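(* Let $B\subset\mathbb R^d$ be a compact convex set containing a neighbourhood of $0$. Consider two Poisson cluster point processes $Z=N$ and $\tilde Z=\tilde N$ in $\mathbb R^d$ with the same intensity, based on the same Poisson process $\Pi$ and with typical clusters $L_0$ and $\tilde L_0$, respectively. Assume that $\tilde L_0$ is distributed as $WL_0=\{Wx:x\in L_0\}$ for some random variable $W\le1$ (any dependence between $W$ and $L_0$ is allowed). Then $Z<_{h-B}\tilde Z$, i.e. the directed $B$-relative empty space hazards satisfy $r_B(t,C)\ge\tilde r_B(t,C)$ for all $t\ge0$ and all Borel sets $C\subset\mathbb R^d$.
   Context: Distances. $B^*:=\{-x:x\in B\}$. For $x\in\mathbb R^d$ and $K\subset\mathbb R^d$, $d_B(x,K):=\inf\{t\ge 0:(x+tB)\cap K\ne\emptyset\}$ (with $\inf\emptyset=\infty$). If $0<d_B(x,K)<\infty$ and $(x+d_B(x,K)B)\cap K=\{y\}$ is a single point, then $u_B(K,x):=(x-y)/d_B(x,K)\in\partial B^*$. Empty space hazard. For a stationary random closed set $Z$ for which $u_B(Z,0)$ is a.s. well defined on $\{0<d_B(0,Z)<\infty\}$ (this holds here), put $u_B(Z,0):=u_0$ for a fixed $u_0\in\partial B^*$ if $0\in Z$ or $d_B(0,Z)=\infty$, and let $F_B(t,C):=P(d_B(0,Z)\le t,\ u_B(Z,0)\in C)$, $F_B(t):=F_B(t,\mathbb R^d)$. $F_B(\cdot,C)$ is absolutely continuous on $(0,\infty)$; $f_B(\cdot,C)$ denotes its density. The directed $B$-relative empty space hazard is $r_B(t,C):=f_B(t,C)/(1-F_B(t))$,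 with $a/0:=0$; $\tilde r_B$ is the hazard of $\tilde Z$. Poisson cluster point process. $N=\bigcup_{x\in\Pi}(L_x+x)$, where $\Pi$ is a stationary Poisson process with intensity $\lambda_\Pi\in(0,\infty)$ and, given $\Pi$, the $L_x$ are i.i.d. finite random point sets distributed as the typical cluster $L_0$; $\gamma:=E\,\mathrm{card}\,L_0\in(0,\infty)$; $N$ has intensity $\lambda_\Pi\gamma$. Standing assumption for both $L_0$ and $\tilde L_0$: the measure $E\big[\sum_{x,y\in L_0,\,x\ne y}\mathbf 1\{x-y\in\cdot\}\big]$ (and its analogue for $\tilde L_0$) is absolutely continuous with respect to Lebesgue measure.
   Formalization: The random variable W is assumed to satisfy 0 ≤ W ≤ 1 almost surely instead of only W ≤ 1, since the claim fails for negative W (e.g. d = 1, B = [-1,1], L_0 = {0,a} with a uniform on [1,2], W = -3). *)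

(* Defs.v *)
From HB Require Import structures.
From mathcomp Require Import all_boot all_order all_algebra.
From mathcomp Require Import all_classical all_reals all_analysis.

Set Implicit Arguments.
Unset Strict Implicit.
Unset Printing Implicit Defensive.

Import Order.TTheory GRing.Theory Num.Theory.
Import numFieldNormedType.Exports.

Local Open Scope classical_set_scope.
Local Open Scope ring_scope.

Section lebesgue_Rd.
Variable R : realType.

Definition borelRd (d : nat) : measurableType _ :=
  g_sigma_algebraType (@open 'rV[R]_d).

Definition borel (d : nat) (A : set 'rV[R]_d) : Prop :=
  measurable (A : set (borelRd d)).

(* Lebesgue measure of a Borel set of R^d, by iterated integration over the
   first coordinate (Cavalieri); it is meaningful on Borel sets only. *)
Fixpoint vol (d : nat) : set 'rV[R]_d -> \bar R :=
  match d with
  | 0%N => fun A => (\1_A 0)%:E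
  | d'.+1 => fun A =>
      (\int[lebesgue_measure]_x
         vol [set v : 'rV[R]_d' | A (row_mx (const_mx x : 'rV[R]_1) v)])%E
  end.

End lebesgue_Rd.

Section empty_space_hazard.
Variables (R : realType) (d : nat).
Local Notation E := 'rV[R]_d.
Implicit Types (B K C : set E) (x y u : E).

Definition reflection B : set E := [set - x | x in B].

Definition boundary B : set E := closure B `\` interior B.

(* x + t B *)
Definition dilate x (t : R) B : set E := [set x + t *: b | b in B].

Definition dB B x K : \bar R :=
  ereal_inf [set t%:E | t in [set t : R | 0 <= t /\ dilate x t B `&` K !=set0]].

(* [u0] is the value wherever the contact direction is not defined *)
Definition uB B (u0 : E) K x : E :=
  xget u0 [set u : E | (0 < dB B x K < +oo)%E /\
    exists2 y, dilate x (fine (dB B x K)) B `&` K = [set y] &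
               u = (fine (dB B x K))^-1 *: (x - y)].

Variables (dT : measure_display) (T : measurableType dT) (P : probability T R).
Implicit Types Z : T -> set E.

Definition FB B (u0 : E) Z (t : R) C : R :=
  fine (P [set w | (dB B 0%R (Z w) <= t%:E)%E /\ C (uB B u0 (Z w) 0)]).

(* [f] is a density of the nondecreasing function [F] on (0, oo) *)
Definition is_density (F f : R -> R) : Prop :=
  [/\ measurable_fun (`]0, +oo[ : set R) f,
      forall t, 0 <= f t &
      forall a b : R, 0 < a -> a <= b ->
        ((F b - F a)%:E = \int[lebesgue_measure]_(t in `]a, b]) (f t)%:E)%E].

Definition directed_density B (u0 : E) Z (f : R -> set E -> R) : Prop :=
  forall C, borel C -> is_density (FB B u0 Z ^~ C) (f ^~ C).

(* r_B(t, C), computed with the versions [f] of the densities;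
   division by 0 yields 0 *)
Definition hazard B (u0 : E) Z (f : R -> set E -> R) (t : R) C : R :=
  f t C / (1 - FB B u0 Z t setT).

(* Z <_{h-B} Z'. Densities being determined only up to null sets, the
   inequality is required for every t >= 0 and every C for suitable versions
   (in particular, the densities must exist), and for almost every t,
   whatever the versions. *)
Definition hazard_order B (u0 : E) Z Z' : Prop :=
  (exists f f' : R -> set E -> R,
     [/\ directed_density B u0 Z f,
         directed_density B u0 Z' f' &
         forall (t : R) C, 0 <= t -> borel C ->
           hazard B u0 Z' f' t C <= hazard B u0 Z f t C]) /\
  (forall f f' : R -> set E -> R,
     directed_density B u0 Z f -> directed_density B u0 Z' f' ->
     forall C, borel C ->
       {ae (@lebesgue_measure R), forall t : R, 0 <= t ->
          hazard B u0 Z' f' t C <= hazard B u0 Z f t C}).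

End empty_space_hazard.

Section random_sets.
Variables (R : realType) (d : nat).
Local Notation E := 'rV[R]_d.

(* the sigma-algebra on point configurations generated by the counting maps *)
Definition count_events : set (set (set E)) :=
  [set G | exists2 A : set E, borel A & exists k : nat,
     G = [set S | counting (S `&` A) = k%:R%:E :> \bar R]].

Definition confRd : measurableType _ := g_sigma_algebraType count_events.

Definition random_finite_set (dT : measure_display) (T : measurableType dT)
    (L : T -> set E) : Prop :=
  (forall w, finite_set (L w)) /\ measurable_fun setT (L : T -> confRd).

Definition same_law (dT dT' : measure_display) (T : measurableType dT)
    (T' : measurableType dT') (P : probability T R) (P' : probability T' R)
    (L : T -> set E) (L' : T' -> set E) : Prop :=
  forall G : set confRd, measurable G -> P (L @^-1` G) = P' (L' @^-1` G).

Definition mean_card (dT : measure_display) (T : measurableType dT)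
    (P : probability T R) (L : T -> set E) : \bar R :=
  (\int[P]_w counting (L w))%E.

(* E [ sum_{x, y in L, x != y} 1{x - y in A} ] *)
Definition difference_measure (dT : measure_display) (T : measurableType dT)
    (P : probability T R) (L : T -> set E) (A : set E) : \bar R :=
  (\int[P]_w counting [set p : E * E |
     [/\ L w p.1, L w p.2, p.1 <> p.2 & A (p.1 - p.2)%R]])%E.

Definition typical_cluster (dT : measure_display) (T : measurableType dT)
    (P : probability T R) (L : T -> set E) : Prop :=
  [/\ random_finite_set L,
      (0 < mean_card P L < +oo)%E &
      forall A : set E, borel A -> vol A = 0%E -> difference_measure P L A = 0%E].

Section poisson_cluster.
Variables (dT : measure_display) (T : measurableType dT) (P : probability T R).

(* The points X 0, X 1, ... (a.s. distinct) enumerate a stationary Poisson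
   process with intensity [lam]. We use [poisson_prob], whose second argument
   is a dummy, since [poisson_pmf] is not a probability mass function at
   rate 0. *)
Definition stationary_poisson (lam : R) (X : nat -> T -> E) : Prop :=
  [/\ forall i, measurable_fun setT (X i : T -> borelRd R d),
      {ae P, forall w, injective (X ^~ w)} &
      forall (n : nat) (A : 'I_n -> set E) (k : 'I_n -> nat),
        (forall i, borel (A i) /\ (vol (A i) < +oo)%E) ->
        trivIset setT A ->
        P [set w | forall i, counting (range (X ^~ w) `&` A i)
                             = (k i)%:R%:E :> \bar R] =
        (\prod_(i < n)
           poisson_prob (lam * fine (vol (A i))) (k i) [set k i])%E].

Definition sigma_points (X : nat -> T -> E) : set (set T) :=
  <<s [set D | exists i, exists2 A : set E, borel A & D = X i @^-1` A] >>.

(* [L i] is the cluster attached to the point [X i]: the L i are i.i.d.,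
   distributed as [L0], and independent of the points. *)
Definition iid_clusters (dT0 : measure_display) (T0 : measurableType dT0)
    (P0 : probability T0 R) (X : nat -> T -> E) (L0 : T0 -> set E)
    (L : nat -> T -> set E) : Prop :=
  [/\ forall i, random_finite_set (L i),
      forall i, same_law P P0 (L i) L0 &
      forall (D : set T) (n : nat) (G : 'I_n -> set confRd),
        sigma_points X D -> (forall i, measurable (G i)) ->
        P (D `&` [set w | forall i : 'I_n, G i (L i w)]) =
        (P D * \prod_(i < n) P (L i @^-1` G i))%E].

Definition cluster_process (X : nat -> T -> E) (L : nat -> T -> set E) (w : T)
    : set E :=
  \bigcup_i [set y + X i w | y in L i w].

End poisson_cluster.
End random_sets.

(* Main.v *)
(** Let g be the gauge of B, so that d_B(0, Z) is the infimum of g over Z. The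
    clusters attached to the points of the Poisson process form a Poisson
    process of pairs (x, L) with intensity lambda times Lebesgue measure times
    the law of the typical cluster, hence P(no pair in S) = exp(- Lambda(S)),
    and P(two pairs in S) <= Lambda(S)^2.

    Let H_t be the set of pairs for which x + L meets tB, and let M_h be the set
    of pairs for which g has a strict minimiser z over x + L, with
    t < g(z) <= t + h and direction -z/g(z) in C. Ties of g have null intensity
    because difference vectors within a cluster have an absolutely continuous
    law. Up to an event of probability O(h^2), on which two clusters reach the
    shell, contact occurs in ]t, t + h] with direction in C iff no pair is in
    H_t and some pair is in M_h, so that
      F(t + h, C) - F(t, C) = (1 - F(t)) (1 - exp(- Lambda(M_h))) + O(h^2).

    Integrating over x first, a configuration L contributes to Lambda(M_h) the
    sum over y in L of the volume of the z in the target with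
    g(z) < g(z + y' - y) for all other y' in L. By convexity of g this volume
    can only decrease when L is contracted to WL. The points of WL are a.s.
    distinct because the mean cluster sizes agree. Dividing by h and letting
    h tend to 0 at Lebesgue points yields the inequality of the hazards. *)

Require Import Defs.
From HB Require Import structures.
From mathcomp Require Import all_boot all_order all_algebra.
From mathcomp Require Import finmap.
From mathcomp Require Import all_classical all_reals all_analysis.
From mathcomp Require Import measurable_realfun.
From mathcomp Require Import ring lra.

Set Implicit Arguments.
Unset Strict Implicit.
Unset Printing Implicit Defensive.

Import Order.TTheory GRing.Theory Num.Theory.
Import numFieldNormedType.Exports.

Local Open Scope classical_set_scope.
Local Open Scope ring_scope.

(** * Borel sets and Lebesgue measure of R^d *)

(** The Poisson process is known only through an enumeration of its points and the joint law of its
    counts in disjoint sets of finite volume, and the clusters only through their law and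
    independence. Void probabilities of the marked process are therefore obtained as limits, over
    the first m points, of products from which the marks are averaged out one at a time. The same
    products with retention probability 1/2 in place of 1 bound the event of two clusters, so a
    finite mean cluster size suffices for the error O(h^2).

    No coupling of the two families of clusters is used. At a fixed t the increment of the
    contracted process is bounded above and that of the original one below, each in terms of the law
    of one typical cluster. Each increment is divided by its own survival probability, so the
    survival probabilities need not be compared.

    Convexity enters the contraction only as quasi-convexity of g along segments. The infimum of g
    over Z may fail to be attained on exceptional samples, hence the slightly enlarged radii.
    Densities have to be shown to exist: increments are Lipschitz in t, which makes the law of the
    contact distance absolutely continuous. *)

Section image_measure.
Context d d' (T : measurableType d) (T' : measurableType d') (R : realType).
Local Open Scope ereal_scope.

(** The measurability proof is an argument of the name, so that the measure instances, which depend
    on it, are found by unification. *)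
Definition image_measure (m : {measure set T -> \bar R}) (f : T -> T')
  (mf : measurable_fun setT f) : set T' -> \bar R := pushforward m f.

Variables (m : {measure set T -> \bar R}) (f : T -> T').
Hypothesis mf : measurable_fun setT f.

Let image0 : image_measure m mf set0 = 0.
Proof. exact: measure0. Qed.

Let image_ge0 A : 0 <= image_measure m mf A.
Proof. exact: measure_ge0. Qed.

Let image_sigma_additive : semi_sigma_additive (image_measure m mf).
Proof. exact: measure_semi_sigma_additive. Qed.

HB.instance Definition _ := isMeasure.Build _ _ _ (image_measure m mf)
  image0 image_ge0 image_sigma_additive.

Lemma ge0_integral_image_measure (h : T' -> \bar R) :
  measurable_fun setT h -> (forall y, 0 <= h y) ->
  \int[image_measure m mf]_y h y = \int[m]_x h (f x).
Proof.
move=> mh h0; rewrite /image_measure.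
by rewrite (ge0_integral_pushforward mf) // preimage_setT.
Qed.

End image_measure.

Section image_probability.
Context d d' (T : measurableType d) (T' : measurableType d') (R : realType).
Variables (P : probability T R) (f : T -> T') (mf : measurable_fun setT f).

Let image_setT : image_measure P mf setT = 1%E.
Proof. by rewrite /image_measure /pushforward preimage_setT; exact: probability_setT. Qed.

HB.instance Definition _ := Measure_isProbability.Build _ _ _
  (image_measure P mf) image_setT.

End image_probability.

Section borel_coordinates.
Context {R : realType} {d : nat}.
Local Notation E := 'rV[R]_d.
Local Notation BE := (borelRd R d).

Lemma open_borel (U : set E) : open U -> measurable (U : set BE).
Proof. by move=> oU; exact: sub_sigma_algebra. Qed.

Lemma closed_borel (U : set E) : closed U -> measurable (U : set BE).
Proof.
move=> cU; rewrite -[X in measurable X]setCK; apply: measurableC.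
by apply: open_borel; exact: closed_openC.
Qed.

Lemma measurable_coord (j : 'I_d) :
  measurable_fun setT (fun v : BE => (v : E) ord0 j).
Proof.
apply: (measurability (@RGenOInfty.G R)).
  exact: RGenOInfty.measurableE.
move=> _ [_ [x ->] <-]; rewrite setTI; apply: open_borel.
apply: open_comp; last exact: interval_open.
by move=> v _; exact: coord_continuous.
Qed.

(** An open set is the union of the boxes with rational corners that it contains, and there are only
    countably many of them. *)
Lemma measurable_fun_coordP dT (T : measurableType dT) (f : T -> E) :
  (forall j, measurable_fun setT (fun w => f w ord0 j)) ->
  measurable_fun setT (f : T -> BE).
Proof.
move=> mf; apply: (@measurability _ _ T BE setT f (@open E)) => //.
move=> _ [U oU <-]; rewrite setTI.
pose box (q : {ffun 'I_d -> rat * rat}) : set E :=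
  [set v | forall j, ratr (q j).1 < v ord0 j < ratr (q j).2].
rewrite (_ : f @^-1` U = \bigcup_(q : {ffun 'I_d -> rat * rat})
    [set w | box q `<=` U /\ box q (f w)]).
  apply: countable_bigcupT_measurable; first exact: countableP.
  move=> q; have [qU|qU] := pselect (box q `<=` U); last first.
    by rewrite (_ : [set w | _] = set0)//; apply/seteqP; split => // w [].
  rewrite (_ : [set w | _] = \bigcap_(j in [set: 'I_d])
     ((fun w => f w ord0 j) @^-1` `]ratr (q j).1, ratr (q j).2[)).
    apply: fin_bigcap_measurable; first exact: finite_finset.
    by move=> j _; rewrite -[X in measurable X]setTI; apply: mf.
  apply/seteqP; split => w /=.
    by move=> [_ bw] j _ /=; rewrite in_itv /=; exact: bw.
  by move=> bw; split => // j; have := bw j I; rewrite /= in_itv.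
apply/seteqP; split => [w /= Uw|w [q _ [qU bq]]]; last exact: qU.
have /nbhs_ballP[e /= e0 eU] : nbhs (f w) U by exact: open_nbhs_nbhs.
have H (j : 'I_d) : exists q : rat * rat,
    [/\ f w ord0 j - e < ratr q.1, (ratr q.1 : R) < f w ord0 j,
      f w ord0 j < ratr q.2 & (ratr q.2 : R) < f w ord0 j + e].
  have /rat_in_itvoo[q1] : f w ord0 j - e < f w ord0 j by lra.
  have /rat_in_itvoo[q2] : f w ord0 j < f w ord0 j + e by lra.
  rewrite !in_itv /= => /andP[? ?] /andP[? ?].
  by exists (q1, q2).
have [q hq] := choice H.
exists [ffun j => q j] => //; split => [v bv|j]; last first.
  by rewrite ffunE; have [_ -> -> _] := hq j.
apply: eU; rewrite /ball /= /mx_ball; split => // i j.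
have := bv j; rewrite ffunE => /andP[v1 v2].
have [q1 q2 q3 q4] := hq j.
rewrite (ord1 i) /ball /= ltr_norml; apply/andP; split.
- by rewrite ltrBrDl; lra.
- by lra.
Qed.

End borel_coordinates.

Section borel_operations.
Context {R : realType} {d : nat}.
Local Notation E := 'rV[R]_d.
Local Notation BE := (borelRd R d).
Context dT (T : measurableType dT).
Implicit Types f g : T -> E.

Lemma measurable_fun_coord f (j : 'I_d) : measurable_fun setT (f : T -> BE) ->
  measurable_fun setT (fun w => f w ord0 j).
Proof. by move=> mf; apply: (measurableT_comp (measurable_coord j) mf). Qed.

Lemma measurable_funD_rV f g : measurable_fun setT (f : T -> BE) ->
  measurable_fun setT (g : T -> BE) ->
  measurable_fun setT ((fun w => f w + g w) : T -> BE).
Proof.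
move=> mf mg; apply: measurable_fun_coordP => j.
under eq_fun do rewrite mxE.
by apply: measurable_funD; exact: measurable_fun_coord.
Qed.

Lemma measurable_funZ_rV (a : T -> R) g : measurable_fun setT a ->
  measurable_fun setT (g : T -> BE) ->
  measurable_fun setT ((fun w => a w *: g w) : T -> BE).
Proof.
move=> mf mg; apply: measurable_fun_coordP => j.
under eq_fun do rewrite mxE.
by apply: measurable_funM => //; exact: measurable_fun_coord.
Qed.

Lemma measurable_funN_rV f : measurable_fun setT (f : T -> BE) ->
  measurable_fun setT ((fun w => - f w) : T -> BE).
Proof.
move=> mf; rewrite (_ : (fun _ => _) = fun w => -1 *: f w).
  exact: measurable_funZ_rV.
by apply/funext => w; rewrite scaleN1r.
Qed.

Lemma measurable_funB_rV f g : measurable_fun setT (f : T -> BE) ->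
  measurable_fun setT (g : T -> BE) ->
  measurable_fun setT ((fun w => f w - g w) : T -> BE).
Proof.
by move=> mf mg; apply: measurable_funD_rV => //; exact: measurable_funN_rV.
Qed.

End borel_operations.

Section rational_halfspaces.
Context {R : realType} {d : nat}.
Local Notation E := 'rV[R]_d.
Local Notation BE := (borelRd R d).

(** A countable family of Borel sets that separates points; it serves to test whether a random set
    is a singleton. *)
Definition halfspace (q : 'I_d * rat) : set E := [set v | v ord0 q.1 < ratr q.2].

Lemma measurable_halfspace q : measurable (halfspace q : set BE).
Proof.
rewrite (_ : halfspace q = (fun v : BE => (v : E) ord0 q.1) @^-1` `]-oo, ratr q.2[).
  by rewrite -[X in measurable X]setTI; apply: measurable_coord.
by apply/seteqP; split => v; rewrite /halfspace /= in_itv.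
Qed.

Lemma halfspace_separated (u v : E) : u <> v ->
  exists q, (halfspace q u /\ ~ halfspace q v) \/ (halfspace q v /\ ~ halfspace q u).
Proof.
move=> uv; have [j /eqP] : exists j, u ord0 j <> v ord0 j.
  apply/existsNP => H; apply: uv; apply/matrixP => i j.
  by rewrite (ord1 i) H.
rewrite neq_lt => /orP[|] /rat_in_itvoo[q]; rewrite in_itv /= => /andP[q1 q2];
  exists (j, q); [left|right]; split => //; rewrite /halfspace /=; apply/negP;
  by rewrite -leNgt ltW.
Qed.

End rational_halfspaces.

Section real_affine.
Context {R : realType}.
Local Notation mu := (@lebesgue_measure R).
Local Open Scope ereal_scope.

Lemma measurable_affine (a s : R) :
  measurable_fun setT (fun x : R => (a + s * x)%R).
Proof.
apply: measurable_funD; first exact: measurable_cst.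
by apply: measurable_funM; [exact: measurable_cst|exact: measurable_id].
Qed.

(** The image of Lebesgue measure under the affine map, multiplied by s, gives every half-open
    interval its length, so it is Lebesgue measure by uniqueness. *)
Lemma ge0_integral_affine (a s : R) (h : R -> \bar R) : (0 < s)%R ->
  measurable_fun setT h -> (forall x, 0 <= h x) ->
  \int[mu]_x h (a + s * x)%R = s^-1%:E * \int[mu]_x h x.
Proof.
move=> s0 mh h0.
pose f : R -> measurableTypeR R := fun x => (a + s * x)%R.
have mf : measurable_fun setT (f : measurableTypeR R -> measurableTypeR R) :=
  measurable_affine a s.
pose m := mscale (NngNum (ltW s0)) (image_measure mu mf).
have mE : forall A, measurable A -> mu A = m A.
  apply: lebesgue_measure_unique => _ [[p q] _ <-].
  rewrite [RHS](_ : _ = s%:E * mu (f @^-1` `]p, q]%classic)) //=.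
  rewrite (_ : f @^-1` _ = `](p - a) / s, (q - a) / s]%classic)%R; last first.
    apply/seteqP; split => x /=; rewrite !in_itv /= ltr_pdivrMr // ler_pdivlMr //;
     by rewrite ltrBlDl lerBrDl (mulrC x).
  rewrite !lebesgue_measure_itv /= !lte_fin ltr_pM2r ?invr_gt0 // ltrD2r.
  case: ifPn => _; last by rewrite mule0.
  by rewrite -!EFinD -EFinM; congr EFin; field; rewrite gt_eqF.
rewrite [X in _ * X](_ : _ = \int[m]_x h x); last first.
  by apply: eq_measure_integral => A mA _; exact: mE.
rewrite /m ge0_integral_mscale //= ge0_integral_image_measure //=.
by rewrite muleA -EFinM mulVf ?mul1e // gt_eqF.
Qed.

End real_affine.

(** * Lebesgue measure of R^d as a sigma-finite measure *)

Section lebesgueRd.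
Context {R : realType}.

Definition rcons0 (d : nat) (p : measurableTypeR R * borelRd R d) :
  borelRd R d.+1 := row_mx (const_mx p.1 : 'rV[R]_1) (p.2 : 'rV[R]_d).

Definition unrcons0 (d : nat) (v : borelRd R d.+1) :
  measurableTypeR R * borelRd R d :=
  ((v : 'rV[R]_d.+1) ord0 ord0, rsubmx (v : 'rV[R]_(1 + d))).

Lemma rcons0K d : cancel (@rcons0 d) (@unrcons0 d).
Proof.
move=> [x v]; rewrite /rcons0 /unrcons0; congr (_, _); last first.
  by rewrite row_mxKr.
have -> : (ord0 : 'I_d.+1) = lshift d (ord0 : 'I_1) by exact: val_inj.
by rewrite (@row_mxEl _ 1 1 d) mxE.
Qed.

Lemma unrcons0K d : cancel (@unrcons0 d) (@rcons0 d).
Proof.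
move=> v; rewrite /rcons0 /unrcons0 /=.
rewrite (_ : const_mx _ = lsubmx (v : 'rV[R]_(1 + d))); first exact: (@hsubmxK R 1 1 d).
apply/matrixP => i j; rewrite !mxE (ord1 i) (ord1 j).
by congr (v _ _); exact: val_inj.
Qed.

Lemma measurable_rcons0 d : measurable_fun setT (@rcons0 d).
Proof.
apply: measurable_fun_coordP => j; rewrite /rcons0.
have [k jk|k jk] := @split_ordP 1 d j.
  under eq_fun do rewrite jk (@row_mxEl _ 1 1 d) mxE.
  exact: measurable_fst.
rewrite (_ : (fun _ => _) =
  fun p : measurableTypeR R * borelRd R d => (p.2 : 'rV[R]_d) ord0 k); last first.
  by apply/funext => p; rewrite jk (@row_mxEr _ 1 1 d).
apply: (@measurable_fun_coord _ _ _ _ (snd : measurableTypeR R * borelRd R d -> 'rV[R]_d)).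
exact: measurable_snd.
Qed.

Lemma measurable_unrcons0 d : measurable_fun setT (@unrcons0 d).
Proof.
apply/measurable_fun_pairP; split; first exact: measurable_coord.
apply: measurable_fun_coordP => j; rewrite /comp /=.
under eq_fun do rewrite mxE.
exact: measurable_coord.
Qed.

Section extend.
Variables (d : nat) (m : {sigma_finite_measure set (borelRd R d) -> \bar R}).

Definition extend_measure : set (borelRd R d.+1) -> \bar R :=
  image_measure (@lebesgue_measure R \x m)%E (@measurable_rcons0 d).

HB.instance Definition _ := Measure.on extend_measure.

Lemma extend_measure_sigma_finite : sigma_finite setT extend_measure.
Proof.
have /sigma_finiteP[F [TF ndF Foo]] := sigma_finiteT (@lebesgue_measure R).
have /sigma_finiteP[G [TG ndG Goo]] := sigma_finiteT m.
exists (fun n => unrcons0 (d := d) @^-1` (F n `*` G n)).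
  rewrite -preimage_bigcup (_ : \bigcup_i _ = setT) ?preimage_setT //.
  apply/seteqP; split => // -[x v] _.
  have [i _ Fx] : (\bigcup_i F i) x by rewrite -TF.
  have [j _ Gv] : (\bigcup_i G i) v by rewrite -TG.
  exists (maxn i j) => //; split.
  - by move: x Fx; exact/subsetPset/ndF/leq_maxl.
  - by move: v Gv; exact/subsetPset/ndG/leq_maxr.
move=> n; have [mF Fn] := Foo n; have [mG Gn] := Goo n; split.
  by rewrite -[X in measurable X]setTI; apply: measurable_unrcons0 => //;
    exact: measurableX.
rewrite /extend_measure /image_measure /pushforward -comp_preimage.
rewrite (_ : _ \o _ = id) ?preimage_id; last by apply/funext => p; exact: rcons0K.
rewrite [X in (X < _)%E](product_measure1E (@lebesgue_measure R) m mF mG).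
by rewrite lte_mul_pinfty // ge0_fin_numE.
Qed.

HB.instance Definition _ := Measure_isSigmaFinite.Build _ _ _ extend_measure
  extend_measure_sigma_finite.

End extend.

(** The set function [vol] carries no measure structure. The same recursion is rebuilt here on
    product measures, which yields sigma-additivity and Fubini; the two agree on Borel sets by
    [vol_lebesgueRd]. *)
Fixpoint lebesgueRd (d : nat) : {sigma_finite_measure set (borelRd R d) -> \bar R} :=
  match d with
  | 0%N => @dirac _ (borelRd R 0) (0 : 'rV[R]_0) R
  | d'.+1 => extend_measure (lebesgueRd d')
  end.

Lemma lebesgueRdS d (A : set (borelRd R d.+1)) :
  lebesgueRd d.+1 A =
  (\int[@lebesgue_measure R]_x lebesgueRd d [set v | A (rcons0 (x, v))])%E.
Proof.
rewrite /= /extend_measure /image_measure /pushforward /product_measure1.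
apply: eq_integral => x _ /=; congr (lebesgueRd d _).
by apply/seteqP; split => v; rewrite /xsection /= inE.
Qed.

Lemma measurable_rcons0_section d (A : set (borelRd R d.+1)) x :
  measurable A -> measurable [set v : borelRd R d | A (rcons0 (x, v))].
Proof.
move=> mA; rewrite (_ : [set v | _] = xsection (rcons0 (d := d) @^-1` A) x).
  by apply: measurable_xsection; rewrite -[X in measurable X]setTI;
    exact: measurable_rcons0.
by apply/seteqP; split => v; rewrite /xsection /= inE.
Qed.

Lemma measurable_fun_rcons0_section d (A : set (borelRd R d.+1)) :
  measurable A ->
  measurable_fun setT
    (fun x : R => lebesgueRd d [set v | A (rcons0 (x, v))]).
Proof.
move=> mA; have mA' : measurable (rcons0 (d := d) @^-1` A).
  by rewrite -[X in measurable X]setTI; exact: measurable_rcons0.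
apply: eq_measurable_fun (measurable_fun_xsection (lebesgueRd d) mA').
move=> x _ /=; congr (lebesgueRd d _).
by apply/seteqP; split => v; rewrite /xsection /= inE.
Qed.

Lemma vol_lebesgueRd d (A : set 'rV[R]_d) : borel A ->
  vol A = lebesgueRd d (A : set (borelRd R d)).
Proof.
elim: d A => [|d IH] A mA; first by rewrite /= diracE indicE.
rewrite lebesgueRdS; apply: eq_integral => x _; rewrite -IH //.
exact: (@measurable_rcons0_section d).
Qed.

(** Induction on the dimension: each slice is transformed by the tail of [a] and the same [s], and
    the integral over the first coordinate supplies one more factor s^-1. *)
Lemma lebesgueRd_affine d (a : 'rV[R]_d) (s : R) (A : set 'rV[R]_d) :
  0 < s -> borel A ->
  (lebesgueRd d [set v | A (a + s *: v)%R] =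
   (s^-1 ^+ d)%:E * lebesgueRd d A)%E.
Proof.
move=> s0; elim: d a A => [|d IH] a A mA.
  rewrite expr0 mul1e /= !diracE; congr (_%:R%:E).
  rewrite (_ : [set v | _] = A) //; apply/seteqP; split => v /=;
    by rewrite (thinmx0 v) (thinmx0 (a + _)).
rewrite !lebesgueRdS; pose a1 := (unrcons0 a).1; pose a2 := (unrcons0 a).2.
transitivity (\int[@lebesgue_measure R]_x ((s^-1 ^+ d)%:E *
    lebesgueRd d [set v | A (rcons0 (a1 + s * x, v)%R)]))%E.
  apply: eq_integral => x _; rewrite -(IH a2); last first.
    exact: (@measurable_rcons0_section d).
  have E (v : 'rV[R]_d) : a + s *: (rcons0 (x, v) : 'rV[R]_d.+1) =
      rcons0 (a1 + s * x, a2 + s *: v) :> 'rV[R]_d.+1.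
    rewrite -[a in LHS]unrcons0K /rcons0 [_ *: _](@scale_row_mx _ 1 1 d).
    rewrite [LHS](@add_row_mx _ 1 1 d); congr (@row_mx _ 1 1 d _ _).
    by apply/matrixP => i j; rewrite !mxE.
  by congr (lebesgueRd d _); apply/funext => v; rewrite /mkset E.
have mh := @measurable_fun_rcons0_section d A mA.
rewrite ge0_integralZl //; last first.
- by rewrite lee_fin exprn_ge0 // invr_ge0 ltW.
- by apply: measurableT_comp mh _; exact: measurable_affine.
rewrite (ge0_integral_affine a1 s0 mh) // muleA -EFinM exprSr //.
Qed.

Lemma lebesgueRd_bounded d (M : R) :
  (lebesgueRd d [set v : 'rV[R]_d | forall j, (`|v ord0 j| <= M)%R] < +oo)%E.
Proof.
elim: d => [|d IH]; first by rewrite /= diracE ltry.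
rewrite /= /extend_measure /image_measure /pushforward.
rewrite (_ : _ @^-1` _ = `[- M, M]%classic `*`
  [set v : 'rV[R]_d | forall j, `|v ord0 j| <= M]).
  rewrite [X in (X < _)%E]product_measure1E //; last first.
    rewrite (_ : [set v | _] = \bigcap_(j in [set: 'I_d])
     ((fun v : borelRd R d => (v : 'rV[R]_d) ord0 j) @^-1` `[- M, M])).
      apply: fin_bigcap_measurable; first exact: finite_finset.
      by move=> j _; rewrite -[X in measurable X]setTI; apply: measurable_coord.
    apply/seteqP; split => v /=.
      by move=> vM j _ /=; rewrite in_itv /= -ler_norml.
    by move=> vM j; have := vM j I; rewrite /= in_itv /= -ler_norml.
  have mM : (lebesgue_measure `[(- M)%R, M]%classic < +oo :> \bar R)%E.
    by rewrite lebesgue_measure_itv /=; case: ifP => // _; rewrite -EFinD ltry.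
  by apply: lte_mul_pinfty; rewrite // ge0_fin_numE.
apply/seteqP; split => [[x v] /= xv|[x v] /= [xM vM] j].
  split => /=.
    rewrite in_itv /= -ler_norml.
    by have := xv (lshift d (ord0 : 'I_1)); rewrite /rcons0 (@row_mxEl _ 1 1 d) mxE.
  by move=> j; have := xv (rshift 1 j); rewrite /rcons0 (@row_mxEr _ 1 1 d).
rewrite /rcons0; have [k ->|k ->] := @split_ordP 1 d j.
  by rewrite (@row_mxEl _ 1 1 d) mxE ler_norml; move: xM; rewrite in_itv.
by rewrite (@row_mxEr _ 1 1 d); exact: vM.
Qed.

End lebesgueRd.

(** * The gauge of a convex body *)

Lemma ge0_small_eq0 (R : realType) (x : \bar R) (C e0 : R) : 0 < e0 -> (0 <= x)%E ->
  (forall e, 0 < e -> e <= e0 -> (x <= (C * e)%:E)%E) -> x = 0%E.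
Proof.
move=> e00 x0 H; apply/eqP; rewrite eq_le x0 andbT.
apply/lee_addgt0Pr => e e1; rewrite add0e.
(* The sign of [C] is arbitrary; this positive majorant can be divided by. *)
have C0 : 0 < `|C| + 1 by rewrite ltr_wpDl.
pose e' := Num.min e0 (e / (`|C| + 1)).
have e'0 : 0 < e' by rewrite lt_min e00 divr_gt0.
apply: (le_trans (H e' e'0 _)); first by rewrite ge_min lexx.
rewrite lee_fin (@le_trans _ _ ((`|C| + 1) * e')) //.
  by rewrite ler_pM2r // (le_trans (ler_norm _)) // lerDl.
by rewrite mulrC -ler_pdivlMr // ge_min lexx orbT.
Qed.

Section gauge.
Context {R : realType} {d : nat}.
Local Notation E := 'rV[R]_d.
Local Notation BE := (borelRd R d).

Definition gauge (B : set E) (z : E) : R :=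
  inf [set t | 0 <= t /\ exists2 b, B b & z = t *: b].

Variable B : set E.
Hypotheses (cB : compact B) (vB : convex_set B) (nB : nbhs (0 : E) B).
Local Notation g := (gauge B).

Lemma convex_comb (x y : E) (k : R) : 0 <= k <= 1 -> B x -> B y ->
  B (k *: x + (1 - k) *: y).
Proof.
move=> /andP[k0 k1] Bx By.
have k01 : Itv.spec (@Itv.num_sem R) (Itv.Real `[0%Z, 1%Z]) k.
  by rewrite /Itv.num_sem /= num_real in_itv /= k0.
have /set_mem := @vB x y (Itv.mk k01) (mem_set Bx) (mem_set By).
by [].
Qed.

Lemma gauge_body0 : B 0.
Proof. exact: nbhs_singleton nB. Qed.

(** The dilates tB increase with t, because B is convex and contains 0. *)
Lemma gauge_nested (z : E) (t s : R) : 0 <= t -> t <= s ->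
  (exists2 b, B b & z = t *: b) -> exists2 b, B b & z = s *: b.
Proof.
move=> t0 ts [b Bb ->]; have [s0|s0] := eqVneq s 0.
  by exists b => //; congr (_ *: _); apply/eqP; rewrite eq_le ts s0.
exists ((t / s) *: b); last by rewrite scalerA mulrC divfK.
have sp : 0 < s by rewrite lt_def s0 (le_trans t0).
have := @convex_comb b 0 (t / s) _ Bb gauge_body0.
rewrite scaler0 addr0; apply.
by rewrite divr_ge0 //= ?ler_pdivrMr ?mul1r // ltW.
Qed.

Lemma gauge_nonempty (z : E) :
  [set t | 0 <= t /\ exists2 b, B b & z = t *: b] !=set0.
Proof.
have /nbhs_ballP[e /= e0 eB] := nB.
have z1 : 0 < `|z| + 1 by rewrite ltr_wpDl.
(* Division by this scale brings z strictly inside the ball of radius e contained in B; the summand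
   1 keeps the scale positive when z = 0. *)
exists ((`|z| + 1) / e); split; first by rewrite divr_ge0 // ltW.
exists (((`|z| + 1) / e)^-1 *: z).
  apply: eB; rewrite -ball_normE /ball_ /= sub0r normrN normrZ.
  rewrite ger0_norm ?invr_ge0 ?divr_ge0 // ?ltW //.
  by rewrite invf_div -mulrA gtr_pMr // mulrC ltr_pdivrMr // mul1r ltrDl.
by rewrite scalerA divff ?scale1r // gt_eqF // divr_gt0.
Qed.

Lemma gauge_has_lbound (z : E) :
  has_lbound [set t | 0 <= t /\ exists2 b, B b & z = t *: b].
Proof. by exists 0 => t []. Qed.

Lemma gauge_ge0 (z : E) : 0 <= g z.
Proof.
by apply: lb_le_inf; [exact: gauge_nonempty|move=> t []].
Qed.

Lemma gauge_gt (z : E) (t : R) : g z < t -> exists2 b, B b & z = t *: b.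
Proof.
move=> gt; have [s [s0 sb] st] := inf_lt (gauge_nonempty z) gt.
by apply: gauge_nested sb => //; exact: ltW.
Qed.

(** The infimum is attained. For t > 0, the points s^-1 z with s > t lie in B and tend to t^-1 z as
    s decreases to t, and B is closed. For t = 0, z lies in eB for every small e, and boundedness of
    B forces z = 0. *)
Lemma gauge_leP (z : E) (t : R) : 0 <= t ->
  g z <= t <-> exists2 b, B b & z = t *: b.
Proof.
move=> t0; split => [gt|zt]; last first.
  by apply: ge_inf => //; exact: gauge_has_lbound.
have H s : t < s -> exists2 b, B b & z = s *: b.
  by move=> ts; apply: gauge_gt; exact: le_lt_trans ts.
have [tz|tz] := eqVneq t 0.
  have [M [Mr MB]] := compact_bounded cB.
  exists 0; first exact: gauge_body0.
  rewrite scaler0; apply/eqP; rewrite -normr_eq0; apply/eqP.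
  suff : (`|z|%:E = 0)%E by move=> [].
  apply: (@ge0_small_eq0 _ _ (`|M| + 1) 1) => // e e0 e1.
  have [|b Bb ->] := H e; first by rewrite tz.
  rewrite lee_fin normrZ gtr0_norm // mulrC ler_pM2r //.
  by apply: (MB (`|M| + 1)); rewrite // (le_lt_trans (ler_norm _)) // ltrDl.
have tp : 0 < t by rewrite lt_def tz.
exists (t^-1 *: z); last by rewrite scalerA divff ?scale1r.
have clB : closed B by apply: compact_closed => //; exact: norm_hausdorff.
apply: (@closed_cvg _ _ (t^'+) _ (fun s => s^-1 *: z) B) => //; last first.
  apply: cvgZr_tmp; apply: cvg_at_right_filter; apply: cvgV => //; exact: cvg_id.
near=> s; have ts : t < s by near: s; exact: nbhs_right_gt.
have [b Bb ->] := H s ts.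
rewrite scalerA mulVf ?scale1r // gt_eqF // (lt_trans tp ts).
Unshelve. all: by end_near. Qed.

(** Quasi-convexity: both endpoints lie in the convex set tB, hence so does the segment. This is the
    only form in which convexity reaches the comparison of clusters. *)
Lemma gauge_segment (z v : E) (t w : R) : 0 <= w <= 1 ->
  g z <= t -> g (z + v) <= t -> g (z + w *: v) <= t.
Proof.
move=> w01 gz gzv; have t0 := le_trans (gauge_ge0 z) gz.
have [b1 Bb1 zE] := (gauge_leP z t0).1 gz.
have [b2 Bb2 zvE] := (gauge_leP (z + v) t0).1 gzv.
apply/(gauge_leP _ t0); exists (w *: b2 + (1 - w) *: b1); first exact: convex_comb.
rewrite scalerDr !scalerA [t * w]mulrC [t * (1 - w)]mulrC -!scalerA -zE -zvE.
by rewrite scalerDr scalerBl scale1r [w *: z + _]addrC -addrA [w *: z + _]addrC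
  subrK addrC.
Qed.

Lemma gauge_eq0 (z : E) : g z <= 0 -> z = 0.
Proof. by move=> /gauge_leP-/(_ (lexx _))[b _ ->]; rewrite scale0r. Qed.

Lemma measurable_gauge_le (t : R) : measurable ([set z | g z <= t] : set BE).
Proof.
have [t0|t0] := ltP t 0.
  rewrite (_ : [set _ | _] = set0) //; apply/seteqP; split => // z /=.
  by move=> /(le_trans (gauge_ge0 z)); rewrite leNgt t0.
have [->|tn] := eqVneq t 0.
  rewrite (_ : [set _ | _] = [set 0]).
    by apply: closed_borel; exact/accessible_closed_set1/hausdorff_accessible/norm_hausdorff.
  apply/seteqP; split => z /=; first exact: gauge_eq0.
  move=> ->; apply/gauge_leP => //; exists 0; first exact: gauge_body0.
  by rewrite scaler0.
rewrite (_ : [set _ | _] = (fun z : BE => t^-1 *: (z : E)) @^-1` B).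
  rewrite -[X in measurable X]setTI; apply: measurable_funZ_rV => //.
  apply: closed_borel; apply: compact_closed => //; exact: norm_hausdorff.
apply/seteqP; split => z /=.
  move=> /gauge_leP-/(_ t0)[b Bb ->]; by rewrite scalerA mulVf ?scale1r.
move=> Bz; apply/(gauge_leP _ t0); exists (t^-1 *: z) => //.
by rewrite scalerA divff ?scale1r.
Qed.

Lemma measurable_gauge : measurable_fun setT (g : BE -> R).
Proof.
apply: (measurability (@RGenOInfty.G R)); first exact: RGenOInfty.measurableE.
move=> _ [_ [x ->] <-]; rewrite setTI.
rewrite (_ : _ @^-1` _ = ~` [set z | g z <= x]).
  by apply: measurableC; exact: measurable_gauge_le.
by apply/seteqP; split => z /=; rewrite in_itv /= andbT ltNge => /negP.
Qed.

Local Notation nu := (lebesgueRd d : set BE -> \bar R).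

Lemma lebesgueRd_shift (a : E) (A : set E) : borel A ->
  nu [set v | A (a + v)] = nu A.
Proof.
move=> mA; have := lebesgueRd_affine a ltr01 mA.
rewrite invr1 expr1n mul1e => <-; congr (lebesgueRd d _).
by apply/funext => v; rewrite /mkset scale1r.
Qed.

Lemma lebesgueRd_body_lty : (nu B < +oo)%E.
Proof.
have [M [Mr MB]] := compact_bounded cB.
apply: le_lt_trans (lebesgueRd_bounded d (`|M| + 1)).
apply: le_measure; rewrite ?inE.
- apply: closed_borel; apply: compact_closed => //; exact: norm_hausdorff.
- rewrite (_ : [set v | _] = \bigcap_(j in [set: 'I_d])
     ((fun v : borelRd R d => (v : 'rV[R]_d) ord0 j) @^-1` `[- (`|M| + 1), `|M| + 1])).
    apply: fin_bigcap_measurable; first exact: finite_finset.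
    by move=> j _; rewrite -[X in measurable X]setTI; apply: measurable_coord.
  apply/seteqP; split => v /=.
    by move=> vM j _ /=; rewrite in_itv /= -ler_norml.
  by move=> vM j; have := vM j I; rewrite /= in_itv /= -ler_norml.
- move=> v Bv j; apply: (@le_trans _ _ `|v|).
    rewrite [leRHS]mx_normrE.
    by apply: (le_bigmax _ (fun i => `|v i.1 i.2|) (ord0, j)).
  by apply: (MB (`|M| + 1)); rewrite // (le_lt_trans (ler_norm _)) // ltrDl.
Qed.

Let K := fine (nu B).

Lemma lebesgueRd_gauge_gt0 (t : R) : 0 < t -> nu [set z | g z <= t] = (t ^+ d * K)%:E.
Proof.
move=> t0.
have mB : borel B.
  by apply: closed_borel; apply: compact_closed => //; exact: norm_hausdorff.
rewrite EFinM /K fineK; last by rewrite ge0_fin_numE ?lebesgueRd_body_lty.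
have := lebesgueRd_affine 0 (_ : 0 < t^-1) mB; rewrite invr_gt0 invrK => /(_ t0) <-.
congr (lebesgueRd d _); apply/seteqP; split => z /=; rewrite add0r.
  move=> /gauge_leP-/(_ (ltW t0))[b Bb ->]; by rewrite scalerA mulVf ?scale1r // gt_eqF.
move=> Bz; apply/(gauge_leP _ (ltW t0)); exists (t^-1 *: z) => //.
by rewrite scalerA divff ?scale1r // gt_eqF.
Qed.

Hypothesis d0 : (0 < d)%N.

(** Radius 0 is squeezed by small radii e, where e^d <= e since the dimension is positive. *)
Lemma lebesgueRd_gauge (t : R) : 0 <= t -> nu [set z | g z <= t] = (t ^+ d * K)%:E.
Proof.
rewrite le_eqVlt => /predU1P[<-|]; last exact: lebesgueRd_gauge_gt0.
rewrite expr0n (gtn_eqF d0) /= mul0r.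
apply: (@ge0_small_eq0 _ _ K 1) => // e e0 e1.
apply: (@le_trans _ _ (nu [set z | g z <= e])).
  by apply: le_measure; rewrite ?inE; [exact: measurable_gauge_le..|];
    move=> z /= /le_trans; apply; exact: ltW.
rewrite lebesgueRd_gauge_gt0 // lee_fin mulrC ler_wpM2l ?fine_ge0 //.
by case: d d0 => // k _; rewrite exprS ler_piMr ?(ltW e0) // exprn_ile1 // ltW.
Qed.

Lemma lebesgueRd_gauge_shell (a b : R) : 0 <= a -> a <= b ->
  nu [set z | a < g z <= b] = ((b ^+ d - a ^+ d) * K)%:E.
Proof.
move=> a0 ab; rewrite (_ : [set z : BE | a < g z <= b] =
    [set z : BE | g z <= b] `\` [set z : BE | g z <= a]); last first.
  apply/seteqP; split => z /=.
    by move=> /andP[az zb]; split => //; apply/negP; rewrite -ltNge.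
  by move=> [zb /negP]; rewrite -ltNge zb => ->.
rewrite [LHS](_ : _ = nu [set z | (g z <= b)%R] - nu [set z | (g z <= a)%R])%E.
  by rewrite !lebesgueRd_gauge // ?(le_trans a0) // -EFinB mulrBl.
rewrite [LHS]measureD; [|exact: measurable_gauge_le..|]; last first.
  apply: (@le_lt_trans _ _ (b ^+ d * K)%:E); last exact: ltry.
  rewrite le_eqVlt; apply/orP; left; apply/eqP.
  exact: lebesgueRd_gauge (le_trans a0 ab).
congr (_ - lebesgueRd d _)%E; apply/seteqP; split => z /=; first by case.
by move=> za; split => //; exact: le_trans ab.
Qed.

(** The derivative at M of the volume t^d K of tB, hence a Lipschitz constant of that volume on
    [0, M]. *)
Definition shell_lip (M : R) : R := d%:R * M ^+ d.-1 * K.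

Lemma shell_lip_ge0 (M : R) : 0 <= M -> 0 <= shell_lip M.
Proof. by move=> M0; rewrite !mulr_ge0 ?exprn_ge0 ?fine_ge0. Qed.

(** b^d - a^d is (b - a) times a sum of d monomials of degree d - 1 in a and b, each at most
    M^(d-1). *)
Lemma lebesgueRd_gauge_shell_le (M a b : R) : 0 <= a -> a <= b -> b <= M ->
  (nu [set z | (a < g z <= b)%R] <= (shell_lip M * (b - a))%:E)%E.
Proof.
move=> a0 ab bM; rewrite lebesgueRd_gauge_shell // lee_fin /shell_lip.
have K0 : 0 <= K by exact: fine_ge0.
rewrite -mulrA [K * _]mulrC mulrA ler_wpM2r // mulrC subrXX ler_wpM2l ?subr_ge0 //.
rewrite (@le_trans _ _ (\sum_(i < d) M ^+ d.-1)) //; last first.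
  by rewrite sumr_const card_ord mulr_natl.
apply: ler_sum => i _.
have b0 : 0 <= b by exact: le_trans ab.
rewrite [leRHS](_ : _ = M ^+ (d.-1 - i) * M ^+ i); last first.
  by rewrite -exprD subnK // -ltnS prednK.
have M0 : 0 <= M by exact: le_trans bM.
by apply: ler_pM; rewrite ?exprn_ge0 // lerXn2r ?nnegrE // (le_trans ab).
Qed.

(** For c > 0 the sphere lies in every shell ]c - e, c], whose volume is of order e. *)
Lemma lebesgueRd_gauge_sphere (c : R) : nu [set z | g z = c] = 0%E.
Proof.
have mc c' : measurable ([set z | g z = c'] : set BE).
  rewrite (_ : [set z | _] = g @^-1` [set c']) //.
  by rewrite -[X in measurable X]setTI; apply: measurable_gauge.
have [c0|c0|->] := ltgtP c 0.
- rewrite (_ : [set _ | _] = set0) ?measure0 //; apply/seteqP; split => // z /= zc.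
  by have := gauge_ge0 z; rewrite zc leNgt c0.
- apply: (@ge0_small_eq0 _ _ (shell_lip c) c) => // e e0 ec.
  have := @lebesgueRd_gauge_shell_le c (c - e) c; rewrite subr_ge0 subKr.
  move=> /(_ ec (ltW _) (lexx _)); rewrite ltrBlDr ltrDl => /(_ e0).
  apply: le_trans; apply: le_measure; rewrite ?inE; first exact: mc.
    rewrite (_ : [set z | _] = g @^-1` `]c - e, c]).
      by rewrite -[X in measurable X]setTI; apply: measurable_gauge.
    by apply/seteqP; split => z /=; rewrite in_itv.
  by move=> z /= ->; rewrite lexx andbT ltrBlDr ltrDl.
- apply/eqP; rewrite eq_le measure_ge0 andbT.
  apply: (@le_trans _ _ (nu [set z | g z <= 0])); last first.
    by rewrite lebesgueRd_gauge // expr0n (gtn_eqF d0) mul0r.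
  apply: le_measure; rewrite ?inE; [exact: mc|exact: measurable_gauge_le|].
  by move=> z /= ->.
Qed.

Lemma dBE (Z : set E) : dB B 0 Z = ereal_inf [set (g z)%:E | z in Z].
Proof.
apply/eqP; rewrite eq_le; apply/andP; split; apply: le_ereal_inf_tmp.
- move=> _ [z Zz <-]; apply: ereal_inf_lbound.
  exists (g z) => //; split; first exact: gauge_ge0.
  have [b Bb zE] := (gauge_leP z (gauge_ge0 z)).1 (lexx _).
  by exists z; split => //; exists b => //; rewrite add0r -zE.
- move=> _ [t [t0 [z [[b Bb <-] Zz]]] <-].
  apply: (@le_trans _ _ (g (0 + t *: b))%:E); first by apply: ereal_inf_lbound; exists (0 + t *: b).
  by rewrite lee_fin; apply/gauge_leP => //; exists b => //; rewrite add0r.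
Qed.

Lemma contactE (Z : set E) (t : R) : 0 <= t ->
  dilate 0 t B `&` Z = [set z | Z z /\ g z <= t].
Proof.
move=> t0; apply/seteqP; split => z /=.
  by move=> [[b Bb <-] Zz]; split => //; apply/gauge_leP => //; exists b => //; rewrite add0r.
move=> [Zz /gauge_leP-/(_ t0)[b Bb zE]]; split => //.
by exists b => //; rewrite add0r zE.
Qed.

End gauge.

(** * Measurability of cluster events *)

Section finite_counting.
Context {R : realType} {d : nat}.
Local Notation E := 'rV[R]_d.
Local Notation BE := (borelRd R d).
Local Notation Conf := (confRd R d).
Local Open Scope ereal_scope.

(* The counting measure of [L], made null on infinite configurations so as to
   be a kernel with finite values. *)
Definition fin_counting (L : set E) : set BE -> \bar R :=
  fun A => if `[< finite_set L >] then counting (L `&` A) else 0.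

Lemma finite_measurable (L : set E) : finite_set L -> measurable (L : set BE).
Proof.
move=> fL; apply: closed_borel.
apply: compact_closed; first exact: norm_hausdorff.
exact: finite_compact.
Qed.

Section measure.
Variable L : set E.

Let fin_counting0 : fin_counting L set0 = 0.
Proof.
by rewrite /fin_counting setI0; case: ifP => // _; exact: (measure0 (@counting BE R)).
Qed.

Let fin_counting_ge0 A : 0 <= fin_counting L A.
Proof.
by rewrite /fin_counting; case: ifP => // _; exact: (measure_ge0 (@counting BE R)).
Qed.

Let fin_counting_sigma_additive : semi_sigma_additive (fin_counting L).
Proof.
move=> F mF tF mUF; rewrite /fin_counting; case: asboolP => fL; last first.
  by under eq_fun do rewrite big1 //; exact: cvg_cst.
rewrite setI_bigcupr.
apply: (@measure_semi_sigma_additive _ _ _ (@counting BE R) (fun n => L `&` F n)).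
- by move=> n; apply: measurableI => //; exact: finite_measurable.
- exact: trivIset_setIl.
- by apply: bigcupT_measurable => n; apply: measurableI => //; exact: finite_measurable.
Qed.

HB.instance Definition _ := isMeasure.Build _ _ _ (fin_counting L)
  fin_counting0 fin_counting_ge0 fin_counting_sigma_additive.

End measure.

Lemma fin_counting_lty L A : fin_counting L A < +oo.
Proof.
rewrite /fin_counting; case: asboolP => fL; last exact: ltry.
by rewrite /counting asboolT ?ltry //; exact: finite_setIl.
Qed.

Lemma fin_counting_eq0 L A : finite_set L ->
  fin_counting L A = 0 <-> forall y, L y -> ~ A y.
Proof.
move=> fL; rewrite /fin_counting asboolT // /counting asboolT; last exact: finite_setIl.
split => [[/eqP]|LA].
  rewrite pnatr_eq0 cardfs_eq0 => /eqP/fset_set_set0 -/(_ (finite_setIl _ fL)) LA y Ly Ay.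
  by have : (L `&` A) y by []; rewrite LA.
rewrite (_ : L `&` A = set0) ?fset_set0 //.
by apply/seteqP; split => // y [Ly] /(LA _ Ly).
Qed.

Lemma measurable_finite_conf : measurable [set L : Conf | finite_set (L : set E)].
Proof.
rewrite (_ : [set L | _] = \bigcup_k [set S : set E | counting (S `&` setT) = k%:R%:E :> \bar R]).
  apply: bigcupT_measurable => k; apply: sub_sigma_algebra.
  by exists setT; [exact: measurableT|exists k].
apply/seteqP; split => [L /= fL|L [k _] /=]; last rewrite setIT /counting.
  by exists #|` fset_set L| => //=; rewrite setIT /counting asboolT.
by case: asboolP.
Qed.

Lemma measurable_fin_counting (A : set BE) : measurable A ->
  measurable_fun setT (fun L : Conf => fin_counting L A).
Proof.
move=> mA _ Y mY; rewrite setTI.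
rewrite (_ : _ @^-1` _ = (\bigcup_k
   ([set L : Conf | finite_set (L : set E)] `&`
     ([set S : set E | counting (S `&` A) = k%:R%:E :> \bar R] `&` [set _ | Y k%:R%:E])))
   `|` (~` [set L : Conf | finite_set (L : set E)] `&` [set _ | Y 0])).
  have mc (Q : Prop) : measurable [set _ : Conf | Q].
    have [q|q] := pselect Q.
      by rewrite (_ : [set _ | _] = setT) //; apply/seteqP; split.
    by rewrite (_ : [set _ | _] = set0) //; apply/seteqP; split.
  apply: measurableU.
    apply: bigcupT_measurable => k; apply: measurableI.
      exact: measurable_finite_conf.
    apply: measurableI => //; apply: sub_sigma_algebra.
    by exists A => //; exists k.
  apply: measurableI => //; apply: measurableC; exact: measurable_finite_conf.
apply/seteqP; split => L /=; rewrite /fin_counting.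
  case: asboolP => fL YL; last by right.
  have cE : counting ((L : set E) `&` A) = #|` fset_set ((L : set E) `&` A)|%:R%:E :> \bar R.
    by rewrite /counting asboolT //; exact: finite_setIl.
  by left; exists #|` fset_set ((L : set E) `&` A)| => //=; rewrite -cE.
move=> [[k _ [fL [Lk Yk]]]|[fL Y0]]; last by rewrite asboolF.
by rewrite asboolT // Lk.
Qed.

End finite_counting.

(** * Events that quantify over the points of a random finite set *)

Section hitting.
Context {R : realType} {d : nat} dT (T : measurableType dT).
Local Notation E := 'rV[R]_d.
Local Notation BE := (borelRd R d).
Local Notation Conf := (confRd R d).
Variable L : T -> set E.
Hypothesis mL : measurable_fun setT (L : T -> Conf).
Local Open Scope ereal_scope.

Definition count_kernel (w : T) : {measure set BE -> \bar R} := fin_counting (L w).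

Let measurable_count_kernel A : measurable A ->
  measurable_fun setT (count_kernel ^~ A).
Proof.
by move=> mA; exact: (measurableT_comp (measurable_fin_counting mA) mL).
Qed.

HB.instance Definition _ := isKernel.Build _ _ _ _ _ count_kernel
  measurable_count_kernel.

(** Here the tested set varies with w. Counting is a kernel with finite values, and measurability of
    sections extends from rectangles to all measurable sets of the product. *)
Lemma measurable_fun_count (A : set (T * BE)) : measurable A ->
  measurable_fun setT (fun w => fin_counting (L w) [set y | A (w, y)]).
Proof.
move=> mA.
have H := @measurable_prod_subset_xsection_kernel _ _ _ _ R
  (count_kernel : R.-ker T ~> BE) setT measurableT.
have [|_] := H _ A mA.
  move=> w; exists (fine (fin_counting (L w) setT) + 1)%R => U mU.
  rewrite /mrestr setIT EFinD fineK; last first.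
    by rewrite ge0_fin_numE // fin_counting_lty.
  apply: (@le_lt_trans _ _ (fin_counting (L w) setT)).
    by apply: le_measure; rewrite ?inE.
  by rewrite lteDl ?lte01 // ge0_fin_numE // fin_counting_lty.
apply: eq_measurable_fun => w _; rewrite /mrestr setIT /=.
by congr (fin_counting _ _); apply/seteqP; split => y; rewrite /xsection /= inE.
Qed.

(** An existential over the points of a configuration is a non-vanishing count. Iterating this, with
    earlier points as parameters, covers events about several points of a cluster. *)
Lemma measurable_hit (A : set (T * BE)) : measurable A ->
  measurable [set w | finite_set (L w) /\ exists2 y, L w y & A (w, y)].
Proof.
move=> mA.
rewrite (_ : [set w | _] = (L @^-1` [set S | finite_set S]) `&`
    (fun w => fin_counting (L w) [set y | A (w, y)]) @^-1` (~` [set 0])).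
  apply: measurableI.
    by rewrite -[X in measurable X]setTI; apply: mL => //; exact: measurable_finite_conf.
  rewrite -[X in measurable X]setTI; apply: measurable_fun_count => //.
  by apply: measurableC; exact: emeasurable_set1.
apply/seteqP; split => w /= [fL].
  by move=> [y Ly Ay]; split => // /fin_counting_eq0-/(_ fL)/(_ _ Ly).
move=> /fin_counting_eq0 => /(_ fL) => /existsNP[y /not_implyP[Ly /contrapT Ay]].
by split => //; exists y.
Qed.

End hitting.

Section measurable_comparisons.
Context dT (T : measurableType dT) {R : realType}.

Lemma measurable_preimageT dT' (T' : measurableType dT') (f : T -> T') (A : set T') :
  measurable_fun setT f -> measurable A -> measurable (f @^-1` A).
Proof. by move=> mf mA; rewrite -[X in measurable X]setTI; exact: mf. Qed.

Lemma measurable_eq_set (A B : set T) : measurable A -> A = B -> measurable B.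
Proof. by move=> mA <-. Qed.

Lemma measurable_ltr (f h : T -> R) : measurable_fun setT f ->
  measurable_fun setT h -> measurable [set w | f w < h w].
Proof.
by move=> mf mh; apply: (measurable_preimageT (measurable_fun_ltr mf mh) (A := [set true])).
Qed.

Lemma measurable_ler (f h : T -> R) : measurable_fun setT f ->
  measurable_fun setT h -> measurable [set w | f w <= h w].
Proof.
by move=> mf mh; apply: (measurable_preimageT (measurable_fun_ler mf mh) (A := [set true])).
Qed.

Lemma measurable_eqr (f h : T -> R) : measurable_fun setT f ->
  measurable_fun setT h -> measurable [set w | f w = h w].
Proof.
move=> mf mh; rewrite (_ : [set w | _] = (fun w => f w == h w) @^-1` [set true]).
  by apply: measurable_preimageT => //; exact: measurable_fun_eqr.
by apply/seteqP; split => w /= /eqP.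
Qed.

Lemma measurable_setU_Prop (Q : Prop) : measurable [set _ : T | Q].
Proof.
have [q|q] := pselect Q.
  by rewrite (_ : [set _ | _] = setT) //; apply/seteqP; split.
by rewrite (_ : [set _ | _] = set0) //; apply/seteqP; split.
Qed.

Lemma measurable_neq_rV d (f h : T -> 'rV[R]_d) :
  measurable_fun setT (f : T -> borelRd R d) ->
  measurable_fun setT (h : T -> borelRd R d) -> measurable [set w | f w <> h w].
Proof.
move=> mf mh.
rewrite (_ : [set w | _] = (fun w => f w - h w) @^-1` (~` [set (0 : 'rV[R]_d)])).
  apply: (@measurable_preimageT _ (borelRd R d)); first exact: measurable_funB_rV.
  by apply: measurableC; apply: finite_measurable; exact: finite_set1.
apply/seteqP; split => w /= fh; first by move/subr0_eq.
by move=> e; apply: fh; rewrite e subrr.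
Qed.

End measurable_comparisons.

Section cluster_events.
Context {R : realType} {d : nat}.
Local Notation E := 'rV[R]_d.
Local Notation BE := (borelRd R d).
Local Notation Conf := (confRd R d).
Local Notation nu := (lebesgueRd d : set BE -> \bar R).

Variable g : E -> R.
Hypothesis mg : measurable_fun setT (g : BE -> R).

(** Finiteness of the configuration is part of this event and of the next two, since
    [measurable_hit] yields existence together with finiteness. *)
Definition hits_ball (t : R) : set (BE * Conf) :=
  [set p | finite_set (p.2 : set E) /\
    exists2 y, (p.2 : set E) y & g ((p.1 : E) + y) <= t].

Definition strict_min (G : set E) : set (BE * Conf) :=
  [set p | finite_set (p.2 : set E) /\ exists2 y, (p.2 : set E) y &
    G ((p.1 : E) + y) /\ forall y', (p.2 : set E) y' -> y' <> y ->
      g ((p.1 : E) + y) < g ((p.1 : E) + y')].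

Definition tied : set (BE * Conf) :=
  [set p | finite_set (p.2 : set E) /\ exists2 y, (p.2 : set E) y &
    exists2 y', (p.2 : set E) y' & y <> y' /\
      g ((p.1 : E) + y) = g ((p.1 : E) + y')].

Let p1 (T : Type) (q : (BE * Conf) * T) : E := q.1.1.
Let p2 (T : Type) (q : (BE * Conf) * T) : set E := q.1.2.

Let mp1 d' (T : measurableType d') : measurable_fun setT (@p1 T : _ -> BE).
Proof. exact: (measurableT_comp measurable_fst measurable_fst). Qed.

Let mp2 d' (T : measurableType d') : measurable_fun setT (@p2 T : _ -> Conf).
Proof. exact: (measurableT_comp measurable_snd measurable_fst). Qed.

Let mg1 : measurable_fun setT (fun q : (BE * Conf) * BE => g (@p1 _ q + (q.2 : E))).
Proof.
apply: (measurableT_comp mg); apply: measurable_funD_rV; first exact: mp1.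
exact: measurable_snd.
Qed.

Let mg11 : measurable_fun setT
  (fun q : (BE * Conf) * BE * BE => g ((q.1.1.1 : E) + (q.1.2 : E))).
Proof. exact: (measurableT_comp mg1 measurable_fst). Qed.

Let mg12 : measurable_fun setT
  (fun q : (BE * Conf) * BE * BE => g ((q.1.1.1 : E) + (q.2 : E))).
Proof.
apply: (measurableT_comp mg); apply: measurable_funD_rV; last exact: measurable_snd.
exact: (measurableT_comp measurable_fst (measurableT_comp measurable_fst measurable_fst)).
Qed.

Let mneq : measurable [set q : (BE * Conf) * BE * BE | (q.1.2 : E) <> (q.2 : E)].
Proof.
apply: measurable_neq_rV; last exact: measurable_snd.
exact: (measurableT_comp measurable_snd measurable_fst).
Qed.

Lemma measurable_hits_ball t : measurable (hits_ball t).
Proof.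
apply: (measurable_hit (T := (BE * Conf)%type) (L := snd) measurable_snd
  (A := [set q | g (@p1 _ q + (q.2 : E)) <= t])).
exact: measurable_ler.
Qed.

(** The point y is a strict minimiser iff no other point does at least as well. The event [mdom]
    that some other point does lives on triples (x, L, y); its complement is then fed to a second
    existential over y. *)
Lemma measurable_strict_min (G : set BE) : measurable G -> measurable (strict_min G).
Proof.
move=> mG.
have mdom := measurable_hit (T := ((BE * Conf) * BE)%type) (L := @p2 _) (@mp2 _ BE)
  (A := [set q | (q.1.2 : E) <> (q.2 : E)] `&`
     [set q | g ((q.1.1.1 : E) + (q.2 : E)) <= g ((q.1.1.1 : E) + (q.1.2 : E))])
  (measurableI _ _ mneq (measurable_ler mg12 mg11)).
have mG1 : measurable [set q : (BE * Conf) * BE | G (@p1 _ q + (q.2 : E))].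
  apply: (measurable_preimageT _ mG); apply: measurable_funD_rV; first exact: mp1.
  exact: measurable_snd.
apply: (measurable_eq_set (measurable_hit (T := (BE * Conf)%type) (L := snd)
  measurable_snd (measurableI _ _ mG1 (measurableC mdom)))).
apply/seteqP; split => p /=.
  move=> [fp [y py [Gy ny]]]; split => //; exists y => //; split => // y' py' yy'.
  rewrite ltNge; apply/negP => le; apply: ny; split => //.
  by exists y' => //; split => // e; exact: yy'.
move=> [fp [y py [Gy ny]]]; split => //; exists y => //; split => // -[_ [y' py' [yy' le]]].
by have := ny _ py' (fun e => yy' (esym e)); rewrite ltNge le.
Qed.

Lemma measurable_tied : measurable tied.
Proof.
have mdom := measurable_hit (T := ((BE * Conf) * BE)%type) (L := @p2 _) (@mp2 _ BE)
  (A := [set q | (q.1.2 : E) <> (q.2 : E)] `&`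
     [set q | g ((q.1.1.1 : E) + (q.1.2 : E)) = g ((q.1.1.1 : E) + (q.2 : E))])
  (measurableI _ _ mneq (measurable_eqr mg11 mg12)).
apply: (measurable_eq_set
  (measurable_hit (T := (BE * Conf)%type) (L := snd) measurable_snd mdom)).
apply/seteqP; split => p /=.
  by move=> [fp [y py [_ [y' py' H]]]]; split => //; exists y => //; exists y'.
by move=> [fp [y py [y' py' H]]]; split => //; exists y => //; split => //; exists y'.
Qed.

End cluster_events.

(** * Volumes of sets of cluster positions *)

Section cluster_volumes.
Context {R : realType} {d : nat}.
Local Notation E := 'rV[R]_d.
Local Notation BE := (borelRd R d).
Local Notation Conf := (confRd R d).
Local Notation nu := (lebesgueRd d : set BE -> \bar R).

Variable g : E -> R.
Hypothesis mg : measurable_fun setT (g : BE -> R).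

Let mgD (v : E) : measurable_fun setT (fun z : BE => g ((z : E) + v)).
Proof.
by apply: (measurableT_comp mg); apply: measurable_funD_rV => //; exact: measurable_cst.
Qed.

(** Admissible locations z = x + y of the minimiser itself. In this variable the other points sit at
    z + (y' - y), so that only difference vectors of L matter. *)
Let free (G : set E) (L : set E) (y : E) : set BE :=
  [set z | G z /\ forall y', L y' -> y' <> y -> g z < g ((z : E) + (y' - y))].

Let measurable_free (G : set BE) (L : set E) y : measurable G -> finite_set L ->
  measurable (free G L y).
Proof.
move=> mG fL; rewrite (_ : free G L y = G `&` \bigcap_(y' in L)
    [set z : BE | y' <> y -> g z < g ((z : E) + (y' - y))]).
  apply: measurableI => //; apply: fin_bigcap_measurable => // y' Ly'.
  have [->|/eqP yy'] := eqVneq y' y.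
    by rewrite (_ : [set z | _] = setT) //; apply/seteqP; split => // z _ /(_ erefl).
  rewrite (_ : [set z | _] = [set z : BE | g z < g ((z : E) + (y' - y))]).
    exact: measurable_ltr.
  by apply/seteqP; split => z /= => [/(_ yy')|H _].
by apply/seteqP; split => z /= [Gz H]; split => // y' Ly'; exact: H.
Qed.

(** A strict minimiser is unique, so the positions x split disjointly according to it, and each
    piece is a translate of [free G L y]. *)
Lemma lebesgueRd_strict_min (G : set BE) (L : set E) : measurable G ->
  finite_set L ->
  nu [set x | strict_min g G (x, L)] = \sum_(y \in L) nu (free G L y).
Proof.
move=> mG fL; pose V y : set BE := [set x | free G L y (y + (x : E))].
have VE y : V y = [set x : BE | G ((x : E) + y) /\
    forall y', L y' -> y' <> y -> g ((x : E) + y) < g ((x : E) + y')].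
  apply/funext => x; rewrite /V /free /mkset [y + _]addrC; congr (_ /\ _).
  by apply: eq_forall => y'; rewrite -addrA subrKC.
rewrite (_ : [set x | _] = \bigcup_(y in L) V y); last first.
  apply/seteqP; split => x /=.
    by move=> [_ [y Ly H]]; exists y => //; rewrite VE.
  by move=> [y Ly]; rewrite VE => H; split => //; exists y.
have mV y : measurable (V y).
  apply: measurable_preimageT (measurable_free y mG fL).
  by apply: measurable_funD_rV => //; exact: measurable_cst.
rewrite measure_fin_bigcup //.
  by apply: eq_fsbigr => y _; exact: (lebesgueRd_shift y (measurable_free y mG fL)).
apply/trivIsetP => y y' Ly Ly' yy'; apply/seteqP; split => // x; rewrite !VE /=.
move=> [[_ H] [_ H']]; have := H _ Ly'; have := H' _ Ly.
have n1 : y <> y' by apply/eqP.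
have n2 : y' <> y by move=> e; apply: n1.
by move=> /(_ n1) h1 /(_ n2); rewrite ltNge ltW.
Qed.

Hypothesis g_segment : forall (z v : E) (t w : R), 0 <= w <= 1 ->
  g z <= t -> g (z + v) <= t -> g (z + w *: v) <= t.

(* If the shrunk competitor [z + w (y' - y)] stays outside the body of gauge
   [g z], then by convexity so does the original competitor [z + (y' - y)]. *)
Lemma lebesgueRd_strict_min_contract (G : set BE) (L : set E) (w : R) :
  measurable G -> finite_set L -> 0 <= w <= 1 -> set_inj L (fun y => w *: y) ->
  (nu [set x | strict_min g G (x, [set (w *: y)%R | y in L])] <=
   nu [set x | strict_min g G (x, L)])%E.
Proof.
move=> mG fL w01 iw.
rewrite !lebesgueRd_strict_min //; last exact: finite_image.
rewrite fsbig_image //; apply: lee_fsum => // y Ly.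
apply: le_measure; rewrite ?inE.
- by apply: measurable_free => //; exact: finite_image.
- exact: measurable_free.
move=> z [Gz H]; split => // y' Ly' yy'.
have : g z < g ((z : E) + (w *: y' - w *: y)).
  apply: H; first by exists y'.
  by move=> /iw; rewrite !inE => /(_ Ly' Ly).
rewrite -scalerBr => lt; rewrite ltNge; apply/negP => le.
by have := g_segment w01 (lexx (g z)) le; rewrite leNgt lt.
Qed.

(** Union bound: some point y of L puts x + y into the shell, and for each y these x form a
    translate of the shell. *)
Lemma lebesgueRd_shell_le (L : set E) (a b c : R) : finite_set L ->
  (nu [set z | (a < g z <= b)%R] <= c%:E)%E ->
  (nu [set x | hits_ball g b (x, L) /\ ~ hits_ball g a (x, L)] <=
   counting L * c%:E)%E.
Proof.
move=> fL abc; pose F y := [set x : BE | a < g ((x : E) + y) <= b].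
have mF y : measurable (F y).
  rewrite (_ : F y = (fun x : BE => g ((x : E) + y)) @^-1` `]a, b]).
    exact: measurable_preimageT.
  by apply/seteqP; split => x /=; rewrite in_itv.
have mH t : measurable [set x | hits_ball g t (x, L)].
  exact: (measurable_preimageT (pair2_measurable (L : Conf)) (measurable_hits_ball mg t)).
apply: (@le_trans _ _ (\sum_(y \in L) nu (F y))%E).
  apply: content_sub_fsum => //.
    exact: (measurableD (mH b) (mH a)).
  move=> x [[_ [y Ly gy]] Ha]; exists y => //; rewrite /F /= gy andbT ltNge.
  by apply/negP => gya; apply: Ha; split => //; exists y.
apply: (@le_trans _ _ (\sum_(y \in L) c%:E)%E).
  apply: lee_fsum => // y Ly.
  rewrite (_ : F y = [set x : BE | (a < g (y + (x : E)) <= b)%R]); last first.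
    by apply/funext => x; rewrite /F /mkset addrC.
  rewrite (lebesgueRd_shift y (A := [set z | a < g z <= b])) //.
  rewrite /borel (_ : [set z | _] = g @^-1` `]a, b]).
    exact: measurable_preimageT.
  by apply/seteqP; split => x /=; rewrite in_itv.
rewrite fsbig_finite // /counting asboolT // sumEFin -EFinM lee_fin.
by rewrite big_const_seq count_predT iter_addr_0 mulr_natl.
Qed.

(** Union bound over ordered pairs of distinct points; the positions at which a given pair ties form
    a translate of the null set assumed for its difference vector. *)
Lemma lebesgueRd_tied (L : set E) : finite_set L ->
  (forall y y', L y -> L y' -> y <> y' ->
     nu [set z | g z = g ((z : E) + (y' - y))] = 0%E) ->
  nu [set x | tied g (x, L)] = 0%E.
Proof.
move=> fL H; apply/eqP; rewrite eq_le measure_ge0 andbT.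
pose F (yy : E * E) : set BE := [set x : BE | yy.1 <> yy.2 /\
   g ((x : E) + yy.1) = g ((x : E) + yy.2)].
have FE (y y' : E) : y <> y' -> F (y, y') =
    [set x : BE | [set z | g z = g (z + (y' - y))] (y + (x : E))].
  move=> yy'; rewrite /F /=; apply/seteqP; split => x /=.
    by move=> [_]; rewrite [y + _]addrC -addrA subrKC.
  by rewrite [y + _]addrC -addrA subrKC.
have F0 (y y' : E) : y = y' -> F (y, y') = set0.
  by move=> ->; apply/seteqP; split => // x [].
have mG (v : E) : measurable ([set z | g z = g (z + v)] : set BE).
  exact: measurable_eqr.
apply: (@le_trans _ _ (\sum_(yy \in L `*` L) nu (F yy))%E).
  apply: content_sub_fsum => //.
  - exact: finite_setX.
  - move=> [y y'] _; have [yy'|/eqP yy'] := eqVneq y y'; first by rewrite F0.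
    rewrite FE //; apply: measurable_preimageT (mG _).
    by apply: measurable_funD_rV => //; exact: measurable_cst.
  - exact: (measurable_preimageT (pair2_measurable (L : Conf)) (measurable_tied mg)).
  - by move=> x [_ [y Ly [y' Ly' h]]]; exists (y, y').
rewrite fsbig1 // => -[y y'] [/= Ly Ly'].
have [yy'|/eqP yy'] := eqVneq y y'; first by rewrite F0 // measure0.
by rewrite FE // lebesgueRd_shift; [exact: H|exact: mG].
Qed.

End cluster_volumes.

(** * Intensities of clusters *)

(** Markov's bound for an integrand of unknown measurability: the integral of a nonnegative function
    is a supremum over the simple functions below it, and the indicator of A is one of them. It is
    meant for the integrand of [difference_measure]. *)
Lemma measure_le_integral d (T : measurableType d) (R : realType)
    (mu : {measure set T -> \bar R}) (A : set T) (f : T -> \bar R) :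
  measurable A -> (forall x, 0 <= f x)%E -> (forall x, A x -> 1 <= f x)%E ->
  (mu A <= \int[mu]_x f x)%E.
Proof.
move=> mA f0 f1; rewrite ge0_integralTE //; apply: ereal_sup_ubound => /=.
exists (indic_nnsfun R mA); last exact: sintegral_indic.
move=> x; rewrite /= /mindic indicE; have [xA|_] := boolP (x \in A); last exact: f0.
by apply: f1; rewrite inE in xA.
Qed.

Lemma product_measureC d1 d2 (T1 : measurableType d1) (T2 : measurableType d2)
    (R : realType) (m1 : {sigma_finite_measure set T1 -> \bar R})
    (m2 : {sigma_finite_measure set T2 -> \bar R}) (A : set (T1 * T2)) :
  measurable A -> ((m1 \x m2) A = (m1 \x^ m2) A)%E.
Proof.
move=> mA; apply: (product_measure_unique (m' := (m1 \x^ m2)%E)) => // U V mU mV.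
exact: product_measure2E.
Qed.

(** If two points had the same image, one of them could be removed from L without changing the
    image, which would then have fewer elements than L. *)
Lemma card_image_inj (T U : choiceType) (f : T -> U) (L : set T) : finite_set L ->
  #|` fset_set (f @` L)| = #|` fset_set L| -> set_inj L f.
Proof.
move=> fL cE y y' /set_mem Ly /set_mem Ly' fyy'.
apply: contrapT => /eqP yy'; move: cE; apply/eqP; rewrite ltn_eqF //.
rewrite (_ : f @` L = f @` (L `\ y)).
  rewrite fset_set_image; last exact: finite_setD.
  apply: leq_ltn_trans (leq_imfset_card _ _ _) _ => /=.
  rewrite [X in (_ < X)%N](cardfsD1 y) in_fset_set // mem_set //= add1n ltnS.
  by rewrite fset_setD1.
apply/seteqP; split => [_ [z Lz <-]|_ [z [Lz _] <-]]; last by exists z.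
have [->|/eqP zy] := eqVneq z y; last by exists z.
by exists y' => //; split => // e; rewrite e eqxx in yy'.
Qed.

Section cluster_intensity.
Context {R : realType} {d : nat}.
Local Notation E := 'rV[R]_d.
Local Notation BE := (borelRd R d).
Local Notation Conf := (confRd R d).
Local Notation nu := (lebesgueRd d : set BE -> \bar R).
Context dT (T : measurableType dT) (P : probability T R).
Variable L : T -> set E.
Hypothesis mL : measurable_fun setT (L : T -> Conf).
Local Open Scope ereal_scope.

Lemma cluster_intensityE (S : set (BE * Conf)) : measurable S ->
  (lebesgueRd d \x image_measure P mL) S = \int[P]_w nu [set x | S (x, L w)].
Proof.
move=> mS; rewrite product_measureC // /product_measure2.
rewrite ge0_integral_image_measure //; last exact: measurable_fun_ysection.
apply: eq_integral => w _ /=; congr (lebesgueRd d _).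
by apply/seteqP; split => x; rewrite /ysection /= inE.
Qed.

Lemma measurable_fun_section (S : set (BE * Conf)) : measurable S ->
  measurable_fun setT (fun w => nu [set x | S (x, L w)]).
Proof.
move=> mS; have := measurableT_comp (measurable_fun_ysection (lebesgueRd d) mS) mL.
apply: eq_measurable_fun => w _ /=; congr (lebesgueRd d _).
by apply/seteqP; split => x; rewrite /ysection /= inE.
Qed.

Hypothesis fL : forall w, finite_set (L w).

Lemma countingE (M : set E) : finite_set M -> counting M = fin_counting M setT :> \bar R.
Proof. by move=> fM; rewrite /fin_counting setIT asboolT. Qed.

Lemma measurable_counting : measurable_fun setT (fun w => counting (L w) : \bar R).
Proof.
have := measurableT_comp (measurable_fin_counting (@measurableT _ BE)) mL.
by apply: eq_measurable_fun => w _ /=; rewrite countingE.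
Qed.

(** A pair with difference in A makes the integrand at least 1, so the probability of such a pair is
    at most the vanishing mean. *)
Lemma difference_measure_eq0 (A : set BE) : measurable A ->
  difference_measure P L A = 0 ->
  {ae P, forall w, forall y y', L w y -> L w y' -> y <> y' -> ~ A ((y : E) - y')%R}.
Proof.
move=> mA A0; pose D := [set q : T * BE * BE | (q.1.2 : E) <> (q.2 : E)] `&`
   [set q : T * BE * BE | A ((q.1.2 : E) - (q.2 : E))%R].
have mD : measurable D.
  have m1 : measurable_fun setT (fun q : T * BE * BE => q.1.2).
    exact: (measurableT_comp measurable_snd measurable_fst).
  apply: measurableI.
    by apply: measurable_neq_rV; last exact: measurable_snd.
  apply: (measurable_preimageT _ mA).
  by apply: measurable_funB_rV => //; exact: measurable_snd.
have mL1 : measurable_fun setT ((fun q : T * BE => L q.1) : T * BE -> Conf).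
  exact: (measurableT_comp mL measurable_fst).
have mN := measurable_hit mL (measurable_hit mL1 mD).
set N := [set w | _] in mN.
exists N; split => //.
  apply/eqP; rewrite eq_le measure_ge0 andbT -A0; apply: measure_le_integral => //.
    by move=> w; rewrite /counting; case: ifP => // _; rewrite ?lee_fin ?leey.
  move=> w [_ [y Ly [_ [y' Ly' [yy' Ayy']]]]].
  set Q := [set p | _]; have fQ : finite_set Q.
    apply: (sub_finite_set (B := L w `*` L w)); last exact: finite_setX.
    by move=> [z z'] [].
  rewrite /counting asboolT // lee_fin ler1n lt0n cardfs_eq0; apply/eqP.
  move/fset_set_set0 => /(_ fQ) Q0; suff : Q (y, y') by rewrite Q0.
  by split.
move=> w /existsNP[y /existsNP[y' /not_implyP[Ly /not_implyP[Ly'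
  /not_implyP[yy' /contrapT Ayy']]]]].
by split => //; exists y => //; split => //; exists y'.
Qed.

End cluster_intensity.

(** * Ties of the gauge *)

Section ties.
Context {R : realType} {d : nat}.
Local Notation E := 'rV[R]_d.
Local Notation BE := (borelRd R d).
Local Notation Conf := (confRd R d).
Local Notation nu := (lebesgueRd d : set BE -> \bar R).
Variable g : E -> R.
Hypothesis mg : measurable_fun setT (g : BE -> R).
Hypothesis g_sphere : forall c, nu [set z | g z = c] = 0%E.

Let equidistant : set (BE * BE) :=
  [set p | g p.2 = g ((p.2 : E) + (p.1 : E))].

Let measurable_equidistant : measurable equidistant.
Proof.
apply: measurable_eqr; first exact: (measurableT_comp mg measurable_snd).
apply: (measurableT_comp mg); apply: measurable_funD_rV.
  exact: measurable_snd.
exact: measurable_fst.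
Qed.

(** The exceptional difference vectors. For bodies with flat faces, such as a cube, the bisector of
    z and z + v can have positive volume for some v, so ties cannot be excluded for every
    configuration; absolute continuity of the differences removes these v. *)
Definition tie_shifts : set BE :=
  [set v | nu [set z | g z = g ((z : E) + (v : E))] <> 0%E].

Let tie_shiftsE : tie_shifts = (nu \o xsection equidistant) @^-1` (~` [set 0%E]).
Proof.
apply/funext => v; rewrite /tie_shifts /mkset /preimage /= /setC /mkset.
congr (~ (lebesgueRd d _ = _)); apply/seteqP; split => z;
  by rewrite /xsection /= inE.
Qed.

Lemma measurable_tie_shifts : measurable tie_shifts.
Proof.
rewrite tie_shiftsE; apply: measurable_preimageT.
  exact: measurable_fun_xsection.
by apply: measurableC; exact: emeasurable_set1.
Qed.

(* Fubini: for a fixed [z], the shifts [v] with [g (z + v) = g z] fill a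
   translated sphere. *)
Lemma lebesgueRd_tie_shifts : nu tie_shifts = 0%E.
Proof.
have H : ((lebesgueRd d \x lebesgueRd d) equidistant = 0)%E.
  rewrite product_measureC // /product_measure2.
  apply: integral0_eq => z _ /=; rewrite -[RHS](g_sphere (g z)).
  rewrite -(lebesgueRd_shift z (A := [set u | g u = g z])).
    congr (lebesgueRd d _); apply/seteqP; split => v;
      by rewrite /ysection /equidistant /= inE /= => ->.
  exact: (measurable_preimageT mg (measurable_set1 (g z))).
have mx : measurable_fun setT ((nu : set BE -> \bar R) \o xsection equidistant).
  exact: measurable_fun_xsection.
have : (\int[lebesgueRd d]_v `|(nu \o xsection equidistant) v|)%E = 0%E.
  by rewrite -[RHS]H; apply: eq_integral => v _; rewrite gee0_abs.
move/(ae_eq_integral_abs (lebesgueRd d) measurableT mx).1 => [N [mN N0 sN]].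
apply/eqP; rewrite eq_le measure_ge0 andbT -N0.
apply: le_measure; rewrite ?inE //; first exact: measurable_tie_shifts.
by rewrite tie_shiftsE => v v0; apply: sN => /= H'; apply: v0; exact: H'.
Qed.

Context dT (T : measurableType dT) (P : probability T R) (L : T -> set E).
Hypotheses (mL : measurable_fun setT (L : T -> Conf)) (fL : forall w, finite_set (L w)).

Lemma cluster_intensity_tied : difference_measure P L tie_shifts = 0%E ->
  ((lebesgueRd d \x image_measure P mL) (tied g) = 0)%E.
Proof.
move=> /(difference_measure_eq0 mL fL measurable_tie_shifts) H.
rewrite cluster_intensityE; last exact: measurable_tied.
rewrite -[RHS](integral0 P setT); apply: ae_eq_integral => //.
- by apply: measurable_fun_section => //; exact: measurable_tied.
- apply: filterS H => w Hw _; apply: lebesgueRd_tied => // y y' Ly Ly' yy'.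
  by apply: contrapT; apply: Hw => // e; exact: yy'.
Qed.

End ties.

(** * Clusters contracted by a random factor *)

Section contraction.
Context {R : realType} {d : nat}.
Local Notation E := 'rV[R]_d.
Local Notation BE := (borelRd R d).
Local Notation Conf := (confRd R d).
Local Notation nu := (lebesgueRd d : set BE -> \bar R).
Context dT (T : measurableType dT) (P : probability T R).
Variables (L : T -> set E) (W : T -> R).
Hypotheses (mL : measurable_fun setT (L : T -> Conf)) (fL : forall w, finite_set (L w)).
Hypothesis mW : measurable_fun setT W.

Definition scaled_cluster (w : T) : set E := [set W w *: x | x in L w].

Lemma finite_scaled_cluster w : finite_set (scaled_cluster w).
Proof. exact: finite_image. Qed.

(** Where W is nonzero, scaling is injective and the points of WL in A are counted by the points y
    of L with Wy in A. Where W = 0, the cluster collapses to {0}, or to the empty set if L is empty,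
    and its count in A is constant on each of these two events. *)
Lemma measurable_scaled_cluster : measurable_fun setT (scaled_cluster : T -> Conf).
Proof.
apply: (@measurability _ _ T Conf setT scaled_cluster (@count_events R d)) => //.
move=> _ [_ [A mA [k ->]] <-]; rewrite setTI.
pose Z := [set w : T | W w = 0].
have mZ : measurable Z by exact: (measurable_preimageT mW (measurable_set1 0)).
pose Em := [set w : T | fin_counting (L w) setT = 0%E].
have mEm : measurable Em.
  apply: (@measurable_preimageT _ _ _ _ (fun w => fin_counting (L w) setT) [set 0%E]).
    exact: (measurableT_comp (measurable_fin_counting (@measurableT _ BE)) mL).
  exact: emeasurable_set1.
have mA' : measurable [set q : T * BE | A (W q.1 *: (q.2 : E))].
  apply: (@measurable_preimageT _ _ _ BE _ A); last exact: mA.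
  apply: measurable_funZ_rV; last exact: measurable_snd.
  exact: (measurableT_comp mW measurable_fst).
have := measurable_fun_count mL mA' => mC.
rewrite (_ : _ @^-1` _ =
   (~` Z `&` [set w | fin_counting (L w) [set y | A (W w *: y)] = k%:R%:E])
   `|` (Z `&` ((Em `&` [set _ | counting (@set0 E) = k%:R%:E :> \bar R])
     `|` (~` Em `&` [set _ | counting ([set (0 : E)] `&` A) = k%:R%:E :> \bar R])))).
  apply: measurableU.
    apply: measurableI; first exact: measurableC.
    exact: (measurable_preimageT mC (emeasurable_set1 _)).
  apply: measurableI => //; apply: measurableU; apply: measurableI.
  - exact: mEm.
  - exact: measurable_setU_Prop.
  - exact: measurableC.
  - exact: measurable_setU_Prop.
have W0 w : W w <> 0 -> counting (scaled_cluster w `&` A) =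
    fin_counting (L w) [set y | A (W w *: y)] :> \bar R.
  move=> Ww; rewrite /fin_counting asboolT // /counting !asboolT; last 2 first.
  - exact: finite_setIl.
  - by apply: finite_setIl; exact: finite_scaled_cluster.
  congr (_%:R%:E).
  rewrite (_ : _ `&` A = (fun y => W w *: y) @` (L w `&` [set y | A (W w *: y)])).
    rewrite fset_set_image; last exact: finite_setIl.
    by rewrite card_imfset //; apply: scalerI; exact/eqP.
  apply/seteqP; split => [_ [[y Ly <-] Ay]|_ [y [Ly Ay] <-]]; first by exists y.
  by split => //; exists y.
have E0 w : Em w <-> L w = set0.
  rewrite /Em /= fin_counting_eq0 //; split => [H|-> //].
  by apply/seteqP; split => // y Ly; exact: (H y Ly).
have Z0 w : W w = 0 -> L w <> set0 -> scaled_cluster w = [set 0].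
  move=> Ww /eqP/set0P[y Ly]; apply/seteqP; split => [_ [z _ <-]|_ ->].
    by rewrite Ww scale0r.
  by exists y => //; rewrite Ww scale0r.
have Z1 w : L w = set0 -> scaled_cluster w = set0.
  by move=> Lw; rewrite /scaled_cluster Lw image_set0.
apply/seteqP; split => w /=.
  have [Ww|/eqP Ww] := eqVneq (W w) 0; last by rewrite W0 //; left.
  have [Lw|Lw] := pselect (L w = set0).
    by rewrite Z1 // set0I; right; split => //; left; split => //; exact/E0.
  by rewrite Z0 //; right; split => //; right; split => // /E0.
move=> [[Ww]|[Ww [[Ew]|[Ew]]]].
- by rewrite W0.
- by rewrite Z1 ?set0I //; exact/E0.
- by rewrite Z0 // => Lw; apply: Ew; exact/E0.
Qed.

Lemma counting_scaled_cluster_le w :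
  (counting (scaled_cluster w) <= counting (L w) :> \bar R)%E.
Proof.
rewrite /counting !asboolT //; last exact: finite_scaled_cluster.
rewrite lee_fin ler_nat fset_set_image //.
exact: leq_imfset_card.
Qed.

(** Scaling never increases the cardinality, so equal finite means force equal cardinalities almost
    surely. In particular, W = 0 almost surely occurs only for clusters with at most one point. *)
Lemma ae_scaled_cluster_inj :
  (\int[P]_w counting (L w) < +oo)%E ->
  (\int[P]_w counting (scaled_cluster w) = \int[P]_w counting (L w))%E ->
  {ae P, forall w, set_inj (L w) (fun y => W w *: y)}.
Proof.
move=> Loo WL.
have c0 (M : set E) : (0 <= counting M :> \bar R)%E.
  by rewrite /counting; case: ifP => // _; rewrite ?lee_fin ?leey.
have mc1 := measurable_counting mL fL.
have mc2 := measurable_counting measurable_scaled_cluster finite_scaled_cluster.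
have i1 : P.-integrable setT (fun w => counting (L w)).
  apply/integrableP; split => //.
  by under eq_integral do rewrite gee0_abs //.
have i2 : P.-integrable setT (fun w => counting (scaled_cluster w)).
  apply/integrableP; split => //.
  by under eq_integral do rewrite gee0_abs //; rewrite WL.
have cf (M : set E) : finite_set M -> (counting M : \bar R) \is a fin_num.
  by move=> fM; rewrite /counting asboolT.
have fs := finite_scaled_cluster.
have : (\int[P]_w `|counting (L w) - counting (scaled_cluster w)| = 0)%E.
  under eq_integral => w _.
    rewrite gee0_abs; last first.
      by rewrite sube_ge0 ?cf // counting_scaled_cluster_le.
    over.
  rewrite integralB // WL subee // ge0_fin_numE //.
  by apply: integral_ge0.
have mB : measurable_fun setT (fun w =>
    (counting (L w) - counting (scaled_cluster w))%E : \bar R).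
  exact: emeasurable_funB.
move/(ae_eq_integral_abs P measurableT mB).1.
apply: filterS => w /(_ I) /= H; apply: card_image_inj => //.
move: H; rewrite /counting !asboolT // -EFinB => -[/eqP].
by rewrite subr_eq0 eqr_nat => /eqP ->.
Qed.

Variable g : E -> R.
Hypothesis mg : measurable_fun setT (g : BE -> R).
Hypothesis g_segment : forall (z v : E) (t w : R), 0 <= w <= 1 ->
  g z <= t -> g (z + v) <= t -> g (z + w *: v) <= t.

Lemma cluster_intensity_contract (G : set BE) : measurable G ->
  {ae P, forall w, 0 <= W w <= 1} ->
  {ae P, forall w, set_inj (L w) (fun y => W w *: y)} ->
  ((lebesgueRd d \x image_measure P measurable_scaled_cluster) (strict_min g G) <=
   (lebesgueRd d \x image_measure P mL) (strict_min g G))%E.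
Proof.
move=> mG W01 iW; have mS := measurable_strict_min mg mG.
rewrite !cluster_intensityE //; apply: ae_ge0_le_integral => //.
- exact: (measurable_fun_section measurable_scaled_cluster mS).
- exact: (measurable_fun_section mL mS).
apply: filterS2 W01 iW => w w01 iw _.
exact: lebesgueRd_strict_min_contract.
Qed.

End contraction.

(** * Poisson processes with independent marks *)

Section freezing.
Context {R : realType} dT (T : measurableType dT) (P : probability T R).
Context dU (U : measurableType dU) dM (M : measurableType dM).
Variables (Q : probability M R) (u : T -> U) (l : T -> M).
Hypotheses (mu : measurable_fun setT u) (ml : measurable_fun setT l).
Hypothesis ind : forall D G, measurable D -> measurable G ->
  (P (u @^-1` D `&` l @^-1` G) = P (u @^-1` D) * Q G)%E.

(** By independence the joint law of u and l agrees with a product measure on rectangles, hence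
    everywhere; Tonelli then integrates out l with u held fixed. *)
Lemma integral_freeze (psi : U * M -> \bar R) : measurable_fun setT psi ->
  (forall x, 0 <= psi x)%E ->
  (\int[P]_w psi (u w, l w) = \int[P]_w \int[Q]_m psi (u w, m))%E.
Proof.
move=> mpsi psi0.
have mul : measurable_fun setT (fun w => (u w, l w)) by exact/measurable_fun_pairP.
transitivity (\int[image_measure P mul]_x psi x)%E.
  by rewrite ge0_integral_image_measure.
transitivity (\int[image_measure P mu \x Q]_x psi x)%E.
  apply: eq_measure_integral => A mA _; apply/esym.
  by apply: (product_measure_unique (m' := image_measure P mul)) => // D G mD mG;
    exact: ind.
rewrite fubini_tonelli1 // ge0_integral_image_measure //.
  exact: measurable_fun_fubini_tonelli_F.
by move=> x; exact: integral_ge0.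
Qed.

End freezing.

Lemma integral_one_probability d (M : measurableType d) (R : realType)
  (Q : probability M R) : (\int[Q]_m 1%:E = 1)%E.
Proof. by rewrite integral_cst // mul1e; exact: probability_setT. Qed.

Section marking.
Context {R : realType} dT (T : measurableType dT) (P : probability T R).
Context dE (E : measurableType dE) dM (M : measurableType dM).
Variables (Q : probability M R) (X : nat -> T -> E) (L : nat -> T -> M).
Hypotheses (mX : forall i, measurable_fun setT (X i))
  (mL : forall i, measurable_fun setT (L i)).

Definition points_events : set (set T) :=
  [set D | exists i, exists2 A, measurable A & D = X i @^-1` A].

Hypothesis indXL : forall D (n : nat) (H : nat -> set M), <<s points_events >> D ->
  (forall i, measurable (H i)) ->
  (P (D `&` [set w | forall i, (i < n)%N -> H i (L i w)]) =
   P D * \prod_(i < n) Q (H i))%E.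

(** All points belong to the past, but only the marks before the k-th: products in which later marks
    are already averaged out are measurable with respect to it. *)
Definition past_events (k : nat) : set (set T) :=
  [set D | (exists i, exists2 A, measurable A & D = X i @^-1` A) \/
           (exists2 j, (j < k)%N & exists2 G, measurable G & D = L j @^-1` G)].

Definition past (k : nat) := g_sigma_algebraType (past_events k).

Lemma measurable_past_points k i : measurable_fun setT (X i : past k -> E).
Proof.
move=> _ A mA; rewrite setTI; apply: sub_sigma_algebra.
by left; exists i; exists A.
Qed.

Lemma measurable_past_marks k j : (j < k)%N -> measurable_fun setT (L j : past k -> M).
Proof.
move=> jk _ A mA; rewrite setTI; apply: sub_sigma_algebra.
by right; exists j => //; exists A.
Qed.

Lemma past_sub k (D : set (past k)) : measurable D -> measurable (D : set T).
Proof.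
apply: smallest_sub; first exact: sigma_algebra_measurable.
by move=> _ [[i [A mA ->]]|[j _ [A mA ->]]]; exact: measurable_preimageT.
Qed.

Lemma measurable_to_past k : measurable_fun setT (id : T -> past k).
Proof. by move=> _ D mD; rewrite setTI; exact: (@past_sub k D mD). Qed.

Lemma points_events_sub D : <<s points_events >> D -> measurable D.
Proof.
move: D; apply: smallest_sub; first exact: sigma_algebra_measurable.
by move=> _ [i [A mA ->]]; exact: measurable_preimageT.
Qed.

(** Both sides are finite measures in D. They agree on the sets D0 meeting finitely many mark
    conditions, which are stable under intersection and generate the past. *)
Lemma mark_indep_past k (D : set (past k)) (G : set M) : measurable D ->
  measurable G -> (P (D `&` L k @^-1` G) = P D * Q G)%E.
Proof.
move=> mD mG.
pose Pi : set (set T) := [set D | exists D0, exists2 H : nat -> set M,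
  <<s points_events >> D0 /\ (forall i, measurable (H i)) &
  D = D0 `&` [set w | forall i, (i < k)%N -> H i (L i w)]].
have sT : <<s points_events >> [set: T].
  exact: (@measurableT _ (g_sigma_algebraType points_events)).
have mLG : measurable (L k @^-1` G) by exact: measurable_preimageT.
have PiP D' : Pi D' -> (P (D' `&` L k @^-1` G) = P D' * Q G)%E.
  move=> [D0 [H [mD0 mH] ->]].
  rewrite indXL // -setIA.
  (* Appending G as the condition on mark k turns the left-hand side into an instance of [indXL]
     with k + 1 marks. *)
  pose H' i := if (i < k)%N then H i else G.
  rewrite (_ : _ `&` L k @^-1` G = [set w | forall i, (i < k.+1)%N -> H' i (L i w)]).
    rewrite indXL //; last by move=> i; rewrite /H'; case: ifP.
    rewrite big_ord_recr /= /H' ltnn muleA; congr (_ * _ * _)%E.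
    by apply: eq_bigr => i _; rewrite ltn_ord.
  apply/seteqP; split => w /=.
    by move=> [Hw Gw] i; rewrite ltnS /H' leq_eqVlt => /predU1P[->|ik];
      rewrite ?ltnn ?ik //; exact: Hw.
  move=> Hw; split => [i ik|].
    by have := Hw i (ltnW ik); rewrite /H' ik.
  by have := Hw k (ltnSn k); rewrite /H' ltnn.
have Pim : Pi `<=` measurable.
  move=> _ [D0 [H [mD0 mH] ->]]; apply: measurableI; first exact: points_events_sub.
  rewrite (_ : [set w | _] = \bigcap_(i in `I_k) L i @^-1` H i) //.
  apply: fin_bigcap_measurable; first exact: finite_II.
  by move=> i _; exact: measurable_preimageT.
have QG : Q G \is a fin_num by exact: fin_num_measure.
pose q : {nonneg R} := NngNum (fine_ge0 (measure_ge0 Q G)).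
suff : mrestr P mLG D = mscale q P D.
  by rewrite /mrestr /mscale /= fineK // muleC.
apply: (@g_sigma_algebra_measure_unique _ _ T Pi Pim (fun=> setT)).
- by move=> _; exists setT; exists (fun=> setT) => //; rewrite setTI; apply/seteqP; split.
- by rewrite bigcup_const.
- move=> _ _ [D1 [H1 [mD1 mH1] ->]] [D2 [H2 [mD2 mH2] ->]].
  exists (D1 `&` D2); exists (fun i => H1 i `&` H2 i).
    split; last by move=> i; exact: measurableI.
    exact: (@measurableI _ (g_sigma_algebraType points_events)).
  apply/seteqP; split => w /=.
    by move=> [[? h1] [? h2]]; split => // i ik; split; [exact: h1|exact: h2].
  by move=> [[? ?] h]; split; split => // i ik; case: (h i ik).
- by move=> D' /PiP H; rewrite /mrestr; apply: (etrans H); rewrite muleC -{1}(fineK QG).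
- move=> _; apply: (@le_lt_trans _ _ 1%E); last exact: ltry.
  by apply: probability_le1; exact: measurableI.
move: mD; apply: smallest_sub; first exact: smallest_sigma_algebra.
move=> _ [[i [A mA ->]]|[j jk [A mA ->]]]; apply: sub_sigma_algebra.
  exists (X i @^-1` A); exists (fun=> setT).
    by split => //; apply: sub_sigma_algebra; exists i; exists A.
  by apply/seteqP; split => // w [].
exists setT; exists (fun i => if i == j then A else setT).
  by split => // i; case: ifP.
rewrite setTI; apply/seteqP; split => w /=.
  by move=> Aw i _; case: ifP => // /eqP ->.
by move=> /(_ j jk); rewrite eqxx.
Qed.

Variable phi : E * M -> R.
Hypotheses (mphi : measurable_fun setT phi) (phi01 : forall x, 0 <= phi x <= 1).

Definition mark_mean (x : E) : R := fine (\int[Q]_m (phi (x, m))%:E).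

Lemma mark_meanE x : (\int[Q]_m (phi (x, m))%:E)%E = (mark_mean x)%:E.
Proof.
rewrite fineK // ge0_fin_numE; last first.
  by apply: integral_ge0 => m _; rewrite lee_fin; case/andP: (phi01 (x, m)).
apply: (@le_lt_trans _ _ (\int[Q]_m 1%:E)%E).
  apply: ge0_le_integral => //.
  - by move=> m _; rewrite lee_fin; case/andP: (phi01 (x, m)).
  - by apply/measurable_EFinP; apply: (measurableT_comp mphi); exact: pair1_measurable.
  - by move=> m _; rewrite lee_fin; case/andP: (phi01 (x, m)).
by rewrite integral_one_probability ltry.
Qed.

Lemma mark_mean01 x : 0 <= mark_mean x <= 1.
Proof.
rewrite -!lee_fin -mark_meanE; apply/andP; split.
  by apply: integral_ge0 => m _; rewrite lee_fin; case/andP: (phi01 (x, m)).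
apply: (@le_trans _ _ (\int[Q]_m 1%:E)%E).
  apply: ge0_le_integral => //.
  - by move=> m _; rewrite lee_fin; case/andP: (phi01 (x, m)).
  - by apply/measurable_EFinP; apply: (measurableT_comp mphi); exact: pair1_measurable.
  - by move=> m _; rewrite lee_fin; case/andP: (phi01 (x, m)).
by rewrite integral_one_probability.
Qed.

Lemma measurable_mark_mean : measurable_fun setT mark_mean.
Proof.
apply/measurable_EFinP; have : measurable_fun setT (fubini_F Q (EFin \o phi)).
  apply: measurable_fun_fubini_tonelli_F => //.
    exact/measurable_EFinP.
  by move=> x /=; rewrite lee_fin; case/andP: (phi01 x).
by apply: eq_measurable_fun => x _; rewrite /fubini_F /= mark_meanE.
Qed.

(** In [F j] the factors below j keep their marks and the others are averaged. Passing from [F j.+1]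
    to [F j] averages mark j alone, and the remaining factors belong to its past. *)
Lemma integral_prod_marks (n : nat) :
  (\int[P]_w (\prod_(i < n) phi (X i w, L i w))%:E =
   \int[P]_w (\prod_(i < n) mark_mean (X i w))%:E)%E.
Proof.
pose F j w := \prod_(i < n) (if (i < j)%N then phi (X i w, L i w) else mark_mean (X i w)).
suff H j : (j <= n)%N ->
    (\int[P]_w (F j w)%:E = \int[P]_w (\prod_(i < n) mark_mean (X i w))%:E)%E.
  rewrite -(H n (leqnn n)); apply: eq_integral => w _; congr EFin.
  by apply: eq_bigr => i _; rewrite ltn_ord.
elim: j => [_|j IH jn].
  by apply: eq_integral => w _; congr EFin; apply: eq_bigr => i _.
rewrite -IH; last exact: ltnW.
pose Y w := \prod_(i < n | i != Ordinal jn)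
  (if (i < j)%N then phi (X i w, L i w) else mark_mean (X i w)).
have Y0 w : 0 <= Y w.
  apply: prodr_ge0 => i _; case: ifP => _; first by case/andP: (phi01 (X i w, L i w)).
  by case/andP: (mark_mean01 (X i w)).
have mY : measurable_fun setT (Y : past j -> R).
  rewrite /Y; under eq_fun do rewrite big_mkcond.
  apply: (@measurable_prod _ (past j)) => i _.
  case: (i != Ordinal jn); last exact: measurable_cst.
  case: (boolP (i < j)%N) => ij; last first.
    apply: (measurableT_comp measurable_mark_mean); exact: measurable_past_points.
  apply: (measurableT_comp mphi); apply/measurable_fun_pairP; split.
    exact: measurable_past_points.
  exact: measurable_past_marks.
transitivity (\int[P]_w (Y w * phi (X j w, L j w))%:E)%E.
  apply: eq_integral => w _; rewrite /F (bigD1 (Ordinal jn)) //= ltnSn mulrC.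
  congr (_ * _)%:E; apply: eq_bigr => i ij; rewrite ltnS leq_eqVlt.
  by move: ij; rewrite -val_eqE /= => /negbTE ->.
transitivity (\int[P]_w (Y w * mark_mean (X j w))%:E)%E; last first.
  by apply: eq_integral => w _; rewrite /F (bigD1 (Ordinal jn)) //= ltnn mulrC.
pose psi (q : past j * M) : \bar R := (Y q.1 * phi (X j q.1, q.2))%:E.
have mpsi : measurable_fun setT psi.
  apply/measurable_EFinP; apply: measurable_funM.
    exact: (measurableT_comp mY measurable_fst).
  apply: (measurableT_comp mphi); apply/measurable_fun_pairP; split.
    exact: (measurableT_comp (@measurable_past_points j j) measurable_fst).
  exact: measurable_snd.
rewrite [LHS](@integral_freeze _ _ T P _ (past j) _ M Q id (L j) _ (mL j) _ psi) //.
- apply: eq_integral => w _; rewrite /psi /=.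
  under eq_integral do rewrite EFinM.
  rewrite ge0_integralZl_EFin // ?mark_meanE //.
    by move=> m _; rewrite lee_fin; case/andP: (phi01 (X j w, m)).
  by apply/measurable_EFinP; apply: (measurableT_comp mphi); exact: pair1_measurable.
- exact: measurable_to_past.
- by move=> D G mD mG; exact: mark_indep_past.
- by move=> q; rewrite /psi lee_fin mulr_ge0 //; case/andP: (phi01 (X j q.1, q.2)).
Qed.

End marking.

(** * Expectations of products of functions of counts *)

Section joint_counts.
Context {R : realType} dT (T : measurableType dT) (P : probability T R).
Local Open Scope ereal_scope.

Lemma emeasurable_prod (I : Type) (r : seq I) (F : I -> T -> \bar R) :
  (forall i, measurable_fun setT (F i)) ->
  measurable_fun setT (fun w => \prod_(i <- r) F i w).
Proof.
move=> mF; elim: r => [|i r IH].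
  by under eq_fun do rewrite big_nil; exact: measurable_cst.
by under eq_fun do rewrite big_cons; exact: emeasurable_funM.
Qed.

Variables (n : nat) (C : 'I_n -> nat -> set T) (q h : 'I_n -> nat -> R) (s : 'I_n -> R).
Hypotheses (mC : forall j k, measurable (C j k)) (h0 : forall j k, (0 <= h j k)%R)
  (q0 : forall j k, (0 <= q j k)%R) (tC : forall j, trivIset setT (C j)).
Hypothesis PC : forall k : 'I_n -> nat,
  P [set w | forall j, C j (k j) w] = (\prod_(j < n) q j (k j))%:E.
Hypothesis hs : forall j, \sum_(l <oo) (h j l * q j l)%:E = (s j)%:E.

(** The value of [h j] at the j-th count, which is the unique l with [C j l w]; it is 0 when the
    count has no finite value. *)
Definition count_mean (j : 'I_n) (w : T) : \bar R :=
  \sum_(l <oo) (h j l)%:E * (\1_(C j l) w)%:E.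

Let term0 j l w : 0 <= (h j l)%:E * (\1_(C j l) w)%:E.
Proof. by rewrite mule_ge0 // lee_fin. Qed.

Let mterm j l : measurable_fun setT (fun w => (h j l)%:E * (\1_(C j l) w)%:E).
Proof.
apply: emeasurable_funM; first exact: measurable_cst.
by apply/measurable_EFinP; exact: measurable_indic.
Qed.

Lemma measurable_count_mean j : measurable_fun setT (count_mean j).
Proof.
by apply: ge0_emeasurable_sum => // l w _ _; exact: term0.
Qed.

Lemma count_mean_ge0 j w : 0 <= count_mean j w.
Proof. by apply: nneseries_ge0 => l _ _; exact: term0. Qed.

Lemma count_meanE j l w : C j l w -> count_mean j w = (h j l)%:E.
Proof.
move=> Cw; rewrite /count_mean (@nneseriesD1 R _ l xpredT) //.
rewrite indicE mem_set // mule1 eseries0 ?adde0 // => k _ /= kl.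
rewrite indicE memNset ?mule0 // => Cw'.
have := @tC j k l I I; move=> /(_ (ex_intro _ w (conj Cw' Cw))) /eqP.
by rewrite (negbTE kl).
Qed.

Lemma count_mean_fin_num j w : count_mean j w \is a fin_num.
Proof.
have [[l Cw]|nC] := pselect (exists l, C j l w); first by rewrite (count_meanE Cw).
rewrite /count_mean eseries0 // => l _ _; rewrite indicE memNset ?mule0 // => Cw.
by apply: nC; exists l.
Qed.

(** Only the joint mass function is given, so the counts are summed out one at a time: in [F J k]
    the counts below J enter through their functions h, and the others are pinned at the values k.
    The start J = 0 is [PC], and each step expands one function into its series. *)
Lemma integral_prod_count_mean :
  \int[P]_w \prod_(j < n) count_mean j w = (\prod_(j < n) s j)%:E.
Proof.
pose F J (k : 'I_n -> nat) (j : 'I_n) w :=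
  if (j < J)%N then count_mean j w else (\1_(C j (k j)) w)%:E.
pose v J (k : 'I_n -> nat) (j : 'I_n) := if (j < J)%N then s j else q j (k j).
have mF J k j : measurable_fun setT (F J k j).
  rewrite /F; case: (j < J)%N; first exact: measurable_count_mean.
  by apply/measurable_EFinP; exact: measurable_indic.
have F0 J k j w : 0 <= F J k j w.
  by rewrite /F; case: ifP => _; [exact: count_mean_ge0|rewrite lee_fin].
suff H J : (J <= n)%N -> forall k,
    \int[P]_w \prod_(j < n) F J k j w = (\prod_(j < n) v J k j)%:E.
  have := H n (leqnn n) (fun=> 0%N) => {}H.
  rewrite (eq_bigr (v n (fun=> 0%N))) -?H; last by move=> j _; rewrite /v ltn_ord.
  apply: eq_integral => w _; apply: eq_bigr => j _; by rewrite /F ltn_ord.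
elim: J => [_ k|J IH Jn k].
  rewrite /v /= -PC.
  transitivity (\int[P]_w (\1_[set w | forall j, C j (k j) w] w)%:E); last first.
    rewrite integral_indic ?setIT //.
    rewrite (_ : [set w | _] = \bigcap_(j in [set: 'I_n]) C j (k j)).
      apply: fin_bigcap_measurable; first exact: finite_finset.
      by move=> j _; exact: mC.
    by apply/seteqP; split => w /= H j => [_|]; exact: H.
  apply: eq_integral => w _; rewrite /F /= prodEFin; congr EFin.
  rewrite [RHS]indicE; have [wC|nC] := pselect (forall j, C j (k j) w).
    by rewrite mem_set // big1 // => j _; rewrite indicE mem_set.
  rewrite memNset //; have /existsNP[j wC] := nC.
  by rewrite (bigD1 j) //= indicE memNset // mul0r.
pose j0 := Ordinal Jn.
pose upd l (j : 'I_n) := if j == j0 then l else k j.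
have ltJ (j : 'I_n) : j != j0 -> (j < J.+1)%N = (j < J)%N.
  move=> jj0; rewrite ltnS leq_eqVlt; move: jj0.
  by rewrite -val_eqE /= => /negbTE ->.
pose Y w := \prod_(j < n | j != j0) F J k j w.
have Y0 w : 0 <= Y w by apply: prode_ge0.
have mY : measurable_fun setT Y.
  rewrite /Y; under eq_fun do rewrite big_mkcond.
  by apply: emeasurable_prod => j; case: (j != j0).
have YE l w : \prod_(j < n) F J (upd l) j w = (\1_(C j0 l) w)%:E * Y w.
  rewrite (bigD1 j0) //= {1}/F ltnn /upd eqxx; congr (_ * _).
  by apply: eq_bigr => j jj0; rewrite /F (negbTE jj0).
transitivity (\int[P]_w \sum_(l <oo) (h j0 l)%:E * ((\1_(C j0 l) w)%:E * Y w)).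
  apply: eq_integral => w _; rewrite (bigD1 j0) //= {1}/F /= ltnSn.
  rewrite (eq_bigr (F J k ^~ w)); last by move=> j jj0; rewrite /F ltJ.
  rewrite -/(Y w) /count_mean muleC.
  have Yf : Y w \is a fin_num.
    apply: prode_fin_num => j _; rewrite /F.
    by case: ifP => // _; exact: count_mean_fin_num.
  rewrite -(fineK Yf) -nneseriesZl; last by move=> l _; exact: term0.
  by apply: eq_eseriesr => l _; rewrite muleC -muleA.
rewrite integral_nneseries //; last 2 first.
- move=> l; apply: emeasurable_funM; first exact: measurable_cst.
  apply: emeasurable_funM => //; apply/measurable_EFinP; exact: measurable_indic.
- by move=> l w _; rewrite !mule_ge0 // lee_fin.
transitivity (\sum_(l <oo) (\prod_(j < n | j != j0) v J k j)%:E * (h j0 l * q j0 l)%:E).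
  apply: eq_eseriesr => l _.
  rewrite ge0_integralZl_EFin //; last 2 first.
  - by move=> w _; rewrite mule_ge0 // lee_fin.
  - apply: emeasurable_funM => //; apply/measurable_EFinP; exact: measurable_indic.
  under eq_integral do rewrite -YE.
  rewrite (IH (ltnW Jn)) (bigD1 j0) //= {1}/v ltnn /upd eqxx -!EFinM.
  rewrite [RHS](_ : _ = (h j0 l * (q j0 l * \prod_(j < n | j != j0) v J k j)%R)%:E).
    congr (_ * (_ * _))%:E; apply: eq_bigr => j jj0; by rewrite /v (negbTE jj0).
  by congr EFin; ring.
rewrite nneseriesZl; last first.
  move=> l _; by rewrite lee_fin mulr_ge0.
have vj0 : v J.+1 k j0 = s j0 by rewrite /v ltnSn.
rewrite hs -EFinM; congr EFin; rewrite [RHS](bigD1 j0) //= vj0 mulrC.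
by congr (_ * _)%R; apply: eq_bigr => j jj0; rewrite /v ltJ.
Qed.

End joint_counts.

Lemma counting_card_eq (T U : choiceType) (R : realType) (A : set T) (B : set U) :
  (A #= B)%card -> counting A = counting B :> \bar R.
Proof.
move=> AB; rewrite /counting (eq_finite_set AB); case: asboolP => // fB.
have fA : finite_set A by rewrite (eq_finite_set AB).
by congr (_%:R%:E); apply/fcard_eq.
Qed.

Lemma counting_nat (T : choiceType) (R : realType) (A : set T) (k : nat) :
  counting A = k%:R%:E :> \bar R <-> finite_set A /\ #|` fset_set A| = k.
Proof.
rewrite /counting; case: asboolP => fA; last by split => // -[].
split => [[/eqP]|[_ ->] //].
by rewrite eqr_nat => /eqP.
Qed.

Section poisson_series.
Context {R : realType}.

Definition poisson_weight (r : R) (l : nat) : R := expR (- r) * (r ^+ l / l`!%:R).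

Lemma poisson_weight_ge0 r l : 0 <= r -> 0 <= poisson_weight r l.
Proof. by move=> r0; rewrite mulr_ge0 ?expR_ge0 // divr_ge0 ?exprn_ge0. Qed.

(** Rate 0 stands apart: [poisson_prob] is then the Dirac mass at 0, and the weight agrees because
    0^0 = 1. *)
Lemma poisson_probE (r : R) (l : nat) : 0 <= r ->
  poisson_prob r l [set l] = (poisson_weight r l)%:E.
Proof.
rewrite /poisson_prob /poisson_weight le_eqVlt => /predU1P[<-|r0].
  rewrite ltxx oppr0 expR0 mul1r diracE expr0n; case: l => [|l].
    by rewrite mem_set // fact0 divr1.
  by rewrite memNset //= mul0r.
rewrite r0 esum_set1; last by rewrite lee_fin poisson_pmf_ge0.
by rewrite /poisson_pmf r0 mulrC.
Qed.

Lemma poisson_generating (r z : R) : 0 <= r -> 0 <= z ->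
  (\sum_(l <oo) (z ^+ l * poisson_weight r l)%:E = (expR (- (r * (1 - z))))%:E)%E.
Proof.
move=> r0 z0.
transitivity (\sum_(l <oo) (expR (- r))%:E * ((z * r) ^+ l / l`!%:R)%:E)%E.
  apply: eq_eseriesr => l _; rewrite -EFinM; congr EFin.
  by rewrite /poisson_weight exprMn; ring.
rewrite nneseriesZl; last first.
  by move=> l _; rewrite lee_fin divr_ge0 // exprn_ge0 // mulr_ge0.
rewrite (_ : - (r * (1 - z)) = - r + z * r); last by ring.
rewrite expRD EFinM; congr (_ * _)%E; rewrite expRE -EFin_lim; last first.
  rewrite /pseries /=; under eq_fun do rewrite mulrC.
  exact: is_cvg_series_exp_coeff.
apply/congr_lim/funext => n /=; rewrite /pseries /= /series /= -sumEFin //.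
by under eq_bigr do rewrite mulrC.
Qed.

End poisson_series.

(** * The Laplace functional of the Poisson process *)

Section laplace_functional.
Context {R : realType} dT (T : measurableType dT) (P : probability T R).
Context dE (E : measurableType dE) (nu : {sigma_finite_measure set E -> \bar R}).
Variable X : nat -> T -> E.
Hypothesis mX : forall i, measurable_fun setT (X i).
Hypothesis mdiag : forall i j, measurable [set w | X i w <> X j w].
Hypothesis injX : {ae P, forall w, injective (X ^~ w)}.
Hypothesis poissonX : forall (n : nat) (A : 'I_n -> set E) (k : 'I_n -> nat),
  (forall i, measurable (A i) /\ (nu (A i) < +oo)%E) -> trivIset setT A ->
  P [set w | forall i, counting (range (X ^~ w) `&` A i) = (k i)%:R%:E :> \bar R] =
  (\prod_(i < n) poisson_prob (fine (nu (A i))) (k i) [set k i])%E.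

Definition count_event (A : set E) (k : nat) : set T :=
  [set w | counting (range (X ^~ w) `&` A) = k%:R%:E :> \bar R].

Lemma measurable_count_event A k : measurable A -> measurable (count_event A k).
Proof.
move=> mA.
(* The enumeration is injective only almost surely, while measurability is needed for every w, so
   each point is counted at its first index. A prescribed count is then a countable union over
   finite sets of indices. *)
pose J w : set nat := [set i | A (X i w) /\ forall j, (j < i)%N -> X j w <> X i w].
have mJ i : measurable [set w | J w i].
  rewrite (_ : [set w | _] = X i @^-1` A `&`
      \bigcap_(j in `I_i) [set w | X j w <> X i w]); last first.
    by apply/seteqP; split => w /= [? H]; split.
  apply: measurableI; first exact: measurable_preimageT.
  by apply: fin_bigcap_measurable => //; exact: finite_II.
have JE w : counting (range (X ^~ w) `&` A) = counting (J w) :> \bar R.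
  rewrite (_ : _ `&` A = (X ^~ w) @` J w); last first.
    apply/seteqP; split => [_ [[i _ <-] Ai]|_ [i [Ai _] <-]]; last by split => //; exists i.
    have ex : exists i', `[< X i' w = X i w >] by exists i; apply/asboolP.
    case: (ex_minnP ex) => m /asboolP Xm mmin; exists m => //.
    split; first by rewrite Xm.
    move=> j jm e; have : (m <= j)%N by apply: mmin; apply/asboolP; rewrite e.
    by rewrite leqNgt jm.
  apply: counting_card_eq; apply: inj_card_eq => i j.
  move=> /set_mem[_ Hi] /set_mem[_ Hj] e.
  by have [/Hj|/Hi|//] := ltngtP i j; rewrite e.
rewrite (_ : count_event A k = \bigcup_(F : {fset nat})
   [set w | #|` F| = k /\ forall i, J w i <-> i \in F]); last first.
  apply/seteqP; split => w; rewrite /count_event /= JE.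
    move=> /counting_nat[fJ cJ]; exists (fset_set (J w)) => //; split => // i.
    by rewrite in_fset_set // inE.
  move=> [F _ [Fk JF]]; apply/counting_nat.
  have -> : J w = [set` F] by apply/seteqP; split => i /= /JF.
  by split; [exact: finite_fset|rewrite set_fsetK].
apply: countable_bigcupT_measurable; first exact: countableP.
move=> F; have [Fk|Fk] := pselect (#|` F| = k); last first.
  by rewrite (_ : [set w | _] = set0) //; apply/seteqP; split => // w [].
rewrite (_ : [set w | _] = \bigcap_i (if i \in F then [set w | J w i] else ~` [set w | J w i])).
  apply: bigcapT_measurable => i; case: ifP => _ //; exact: measurableC.
apply/seteqP; split => w /=.
  by move=> [_ H] i _; case: ifPn => [/H//|/negP iF] /=; apply: contra_not iF => /H.
move=> H; split => // i; have := H i I; case: ifPn => iF //= nJ; split => //.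
Qed.

(** Once m exceeds the indices of the l points in A, each of them contributes one factor 1 - c and
    all other factors are 1. *)
Lemma avoid_const_near (A : set E) (l : nat) (c : R) w : injective (X ^~ w) ->
  count_event A l w ->
  \forall m \near \oo, \prod_(i < m) (1 - c * \1_A (X i w)) = (1 - c) ^+ l.
Proof.
move=> iX; rewrite /count_event /=; pose J : set nat := [set i | A (X i w)].
rewrite (_ : _ `&` A = (X ^~ w) @` J); last first.
  apply/seteqP; split => [_ [[i _ <-] Ai]|_ [i Ai <-]]; first by exists i.
  by split => //; exists i.
rewrite (_ : counting _ = counting J :> \bar R); last first.
  by apply: counting_card_eq; apply: inj_card_eq => i j _ _; exact: iX.
move=> /counting_nat[fJ cJ]; pose F := fset_set J.
have JF i : (i \in F) = `[< A (X i w) >].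
  by rewrite in_fset_set //; apply/idP/asboolP => [/set_mem|/mem_set].
near=> m; have mF i : i \in F -> (i < m)%N.
  move=> iF; apply: (@leq_trans (\max_(k <- F) k.+1)%N).
    exact: (@leq_bigmax_seq _ _ _ (fun k => k.+1)).
  by near: m; exact: nbhs_infty_ge.
transitivity (\prod_(i <- index_iota 0 m | i \in F) (1 - c)).
  rewrite [RHS]big_mkord [RHS]big_mkcond /=; apply: eq_bigr => i _.
  rewrite JF indicE; case: asboolP => [Ai|nA].
    by rewrite mem_set // mulr1.
  by rewrite memNset // mulr0 subr0.
rewrite -big_filter (perm_big F) /=; last first.
  apply: uniq_perm; [exact/filter_uniq/iota_uniq|exact: fset_uniq|].
  by move=> i; rewrite mem_filter mem_index_iota /=; case: (boolP (i \in F)) => //= /mF ->.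
by rewrite big_const_seq count_predT iter_mulr mulr1 cJ.
Unshelve. all: by end_near. Qed.

(** Given the points, the probability that none of the first m survives when a point at x is kept
    independently with probability [p x]. *)
Definition avoid (p : E -> R) (m : nat) (w : T) : R := \prod_(i < m) (1 - p (X i w)).

Lemma avoid01 p m w : (forall x, 0 <= p x <= 1) -> 0 <= avoid p m w <= 1.
Proof.
move=> p01; have H i : 0 <= 1 - p (X i w) <= 1.
  by have /andP[p0 p1] := p01 (X i w); rewrite subr_ge0 p1 lerBlDr lerDl.
apply/andP; split; first by apply: prodr_ge0 => i _; case/andP: (H i).
by apply: prodr_ile1 => i _; exact: H.
Qed.

Lemma measurable_avoid p m : measurable_fun setT p -> measurable_fun setT (avoid p m).
Proof.
move=> mp; apply: measurable_prod => i _; apply: measurable_funB => //.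
exact: measurableT_comp.
Qed.

Lemma avoid_nonincreasing p m n w : (forall x, 0 <= p x <= 1) -> (m <= n)%N ->
  avoid p n w <= avoid p m w.
Proof.
move=> p01 mn; rewrite /avoid -!(big_mkord xpredT (fun i => 1 - p (X i w))).
rewrite (big_cat_nat (leq0n m) mn) /=.
have H i : 0 <= 1 - p (X i w) <= 1.
  by have /andP[p0 p1] := p01 (X i w); rewrite subr_ge0 p1 lerBlDr lerDl.
apply: ler_piMr; first by apply: prodr_ge0 => i _; case/andP: (H i).
by apply: prodr_ile1 => i _; exact: H.
Qed.

Lemma avoid_anti p q m w : (forall x, 0 <= q x) -> (forall x, q x <= p x) ->
  (forall x, p x <= 1) -> avoid p m w <= avoid q m w.
Proof.
move=> q0 qp p1; apply: ler_prod => i _.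
by rewrite subr_ge0 p1 /= lerB.
Qed.

Section simple.
Variables (n : nat) (A : 'I_n -> set E) (c : 'I_n -> R).
Hypotheses (mA : forall j, measurable (A j)) (Aoo : forall j, (nu (A j) < +oo)%E)
  (tA : trivIset setT A) (c01 : forall j, 0 <= c j <= 1).

Let p x : R := \sum_(j < n) c j * \1_(A j) x.
Let z j l : R := (1 - c j) ^+ l.
Let r j : R := fine (nu (A j)).

Let z0 j l : 0 <= z j l.
Proof. by rewrite exprn_ge0 // subr_ge0; case/andP: (c01 j). Qed.

Let count j l := count_event (A j) l.

(** The sets [A j] are disjoint, so at most one indicator is nonzero at x. *)
Let pE x : 1 - p x = \prod_(j < n) (1 - c j * \1_(A j) x).
Proof.
rewrite /p; have [[j Ajx]|nA] := pselect (exists j, A j x).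
  have o i : i != j -> \1_(A i) x = 0 :> R.
    move=> ij; rewrite indicE memNset // => Aix.
    have := tA (i := i) (j := j) I I; move=> /(_ (ex_intro _ x (conj Aix Ajx))) e.
    by rewrite e eqxx in ij.
  rewrite (bigD1 j) //= big1 ?addr0; last by move=> i ij; rewrite o // mulr0.
  by rewrite (bigD1 j) //= big1 ?mulr1 // => i ij; rewrite o // mulr0 subr0.
have o i : \1_(A i) x = 0 :> R.
  by rewrite indicE memNset // => Aix; apply: nA; exists i.
by rewrite !big1 ?subr0 // => i _; rewrite o ?mulr0 ?subr0.
Qed.

Let Pcount (k : 'I_n -> nat) :
  P [set w | forall j, count j (k j) w] = (\prod_(j < n) poisson_weight (r j) (k j))%:E.
Proof.
rewrite /count /count_event /= poissonX //.
rewrite -prodEFin; apply: eq_bigr => j _.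
by rewrite poisson_probE // fine_ge0.
Qed.

Let tcount j : trivIset setT (count j).
Proof.
move=> k l _ _ [w []]; rewrite /count /count_event /= => -> [] /eqP.
by rewrite eqr_nat => /eqP.
Qed.

Let zsum j : (\sum_(l <oo) (z j l * poisson_weight (r j) l)%:E = (expR (- (r j * c j)))%:E)%E.
Proof.
rewrite /z poisson_generating ?fine_ge0 //; last by rewrite subr_ge0; case/andP: (c01 j).
by congr (expR (- (_ * _)))%:E; ring.
Qed.

Let mcount j k : measurable (count j k).
Proof. exact: measurable_count_event. Qed.

(** The Poisson weights sum to 1, so no mass is left for an infinite count. This is the product
    formula for a single count with h constantly 1. *)
Lemma ae_count_finite j : {ae P, forall w, exists l, count j l w}.
Proof.
pose C (_ : 'I_1) := count j; pose h (_ : 'I_1) (_ : nat) : R := 1.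
pose q (_ : 'I_1) l : R := poisson_weight (r j) l.
have H := @integral_prod_count_mean R _ T P 1 C q h (fun=> 1).
have {H} : (\int[P]_w \prod_(j < 1) count_mean C h j w = (\prod_(j < 1) 1)%:E)%E.
  apply: H => //.
  - by move=> i k; exact: mcount.
  - by move=> i k; apply: poisson_weight_ge0; exact: fine_ge0.
  - by move=> i; exact: tcount.
  - move=> k; rewrite big_ord1.
    have -> : [set w | forall i, C i (k i) w] =
        [set w | forall i : 'I_1, counting (range (X ^~ w) `&` A j) = (k i)%:R%:E :> \bar R].
      by [].
    rewrite (@poissonX 1 (fun=> A j) k) //.
      by rewrite big_ord1 poisson_probE // fine_ge0.
    by move=> i i' _ _ _; rewrite (ord1 i) (ord1 i').
  - move=> i; rewrite /h /q.
    have := poisson_generating (fine_ge0 (measure_ge0 nu (A j))) ler01.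
    rewrite subrr mulr0 oppr0 expR0 => <-.
    by apply: eq_eseriesr => l _; rewrite expr1n.
under eq_integral do rewrite big_ord1; rewrite big_ord1 => H.
have mU : measurable (\bigcup_l count j l) by exact: bigcupT_measurable.
exists (~` \bigcup_l count j l); split; first exact: measurableC; last first.
  by move=> w /= nw [l _ lw]; apply: nw; exists l.
rewrite probability_setC //.
suff -> : P (\bigcup_l count j l) = 1%E by rewrite subee.
rewrite -[RHS]H.
transitivity (\int[P]_w (\1_(\bigcup_l count j l) w)%:E)%E.
  by rewrite integral_indic ?setIT.
apply: eq_integral => w _; rewrite indicE.
have [[l lw]|nl] := pselect (exists l, count j l w).
  rewrite mem_set; last by exists l.
  by rewrite (@count_meanE _ _ _ _ C h (fun _ _ => ler01) (fun=> @tcount j) ord0 l).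
rewrite memNset; last by move=> [l _ lw]; apply: nl; exists l.
rewrite /count_mean eseries0 // => l _ _.
by rewrite indicE memNset ?mule0 // => lw; apply: nl; exists l.
Qed.

(** The products converge almost surely to the product of (1 - c_j)^(N_j), where N_j counts the
    points in [A j]. Its mean is a product of Poisson generating functions, and all products are
    dominated by 1. *)
Lemma avoid_simple_cvg :
  (\int[P]_w (avoid p m w)%:E)%E @[m --> \oo] -->
  (expR (- \sum_(j < n) c j * fine (nu (A j))))%:E.
Proof.
have zt j : (forall k, 0 <= z j k) by move=> k; exact: z0.
pose f w := (\prod_(j < n) count_mean count z j w)%E.
have p01 x : 0 <= p x <= 1.
  have : 0 <= 1 - p x <= 1.
    rewrite pE; have H j : 0 <= 1 - c j * \1_(A j) x <= 1.
      have /andP[c0 c1] := c01 j; rewrite indicE; case: (x \in A j);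
      by rewrite ?mulr1 ?mulr0 ?subr0 ?lexx ?ler01 // subr_ge0 c1 lerBlDr lerDl.
    apply/andP; split; first by apply: prodr_ge0 => j _; case/andP: (H j).
    by apply: prodr_ile1 => j _; exact: H.
  by rewrite subr_ge0 lerBlDr lerDl andbC.
have mp : measurable_fun setT p.
  apply: measurable_sum => j; apply: measurable_funM; first exact: measurable_cst.
  exact: measurable_indic.
have mf : measurable_fun setT f.
  by apply: emeasurable_prod => j; exact: measurable_count_mean.
have fE : (\int[P]_w f w)%E = (expR (- \sum_(j < n) c j * fine (nu (A j))))%:E.
  rewrite /f (integral_prod_count_mean mcount z0 _ tcount Pcount zsum); last first.
    by move=> j k; apply: poisson_weight_ge0; exact: fine_ge0.
  by rewrite -expR_sum sumrN; congr (expR (- _))%:E; apply: eq_bigr => j _; rewrite mulrC.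
have [] := @dominated_convergence _ _ _ P setT measurableT
  (fun m w => (avoid p m w)%:E) f (cst 1%E).
- by move=> m; apply/measurable_EFinP; exact: measurable_avoid.
- exact: mf.
- have : {ae P, forall w, forall j, exists l, count j l w}.
    by apply: filter_forall => j; exact: ae_count_finite.
  apply: filterS2 injX => w iX cw _.
  have /choice[l lw] := cw; apply: cvg_near_cst.
  rewrite /f (eq_bigr (fun j => (z j (l j))%:E)); last first.
    by move=> j _; rewrite (@count_meanE _ _ _ _ count z z0 tcount j (l j)).
  rewrite prodEFin.
  have : \forall m \near \oo, forall j,
      \prod_(i < m) (1 - c j * \1_(A j) (X i w)) = z j (l j).
    by apply: filter_forall => j; exact: (avoid_const_near (c j) iX (lw j)).
  apply: filterS => m H; congr EFin; rewrite /avoid.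
  rewrite (eq_bigr (fun i : 'I_m => \prod_(j < n) (1 - c j * \1_(A j) (X i w)))).
    by rewrite exchange_big /=; apply: eq_bigr => j _; exact: H.
  by move=> i _; exact: pE.
- exact: finite_measure_integrable_cst.
- apply: aeW => w m _; rewrite /= lee_fin ger0_norm; by case/andP: (avoid01 m w p01).
by move=> _ _; rewrite fE.
Qed.

End simple.

Import HBNNSimple.

Lemma avoid_nnsfun_cvg (f : {nnsfun E >-> R}) : (forall x, f x <= 1) ->
  (\int[nu]_x (f x)%:E < +oo)%E ->
  (\int[P]_w (avoid f m w)%:E)%E @[m --> \oo] -->
  (expR (- fine (\int[nu]_x (f x)%:E)))%:E.
Proof.
(* The value 0 is dropped because its level set may have infinite measure; the other level sets are
   finite since f is integrable. *)
move=> f1 foo; pose s := [seq y <- fset_set (range f) | y != 0].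
pose n := size s; pose c (j : 'I_n) := s`_j; pose A j := f @^-1` [set c j].
have us : uniq s by rewrite filter_uniq // fset_uniq.
have cs j : c j \in s by exact: mem_nth.
have c0 j : c j != 0 by have := cs j; rewrite mem_filter => /andP[].
have c01 j : 0 <= c j <= 1.
  have := cs j; rewrite mem_filter => /andP[_].
  by rewrite in_fset_set // inE => -[x _ <-]; rewrite f1 andbT.
have sumE (F : R -> \bar R) : F 0 = 0%E ->
    (\sum_(y \in range f) F y = \sum_(j < n) F (c j))%E.
  move=> F0; rewrite fsbig_finite //= -(big_mkord xpredT (fun j => F s`_j)).
  rewrite -(big_nth 0 xpredT F) /s big_filter [RHS]big_mkcond /=.
  by apply: eq_bigr => y _; case: eqVneq => [->|].
have fE x : f x = \sum_(j < n) c j * \1_(A j) x.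
  rewrite fimfunE; apply: EFin_inj; rewrite -fsumEFin //.
  by rewrite (sumE (fun y => (y * \1_(f @^-1` [set y]) x)%:E)) ?mul0r // sumEFin.
have mA j : measurable (A j) by exact: measurable_sfunP.
have If : (\int[nu]_x (f x)%:E = \sum_(j < n) (c j)%:E * nu (A j))%E.
  rewrite integral_nnsfun // patch_setT sintegralE.
  by rewrite (sumE (fun y => y%:E * nu (f @^-1` [set y]))%E) ?mul0e.
have Aoo j : (nu (A j) < +oo)%E.
  rewrite ltey; apply/eqP => Aoo; move: foo; rewrite If (bigD1 j) //= Aoo.
  have cj : 0 < c j by rewrite lt_def c0; case/andP: (c01 j).
  rewrite gt0_muley ?lte_fin // addye // gt_eqF //.
  apply: (@lt_le_trans _ _ 0%E) => //; apply: sume_ge0 => i _.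
  by apply: mule_ge0 => //; rewrite lee_fin; case/andP: (c01 i).
have tA : trivIset setT A.
  move=> i j _ _ [x []]; rewrite /A /= => -> /eqP.
  by rewrite /c nth_uniq // => /eqP; exact: val_inj.
have := avoid_simple_cvg mA Aoo tA c01.
rewrite -(_ : (f : E -> R) = (fun x => \sum_(j < n) c j * \1_(A j) x)); last exact/funext.
rewrite If; congr (_ --> (expR (- _))%:E).
have -> : (\sum_(j < n) (c j)%:E * nu (A j) = \sum_(j < n) (c j * fine (nu (A j)))%:E)%E.
  by apply: eq_bigr => j _; rewrite EFinM fineK // ge0_fin_numE.
by rewrite sumEFin.
Qed.

Lemma integral_avoid_nonincreasing (p : E -> R) : measurable_fun setT p ->
  (forall x, 0 <= p x <= 1) ->
  {homo (fun m => \int[P]_w (avoid p m w)%:E)%E : m n / (m <= n)%N >-> (n <= m)%E}.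
Proof.
move=> mp p01 m n mn; apply: ge0_le_integral => //.
- by move=> w _; rewrite lee_fin; case/andP: (avoid01 n w p01).
- by apply/measurable_EFinP; exact: measurable_avoid.
- by apply/measurable_EFinP; exact: measurable_avoid.
- by move=> w _; rewrite lee_fin avoid_nonincreasing.
Qed.

(** Simple functions f_k increase to p, and the limits in m and k are interchanged by monotonicity.
    For fixed m, the mean for p is the limit over k of the means for f_k, each at least its own
    limit in m. Conversely the mean for p is at most the mean for f_k, so its limit in m is below
    every exponential with f_k. *)
Theorem avoid_cvg (p : E -> R) : measurable_fun setT p ->
  (forall x, 0 <= p x <= 1) -> (\int[nu]_x (p x)%:E < +oo)%E ->
  (\int[P]_w (avoid p m w)%:E)%E @[m --> \oo] -->
  (expR (- fine (\int[nu]_x (p x)%:E)))%:E.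
Proof.
move=> mp p01 poo; have mpE : measurable_fun setT (EFin \o p) by exact/measurable_EFinP.
have p0 x : setT x -> (0 <= (EFin \o p) x)%E.
  by move=> _; rewrite lee_fin; case/andP: (p01 x).
pose f := nnsfun_approx measurableT mpE.
have fp k x : f k x <= p x.
  by rewrite -lee_fin /f nnsfun_approxE; exact: le_approx.
have f1 k x : f k x <= 1 by apply: le_trans (fp k x) _; case/andP: (p01 x).
have f01 k x : 0 <= f k x <= 1 by rewrite f1 andbT.
have fcvg x : f k x @[k --> \oo] --> p x.
  have := @cvg_nnsfun_approx _ _ _ _ measurableT _ mpE p0 x I.
  by move=> /fine_cvgP[_]; apply: cvg_trans; exact: cvg_id.
have fle k : (\int[nu]_x (f k x)%:E <= \int[nu]_x (p x)%:E)%E.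
  apply: ge0_le_integral => //.
  - by move=> x _; rewrite lee_fin.
  - exact/measurable_EFinP.
  - by move=> x _; rewrite lee_fin.
have foo k : (\int[nu]_x (f k x)%:E < +oo)%E by exact: le_lt_trans (fle k) _.
pose b k := (expR (- fine (\int[nu]_x (f k x)%:E)))%:E : \bar R.
pose a m : \bar R := (\int[P]_w (avoid p m w)%:E)%E.
have Ifcvg : (\int[nu]_x (f k x)%:E)%E @[k --> \oo] --> (\int[nu]_x (p x)%:E)%E.
  rewrite (_ : (\int[nu]_x (p x)%:E)%E = (\int[nu]_x limn (fun k => (f k x)%:E))%E).
    apply: cvg_monotone_convergence => //.
    - by move=> k; exact/measurable_EFinP.
    - by move=> k x _; rewrite lee_fin.
    - by move=> x _ k l kl; rewrite lee_fin; exact/lefP/nd_nnsfun_approx.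
  apply: eq_integral => x _; apply/esym/cvg_lim => //.
  exact: (@cvg_nnsfun_approx _ _ _ _ measurableT _ mpE p0 x I).
have Ip0 : (0 <= \int[nu]_x (p x)%:E)%E by apply: integral_ge0 => x _; exact: p0.
have bcvg : b k @[k --> \oo] --> (expR (- fine (\int[nu]_x (p x)%:E)))%:E.
  apply: cvg_EFin; first by apply: nearW.
  have pf : (\int[nu]_x (p x)%:E)%E \is a fin_num by rewrite ge0_fin_numE.
  have fcv : fine (\int[nu]_x (f k x)%:E) @[k --> \oo] --> fine (\int[nu]_x (p x)%:E).
    by move: Ifcvg; rewrite -{1}(fineK pf) => /fine_cvgP[].
  apply: (@continuous_cvg _ _ _ _ _ _ expR); first exact: continuous_expR.
  exact: cvgN fcv.
have acvg := ereal_nonincreasing_cvgn (integral_avoid_nonincreasing mp p01).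
set l := ereal_inf _ in acvg.
have ab m : ((expR (- fine (\int[nu]_x (p x)%:E)))%:E <= a m)%E.
  have H : (\int[P]_w (avoid (f k) m w)%:E)%E @[k --> \oo] --> a m.
    have [] := @dominated_convergence _ _ _ P setT measurableT
      (fun k w => (avoid (f k) m w)%:E) (fun w => (avoid p m w)%:E) (cst 1%E).
    - by move=> k; apply/measurable_EFinP; exact: measurable_avoid.
    - by apply/measurable_EFinP; exact: measurable_avoid.
    - apply: aeW => w _; apply: cvg_EFin; first exact: nearW.
      rewrite /comp /= /avoid; apply: cvg_big => [|i _]; first exact: mul_continuous.
      by apply: cvgB; [exact: cvg_cst|exact: fcvg].
    - exact: finite_measure_integrable_cst.
    - apply: aeW => w k _; rewrite /= lee_fin ger0_norm; by case/andP: (avoid01 m w (f01 k)).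
    by [].
  apply: (lee_cvg_to bcvg H) => //; apply: nearW => k.
  have Hk := avoid_nnsfun_cvg (f1 k) (foo k).
  have Hi := ereal_nonincreasing_cvgn
    (integral_avoid_nonincreasing (measurable_funP (f k)) (f01 k)).
  rewrite /b -(cvg_lim (@ereal_hausdorff R) Hk) (cvg_lim (@ereal_hausdorff R) Hi).
  by apply: ereal_inf_lbound; exists m.
suff <- : l = (expR (- fine (\int[nu]_x (p x)%:E)))%:E by [].
apply/eqP; rewrite eq_le; apply/andP; split; last first.
  by apply: le_ereal_inf_tmp => _ [m _ <-]; exact: ab.
apply: (@cvge_ge _ _ _ _ b) bcvg; apply: nearW => k.
apply: (lee_cvg_to acvg (avoid_nnsfun_cvg (f1 k) (foo k))).
apply: nearW => m; apply: ge0_le_integral => //.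
- by move=> w _; rewrite lee_fin; case/andP: (avoid01 m w p01).
- by apply/measurable_EFinP; exact: measurable_avoid.
- by apply/measurable_EFinP; exact: measurable_avoid.
- move=> w _; rewrite lee_fin; apply: avoid_anti => // x.
  by case/andP: (p01 x).
Qed.

End laplace_functional.

(** * Void probability and pairs of points of the marked process *)

Section marked_poisson.
Context {R : realType} dT (T : measurableType dT) (P : probability T R).
Context dE (E : measurableType dE) (nu : {sigma_finite_measure set E -> \bar R}).
Context dM (M : measurableType dM) (Q : probability M R).
Variables (X : nat -> T -> E) (L : nat -> T -> M).
Hypotheses (mX : forall i, measurable_fun setT (X i))
  (mL : forall i, measurable_fun setT (L i)).
Hypothesis mdiag : forall i j, measurable [set w | X i w <> X j w].
Hypothesis injX : {ae P, forall w, injective (X ^~ w)}.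
Hypothesis poissonX : forall (n : nat) (A : 'I_n -> set E) (k : 'I_n -> nat),
  (forall i, measurable (A i) /\ (nu (A i) < +oo)%E) -> trivIset setT A ->
  P [set w | forall i, counting (range (X ^~ w) `&` A i) = (k i)%:R%:E :> \bar R] =
  (\prod_(i < n) poisson_prob (fine (nu (A i))) (k i) [set k i])%E.
Hypothesis indXL : forall D (n : nat) (H : nat -> set M), <<s points_events X >> D ->
  (forall i, measurable (H i)) ->
  (P (D `&` [set w | forall i, (i < n)%N -> H i (L i w)]) =
   P D * \prod_(i < n) Q (H i))%E.

Variable S : set (E * M).
Hypotheses (mS : measurable S) (Soo : ((nu \x Q) S < +oo)%E).
Let Lam : R := fine ((nu \x Q) S).

Definition mark_hit (i : nat) : set T := [set w | S (X i w, L i w)].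

Lemma measurable_mark_hit i : measurable (mark_hit i).
Proof.
apply: (measurable_preimageT (f := fun w => (X i w, L i w))) mS.
by apply: measurable_fun_pair.
Qed.

Definition thin (c : R) (m : nat) (w : T) : R :=
  \prod_(i < m) (1 - c * \1_(mark_hit i) w).

Let factor01 (c : R) i w : 0 <= c <= 1 -> 0 <= 1 - c * \1_(mark_hit i) w <= 1.
Proof.
move=> /andP[c0 c1]; rewrite indicE; case: (w \in mark_hit i);
by rewrite ?mulr1 ?mulr0 ?subr0 ?lexx ?ler01 // subr_ge0 c1 lerBlDr lerDl.
Qed.

Lemma thin01 (c : R) m w : 0 <= c <= 1 -> 0 <= thin c m w <= 1.
Proof.
move=> c01; apply/andP; split.
  by apply: prodr_ge0 => i _; case/andP: (factor01 i w c01).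
by apply: prodr_ile1 => i _; exact: factor01.
Qed.

Lemma measurable_thin (c : R) m : measurable_fun setT (thin c m).
Proof.
apply: measurable_prod => i _; apply: measurable_funB => //.
apply: measurable_funM; first exact: measurable_cst.
by apply: measurable_indic; exact: measurable_mark_hit.
Qed.

(** Averaging the marks turns each factor into 1 - c Q(S_x), S_x being the section of S at x; what
    remains is a thinning of the unmarked points, with total retention c Lam. *)
Lemma thin_cvg (c : R) : 0 <= c <= 1 ->
  (\int[P]_w (thin c m w)%:E)%E @[m --> \oo] --> (expR (- (c * Lam)))%:E.
Proof.
move=> c01; have [c0 c1] := andP c01.
have mS1 : measurable_fun setT (\1_S : E * M -> R) by exact: measurable_indic.
pose phi (x : E * M) : R := 1 - c * \1_S x.
have mphi : measurable_fun setT phi.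
  apply: measurable_funB; first exact: measurable_cst.
  by apply: measurable_funM; [exact: measurable_cst|exact: measurable_indic].
have phi01 x : 0 <= phi x <= 1.
  rewrite /phi indicE; case: (x \in S);
  by rewrite ?mulr1 ?mulr0 ?subr0 ?lexx ?ler01 // subr_ge0 c1 lerBlDr lerDl.
pose p x : R := c * fine (Q (xsection S x)).
have Qf x : Q (xsection S x) \is a fin_num.
  by apply: fin_num_measure; exact: measurable_xsection.
have Q01 x : 0 <= fine (Q (xsection S x)) <= 1.
  rewrite fine_ge0 //= -lee_fin fineK //.
  by apply: probability_le1; exact: measurable_xsection.
have p01 x : 0 <= p x <= 1.
  by have /andP[q0 q1] := Q01 x; rewrite mulr_ge0 //= mulr_ile1.
have mQ : measurable_fun setT (fun x => fine (Q (xsection S x))).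
  apply/measurable_EFinP; apply: eq_measurable_fun (measurable_fun_xsection Q mS).
  by move=> x _ /=; rewrite fineK.
have mp : measurable_fun setT p by apply: measurable_funM.
have meanE x : mark_mean Q phi x = 1 - p x.
  apply: EFin_inj; rewrite -mark_meanE // /phi.
  under eq_integral do rewrite EFinB.
  rewrite integralB //; last 2 first.
  - exact: finite_measure_integrable_cst.
  - apply: (@le_integrable _ _ _ _ _ measurableT _ (EFin \o cst 1)).
    + apply/measurable_EFinP; apply: measurable_funM => //.
      by apply: (measurableT_comp mS1); exact: pair1_measurable.
    + move=> m _; rewrite /= lee_fin normr1 indicE; case: (_ \in _);
      by rewrite ?mulr1 ?mulr0 ?normr0 ?ler01 // ger0_norm.
    + exact: finite_measure_integrable_cst.
  rewrite integral_one_probability EFinB /p EFinM fineK //; congr (_ - _)%E.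
  under eq_integral do rewrite EFinM.
  rewrite ge0_integralZl_EFin //; last first.
    apply/measurable_EFinP; apply: (measurableT_comp mS1).
    exact: pair1_measurable.
  congr (_ * _)%E.
  transitivity (\int[Q]_m (\1_(xsection S x) m)%:E)%E.
    by apply: eq_integral => m _; rewrite !indicE mem_xsection.
  by rewrite integral_indic ?setIT //; exact: measurable_xsection.
have Ip : (\int[nu]_x (p x)%:E = c%:E * (nu \x Q) S)%E.
  rewrite /p; under eq_integral do rewrite EFinM fineK //.
  by rewrite ge0_integralZl_EFin //; exact: measurable_fun_xsection.
have := avoid_cvg mX mdiag injX poissonX mp p01.
rewrite Ip => H; rewrite (_ : c * Lam = fine (c%:E * (nu \x Q) S)%E); last first.
  by rewrite fineM // ge0_fin_numE.
rewrite (_ : (fun m => _) = (fun m => \int[P]_w (avoid X p m w)%:E)%E).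
  by apply: H; rewrite lte_mul_pinfty // lee_fin.
apply/funext => m.
transitivity (\int[P]_w (\prod_(i < m) phi (X i w, L i w))%:E)%E.
  by apply: eq_integral => w _; congr EFin; exact: eq_bigr.
rewrite (integral_prod_marks mX mL indXL mphi phi01).
by apply: eq_integral => w _; congr EFin; apply: eq_bigr => i _; rewrite meanE.
Qed.

Let none m : set T := [set w | forall i, (i < m)%N -> ~ mark_hit i w].

Let measurable_none m : measurable (none m).
Proof.
rewrite (_ : none m = \bigcap_(i in `I_m) ~` mark_hit i) //.
apply: fin_bigcap_measurable; first exact: finite_II.
by move=> i _; apply: measurableC; exact: measurable_mark_hit.
Qed.

Let none_cvg : P (none m) @[m --> \oo] --> (expR (- Lam))%:E.
Proof.
have := @thin_cvg 1; rewrite mul1r lexx ler01 => /(_ isT).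
rewrite (_ : (fun m => _) = (fun m => P (none m))) //; apply/funext => m.
transitivity (\int[P]_w (\1_(none m) w)%:E)%E; last first.
  by rewrite integral_indic ?setIT.
apply: eq_integral => w _; congr EFin; rewrite /thin [RHS]indicE.
have [nw|nw] := pselect (none m w).
  rewrite mem_set // big1 // => i _.
  by rewrite indicE memNset ?mulr0 ?subr0 //; exact: nw.
rewrite memNset //; move: nw => /existsNP[i /not_implyP[im /contrapT hi]].
by rewrite (bigD1 (Ordinal im)) //= indicE mem_set // mulr1 subrr mul0r.
Qed.

Theorem void_probability :
  P [set w | forall i, ~ mark_hit i w] = (expR (- Lam))%:E.
Proof.
have -> : [set w | forall i, ~ mark_hit i w] = \bigcap_m none m.
  apply/seteqP; split => w /= H; first by move=> m _ i _; exact: H.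
  by move=> i; apply: (H i.+1 I).
have H : P (none m) @[m --> \oo] --> P (\bigcap_m none m).
  apply: nonincreasing_cvg_mu => //.
  - by rewrite (le_lt_trans (probability_le1 _ _)) ?ltry.
  - exact: bigcapT_measurable.
  - by move=> m k mk; apply/subsetPset => w H i im; apply: H; exact: leq_trans mk.
by rewrite -(cvg_lim (@ereal_hausdorff R) H) (cvg_lim (@ereal_hausdorff R) none_cvg).
Qed.

Let two m : set T := [set w | exists i j, [/\ (i < j)%N, (j < m)%N,
  mark_hit i w & mark_hit j w]].

Let measurable_two m : measurable (two m).
Proof.
rewrite (_ : two m = \bigcup_i \bigcup_j
   ((mark_hit i `&` mark_hit j) `&` [set _ | (i < j)%N /\ (j < m)%N])).
  apply: bigcupT_measurable => i; apply: bigcupT_measurable => j.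
  apply: measurableI; last exact: measurable_setU_Prop.
  by apply: measurableI; exact: measurable_mark_hit.
apply/seteqP; split => w /=.
  by move=> [i [j [ij jm hi hj]]]; exists i => //; exists j.
by move=> [i _ [j _ [[hi hj] [ij jm]]]]; exists i, j.
Qed.

Let half01 : 0 <= (2^-1 : R) <= 1.
Proof. by rewrite invr_ge0 ler0n /= invf_le1 ?ler1n. Qed.

(* The generating function at 1/2: with N points, 2^-N is 1 if N = 0, is 1/2 if
   N = 1 and is at most 1/4 if N >= 2. *)
Let thin_two m w : thin (2^-1 : R) m w + (4^-1 : R) * \1_(two m) w <=
  (2^-1 : R) + 2^-1 * \1_(none m) w.
Proof.
have rest (Pr : pred 'I_m) : 0 <= \prod_(i < m | Pr i) (1 - (2^-1 : R) * \1_(mark_hit i) w) <= 1.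
  apply/andP; split.
    by apply: prodr_ge0 => i _; case/andP: (factor01 i w half01).
  by apply: prodr_ile1 => i _; exact: factor01.
have [[i [j [ij jm hi hj]]]|ntwo] := pselect (two m w).
  have tw : two m w by exists i, j.
  rewrite [\1_(two m) w]indicE mem_set // mulr1.
  rewrite [\1_(none m) w]indicE memNset ?mulr0 ?addr0; last first.
    by move=> /(_ j jm).
  have im := ltn_trans ij jm.
  rewrite /thin (bigD1 (Ordinal im)) //= (bigD1 (Ordinal jm)) /=; last first.
    by rewrite -val_eqE /= gtn_eqF.
  rewrite !indicE !mem_set // mulr1.
  have := rest (fun k => (k != Ordinal im) && (k != Ordinal jm)).
  by set r := (\prod_(k < m | _) _) => /andP[r0 r1]; lra.
rewrite [\1_(two m) w]indicE memNset // mulr0 addr0.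
have [nw|nw] := pselect (none m w).
  rewrite indicE mem_set // mulr1; have /andP[_] := thin01 m w half01.
  by move/le_trans; apply; lra.
rewrite indicE memNset // mulr0 addr0.
move: nw => /existsNP[i /not_implyP[im /contrapT hi]].
rewrite /thin (bigD1 (Ordinal im)) //= indicE mem_set // mulr1.
have := rest (fun k => (k != Ordinal im)).
by set r := (\prod_(k < m | _) _) => /andP[r0 r1]; lra.
Qed.

(** In the limit, [thin_two] bounds the probability by 2 + 2 exp(-Lam) - 4 exp(-Lam/2) = 2 (1 -
    exp(-Lam/2))^2, which is at most Lam^2 / 2. *)
Theorem two_points_le :
  (P [set w | exists i j, [/\ i <> j, mark_hit i w & mark_hit j w]] <= (Lam ^+ 2)%:E)%E.
Proof.
have L0 : 0 <= Lam by exact: fine_ge0.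
have -> : [set w | exists i j, [/\ i <> j, mark_hit i w & mark_hit j w]] = \bigcup_m two m.
  apply/seteqP; split => w /=.
    move=> [i [j [/eqP]]]; rewrite neq_ltn => /orP[ij|ji] hi hj.
      by exists j.+1 => //; exists i, j.
    by exists i.+1 => //; exists j, i.
  move=> [m _ [i [j [ij _ hi hj]]]]; exists i, j; split => //.
  by move=> e; move: ij; rewrite e ltnn.
have tH : P (two m) @[m --> \oo] --> P (\bigcup_m two m).
  apply: nondecreasing_cvg_mu => //; first exact: bigcupT_measurable.
  move=> m k mk; apply/subsetPset => w [i [j [ij jm hi hj]]].
  by exists i, j; split => //; exact: leq_trans mk.
have Pf A : measurable A -> P A \is a fin_num by move=> mA; exact: fin_num_measure.
have thf m : (\int[P]_w (thin (2^-1 : R) m w)%:E)%E \is a fin_num.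
  rewrite ge0_fin_numE; last first.
    by apply: integral_ge0 => w _; rewrite lee_fin; case/andP: (thin01 m w half01).
  apply: (@le_lt_trans _ _ (\int[P]_w 1%:E)%E); last by rewrite integral_one_probability ltry.
  apply: ge0_le_integral => //.
  - by move=> w _; rewrite lee_fin; case/andP: (thin01 m w half01).
  - by apply/measurable_EFinP; exact: measurable_thin.
  - by move=> w _; rewrite lee_fin; case/andP: (thin01 m w half01).
have step m : fine (P (two m)) <= 2 + 2 * fine (P (none m)) -
    4 * fine (\int[P]_w (thin (2^-1 : R) m w)%:E)%E.
  suff : fine (\int[P]_w (thin (2^-1 : R) m w)%:E)%E + 4^-1 * fine (P (two m)) <=
    2^-1 + 2^-1 * fine (P (none m)) by lra.
  rewrite -lee_fin !EFinD !EFinM !fineK ?Pf //.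
  have mind (A : set T) : measurable A -> measurable_fun setT (fun w => (\1_A w : R)%:E).
    by move=> mA; apply/measurable_EFinP; exact: measurable_indic.
  have indE (k : R) (A : set T) : 0 <= k -> measurable A ->
      (k%:E * P A = \int[P]_w (k%:E * (\1_A w)%:E))%E.
    move=> k0 mA; rewrite ge0_integralZl_EFin //; last exact: mind.
    by rewrite integral_indic ?setIT.
  have k4 : 0 <= (4^-1 : R) by rewrite invr_ge0 ler0n.
  have k2 : 0 <= (2^-1 : R) by rewrite invr_ge0 ler0n.
  have mth : measurable_fun setT (fun w => (thin (2^-1 : R) m w)%:E).
    by apply/measurable_EFinP; exact: measurable_thin.
  have th0 w : (0 <= (thin (2^-1 : R) m w)%:E)%E.
    by rewrite lee_fin; case/andP: (thin01 m w half01).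
  have mk (k : R) (A : set T) : measurable A ->
      measurable_fun setT (fun w => k%:E * (\1_A w)%:E)%E.
    by move=> mA; apply: emeasurable_funM; [exact: measurable_cst|exact: mind].
  have k0 (k : R) (A : set T) w : 0 <= k -> (0 <= k%:E * (\1_A w)%:E)%E.
    by move=> kp; rewrite mule_ge0 // lee_fin.
  rewrite !indE //.
  rewrite [X in (_ <= X + _)%E](_ : _ = \int[P]_w (2^-1%:E : \bar R))%E; last first.
    rewrite integral_cst //; rewrite [X in (_ * X)%E](_ : _ = 1%E) ?mule1 //.
    exact: probability_setT.
  rewrite -!ge0_integralD //; [|exact: mk|exact: mk].
  apply: ge0_le_integral => //.
  - by move=> w _; rewrite adde_ge0 // k0.
  - by apply: emeasurable_funD => //; exact: mk.
  - by apply: emeasurable_funD => //; exact: mk.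
  - by move=> w _; rewrite -!EFinM -!EFinD lee_fin; exact: thin_two.
have bound m : (P (two m) <= (2 + 2 * expR (- Lam) - 4 * expR (- (2^-1 * Lam)))%:E)%E.
  rewrite -[leLHS]fineK ?Pf // lee_fin.
  have c1 : fine (P (none k)) @[k --> \oo] --> expR (- Lam).
    by move/fine_cvgP: none_cvg => [].
  have c2 : fine (\int[P]_w (thin (2^-1 : R) k w)%:E)%E @[k --> \oo] --> expR (- (2^-1 * Lam)).
    by move/fine_cvgP: (thin_cvg half01) => [].
  have c3 : 2 + 2 * fine (P (none k)) - 4 * fine (\int[P]_w (thin (2^-1 : R) k w)%:E)%E
      @[k --> \oo] --> 2 + 2 * expR (- Lam) - 4 * expR (- (2^-1 * Lam)).
    by apply: cvgB; [apply: cvgD; [exact: cvg_cst|exact: cvgMl_tmp]|exact: cvgMl_tmp].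
  apply: (ler_cvg_to (cvg_cst _) c3); near=> k.
  apply: le_trans (step k); rewrite fine_le ?Pf //.
  apply: le_measure; rewrite ?inE // => w [i [j [ij jm hi hj]]].
  exists i, j; split => //; apply: leq_trans jm _.
  by near: k; exact: nbhs_infty_ge.
apply: (@le_trans _ _ (2 + 2 * expR (- Lam) - 4 * expR (- (2^-1 * Lam)))%:E).
  by apply: cvge_le tH; apply: nearW.
rewrite lee_fin; set x := 2^-1 * Lam.
have LE : Lam = x + x by rewrite /x; field.
have ex : expR (- Lam) = expR (- x) * expR (- x) by rewrite LE opprD expRD.
have e1 : expR (- x) >= 1 - x by have := expR_ge1Dx (- x).
have x0 : 0 <= x by rewrite /x mulr_ge0 //; case/andP: half01.
have e2 : expR (- x) <= 1 by rewrite -[leRHS]expR0 ler_expR oppr_le0.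
rewrite ex LE; move: e1 e2 x0; set u := expR (- x) => e1 e2 x0.
have : (1 - u) ^+ 2 <= x ^+ 2 by rewrite lerXn2r ?nnegrE //; lra.
by rewrite !expr2; nra.
Unshelve. all: by end_near. Qed.

End marked_poisson.

(** * The contact distance and direction *)

Section contact.
Context {R : realType} {d : nat}.
Local Notation E := 'rV[R]_d.
Local Notation BE := (borelRd R d).
Local Notation Conf := (confRd R d).
Variables (B : set E) (u0 : E).
Hypotheses (cB : compact B) (vB : convex_set B) (nB : nbhs (0 : E) B).
Local Notation g := (gauge B).

Lemma dB_ge0 (Z : set E) : (0 <= dB B 0 Z)%E.
Proof.
rewrite dBE //; apply: le_ereal_inf_tmp => _ [z _ <-].
by rewrite lee_fin gauge_ge0.
Qed.

Lemma dB_le (Z : set E) (z : E) : Z z -> (dB B 0 Z <= (g z)%:E)%E.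
Proof. by move=> Zz; rewrite dBE //; apply: ereal_inf_lbound; exists z. Qed.

Lemma dB_lt (Z : set E) (t : \bar R) : (dB B 0 Z < t)%E ->
  exists2 z, Z z & ((g z)%:E < t)%E.
Proof.
by rewrite dBE // => /ereal_inf_lt[_ [z Zz <-]] zt; exists z.
Qed.

(** An infinite distance is read as 0 here, which is harmless because contact directions are only
    evaluated when the distance is positive and finite. *)
Definition contact (Z : set E) : set E := [set z | Z z /\ g z <= fine (dB B 0 Z)].

Lemma uB_contact (Z : set E) (y : E) : (0 < dB B 0 Z < +oo)%E ->
  contact Z = [set y] -> uB B u0 Z 0 = (fine (dB B 0 Z))^-1 *: (0 - y).
Proof.
move=> d0 cy; rewrite /uB; apply: xget_unique.
  split => //; exists y => //; rewrite (contactE cB vB nB) //.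
  by rewrite fine_ge0 // dB_ge0.
move=> u [_ [y' cy' ->]]; move: cy'.
rewrite (contactE cB vB nB) ?fine_ge0 ?dB_ge0 // => cy'.
have : [set y] y' by rewrite -cy /contact cy'.
by move=> ->.
Qed.

Lemma uB_no_contact (Z : set E) :
  ~ ((0 < dB B 0 Z < +oo)%E /\ exists y, contact Z = [set y]) -> uB B u0 Z 0 = u0.
Proof.
move=> nc; rewrite /uB; apply: xgetPN => u [d0 [y cy _]]; apply: nc; split => //.
by exists y; rewrite -cy (contactE cB vB nB) // fine_ge0 // dB_ge0.
Qed.

(** A nonempty set is a singleton iff no rational half-space splits it: countably many tests, each
    expressible as an event. *)
Lemma single_halfspaces (K : set E) : (exists y, K = [set y]) <->
  K !=set0 /\ forall q : 'I_d * rat,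
    ~ ((K `&` halfspace q) !=set0 /\ (K `&` ~` halfspace q) !=set0).
Proof.
split => [[y ->]|[[y Ky] H]].
  by split => [|q [[_ [->]] yq [_ [-> nyq]]]]; [exists y|exact: nyq].
exists y; apply/seteqP; split => [z Kz|_ -> //].
apply: contrapT => zy; have [q [[h1 h2]|[h1 h2]]] := halfspace_separated zy.
  by apply: (H q); split; [exists z|exists y].
by apply: (H q); split; [exists y|exists z].
Qed.

Section process.
Context dT (T : measurableType dT).
Variables (X : nat -> T -> E) (L : nat -> T -> set E).
Hypotheses (mX : forall i, measurable_fun setT (X i : T -> BE))
  (mL : forall i, measurable_fun setT (L i : T -> Conf))
  (fL : forall i w, finite_set (L i w)).

Local Notation Z := (cluster_process X L).
Let dist w := dB B 0 (Z w).
Let r w := fine (dist w).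

Lemma cluster_processP w z :
  Z w z <-> exists i, exists2 y, L i w y & z = X i w + y.
Proof.
split=> [[i _ [y Ly <-]]|[i [y Ly ->]]]; first by exists i, y => //; rewrite addrC.
by exists i => //; exists y => //; rewrite addrC.
Qed.

Lemma measurable_process_hit (A : set (T * BE)) : measurable A ->
  measurable [set w | exists2 z, Z w z & A (w, z)].
Proof.
move=> mA.
rewrite (_ : [set w | _] = \bigcup_i [set w | finite_set (L i w) /\
    exists2 y, L i w y & A (w, X i w + y)]); last first.
  apply/seteqP; split => w /=.
    by move=> [z /cluster_processP[i [y Ly ->]] Az]; exists i => //; split => //; exists y.
  move=> [i _ [_ [y Ly Ay]]]; exists (X i w + y) => //.
  by apply/cluster_processP; exists i, y.
apply: bigcupT_measurable => i.
have mXi : measurable_fun setT (fun q : T * BE => (q.1, X i q.1 + (q.2 : E)) : T * BE).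
  apply: measurable_fun_pair; first exact: measurable_fst.
  apply: measurable_funD_rV; last exact: measurable_snd.
  exact: (measurableT_comp (mX i) measurable_fst).
exact: (measurable_hit (mL i) (measurable_preimageT mXi mA)).
Qed.

Let mg2 : measurable_fun setT (fun q : T * BE => g (q.2 : E)).
Proof. exact: (measurableT_comp (measurable_gauge cB vB nB) measurable_snd). Qed.

Lemma measurable_dist : measurable_fun setT dist.
Proof.
apply: (measurability (@ErealGenInftyO.G R)); first exact: ErealGenInftyO.measurableE.
move=> _ [_ [t ->] <-]; rewrite setTI.
rewrite (_ : _ @^-1` _ = [set w | exists2 z, Z w z & g z < t]).
  by apply: (measurable_process_hit (A := [set q : T * BE | g (q.2 : E) < t]));
    exact: measurable_ltr.
apply/seteqP; split => w /=; rewrite in_itv /=.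
  by move=> /dB_lt[z Zz zt]; exists z.
by move=> [z Zz zt]; apply: le_lt_trans (dB_le Zz) _; rewrite lte_fin.
Qed.

Let mr : measurable_fun setT r.
Proof. exact: (measurableT_comp (fine_measurable measurableT) measurable_dist). Qed.

Let touch (A : set (T * BE)) : set T :=
  [set w | exists2 z, Z w z & g z <= r w /\ A (w, z)].

Let measurable_touch A : measurable A -> measurable (touch A).
Proof.
move=> mA; apply: (measurable_process_hit
  (A := [set q : T * BE | g (q.2 : E) <= r q.1] `&` A)).
apply: measurableI => //; apply: measurable_ler => //.
exact: (measurableT_comp mr measurable_fst).
Qed.

Let touchP A w : touch A w <-> (contact (Z w) `&` [set z | A (w, z)]) !=set0.
Proof.
by split => [[z Zz [zr Az]]|[z [[Zz zr] Az]]]; exists z.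
Qed.

Let msnd (A : set BE) : measurable A -> measurable [set q : T * BE | A q.2].
Proof. by move=> mA; exact: (measurable_preimageT measurable_snd mA). Qed.

Let single : set T := [set w | exists y, contact (Z w) = [set y]].

Let measurable_single : measurable single.
Proof.
rewrite (_ : single = touch setT `&` \bigcap_(q in [set: 'I_d * rat])
  ~` (touch [set p | halfspace q (p.2 : E)] `&`
      touch [set p | (~` halfspace q) (p.2 : E)])).
  apply: measurableI; first exact: measurable_touch.
  rewrite -[X in measurable X]setCK setC_bigcap; apply: measurableC.
  apply: countable_bigcupT_measurable; first exact: countableP.
  move=> q; rewrite setCK; apply: measurableI; apply: measurable_touch;
    apply: msnd; last apply: measurableC; exact: measurable_halfspace.
apply/seteqP; split => w.
  move=> /single_halfspaces[[y Ky] H]; split; first by apply/touchP; exists y.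
  by move=> q _ [/touchP h1 /touchP h2]; exact: (H q).
move=> [/touchP[y [Ky _]] H]; apply/single_halfspaces; split; first by exists y.
by move=> q [h1 h2]; apply: (H q I); split; exact/touchP.
Qed.

(** Where the contact point is unique at a positive finite distance, the direction lies in C iff
    some contact point has its direction in C, an existential over the process. Elsewhere the
    direction is the default [u0]. *)
Lemma measurable_contact_event (t : R) (C : set E) : borel C ->
  measurable [set w | (dist w <= t%:E)%E /\ C (uB B u0 (Z w) 0)].
Proof.
move=> mC; pose pos := [set w | (0 < dist w < +oo)%E].
have mpos : measurable pos.
  rewrite (_ : pos = dist @^-1` `]0%E, +oo%E[).
    exact: (measurable_preimageT measurable_dist (emeasurable_itv _)).
  by apply/seteqP; split => w /=; rewrite in_itv.
pose dir : set (T * BE) := [set q | C ((r q.1)^-1 *: (0 - (q.2 : E)))].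
have mdir : measurable dir.
  apply: (@measurable_preimageT _ _ _ BE _ C); last exact: mC.
  apply: measurable_funZ_rV.
    rewrite (_ : (fun _ => _) = (fun q : T * BE => r q.1 `^ (-1))).
      have mr1 : measurable_fun setT (fun q : T * BE => r q.1).
        exact: (measurableT_comp mr measurable_fst).
      exact: (measurableT_comp (@measurable_powR R (-1)) mr1).
    by apply/funext => q; rewrite powR_inv1 // fine_ge0 // dB_ge0.
  by apply: measurable_funB_rV; [exact: measurable_cst|exact: measurable_snd].
rewrite (_ : [set w | _] = [set w | (dist w <= t%:E)%E] `&`
   (((pos `&` single) `&` touch dir) `|` (~` (pos `&` single) `&` [set _ | C u0]))).
  apply: measurableI.
    rewrite -[X in measurable X]setTI; apply: emeasurable_fun_infty_c => //.
    exact: measurable_dist.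
  apply: measurableU.
    by apply: measurableI; [exact: measurableI|exact: measurable_touch].
  apply: measurableI; last exact: measurable_setU_Prop.
  by apply: measurableC; exact: measurableI.
have key w : C (uB B u0 (Z w) 0) <->
   (((pos `&` single) `&` touch dir) `|` (~` (pos `&` single) `&` [set _ | C u0])) w.
  have [ps|nps] := pselect ((pos `&` single) w); last first.
    rewrite uB_no_contact //; split => [Cu|[[]|[]] //]; by right.
  have [pw [y cy]] := ps; rewrite (uB_contact pw cy).
  split => [Cy|[[_ /touchP[z []]]|[]//]]; last by rewrite cy => ->.
  by left; split => //; apply/touchP; exists y; rewrite cy.
apply/seteqP; split => w.
  by move=> [dt Cu]; split => //; exact/key.
by move=> [dt H]; split => //; exact/key.
Qed.

End process.
End contact.

Lemma finite_argmin (T : eqType) (R : realDomainType) (f : T -> R) (L : set T) (x : T) :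
  finite_set L -> L x -> exists2 y, L y & forall y', L y' -> f y <= f y'.
Proof.
move=> /finite_seqP[s ->]; elim: s x => [//|z s IH] x.
have [->|sn] := eqVneq s [::].
  move=> _; exists z => [|y']; first by rewrite /= mem_seq1.
  by rewrite /= mem_seq1 => /eqP ->.
move=> _; have [w ws] : exists w, w \in s.
  by case: s sn {IH} => // w s' _; exists w; rewrite mem_head.
have [y ys ymin] := IH w ws.
have [yz|zy] := leP (f y) (f z).
  exists y; first by rewrite /= inE ys orbT.
  by move=> y'; rewrite /= inE => /predU1P[->|/ymin].
exists z; first by rewrite /= mem_head.
move=> y'; rewrite /= inE => /predU1P[->//|/ymin]; exact/le_trans/ltW.
Qed.

(** * Pathwise comparison of contact with cluster events *)

Section sandwich.
Context {R : realType} {d : nat}.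
Local Notation E := 'rV[R]_d.
Local Notation BE := (borelRd R d).
Local Notation Conf := (confRd R d).
Variables (B : set E) (u0 : E).
Hypotheses (cB : compact B) (vB : convex_set B) (nB : nbhs (0 : E) B).
Local Notation g := (gauge B).

(** The least gauge over the cluster lies in ]a, b]: a cluster that already has a point within
    radius a is excluded even if it also has points in the shell. *)
Definition shell (a b : R) : set (BE * Conf) := hits_ball g b `\` hits_ball g a.

Definition target (a b : R) (C : set E) : set E :=
  [set z | a < g z <= b /\ C ((g z)^-1 *: (0 - z))].

Context dT (T : measurableType dT) (X : nat -> T -> E) (L : nat -> T -> set E).
Hypothesis fL : forall i w, finite_set (L i w).
Local Notation Z := (cluster_process X L).
Variable w : T.
Local Notation at_ S i := (S (X i w, L i w)).

Let in_process i y : L i w y -> Z w (X i w + y).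
Proof. by move=> Ly; apply/cluster_processP; exists i, y. Qed.

Let minimum_contact (z0 : E) : Z w z0 -> 0 < g z0 ->
  (forall z, Z w z -> z <> z0 -> g z0 < g z) ->
  dB B 0 (Z w) = (g z0)%:E /\ uB B u0 (Z w) 0 = (g z0)^-1 *: (0 - z0).
Proof.
move=> Zz0 gp H.
have dE : dB B 0 (Z w) = (g z0)%:E.
  apply/eqP; rewrite eq_le dB_le //= dBE //; apply: le_ereal_inf_tmp => _ [z Zz <-].
  rewrite lee_fin; have [->//|/eqP zz0] := eqVneq z z0; exact/ltW/H.
split => //; rewrite -[X in X^-1](_ : fine (dB B 0 (Z w)) = g z0); last by rewrite dE.
apply: (uB_contact u0 cB vB nB); first by rewrite dE lte_fin gp ltry.
apply/seteqP; split => z; rewrite /contact /= dE /=.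
  by move=> [Zz zz0]; apply: contrapT => /(H _ Zz); rewrite ltNge zz0.
by move=> ->.
Qed.

(* As only one cluster reaches the shell [a < g <= b], its strict minimiser is
   the contact point. *)
Lemma sandwich_lower (a b : R) (C : set E) (i0 : nat) : 0 <= a ->
  (forall i, ~ at_ (hits_ball g a) i) ->
  at_ (strict_min g (target a b C)) i0 ->
  ~ (exists i j, [/\ i <> j, at_ (shell a b) i & at_ (shell a b) j]) ->
  [/\ (a%:E < dB B 0 (Z w))%E, (dB B 0 (Z w) <= b%:E)%E & C (uB B u0 (Z w) 0)].
Proof.
move=> a0 na [_ [y Ly [[/andP[/= ay yb] Cy] ymin]]] ntwo.
have [dE uE] : dB B 0 (Z w) = (g (X i0 w + y))%:E /\
    uB B u0 (Z w) 0 = (g (X i0 w + y))^-1 *: (0 - (X i0 w + y)).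
  apply: minimum_contact; [exact: in_process|exact: le_lt_trans ay|].
  move=> _ /cluster_processP[i [y' Ly' ->]] zz0.
  have [ii0|/eqP ii0] := eqVneq i i0.
    move: Ly' zz0; rewrite ii0 => Ly' zz0; apply: ymin => // e.
    by apply: zz0; rewrite e.
  apply: (le_lt_trans yb); rewrite ltNge; apply/negP => le; apply: ntwo.
  exists i, i0; split => //; split; try exact: na.
    by split; [exact: fL|exists y'].
  by split; [exact: fL|exists y].
by rewrite dE uE !lte_fin lee_fin.
Qed.

(* The infimum defining [dB] need not be attained, and [b < b'] leaves room to
   pick a near minimiser; its cluster is then the only one within reach. *)
Lemma sandwich_upper (a b b' : R) (C : set E) : 0 <= a -> b < b' ->
  (a%:E < dB B 0 (Z w))%E -> (dB B 0 (Z w) <= b%:E)%E -> C (uB B u0 (Z w) 0) ->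
  (forall i, ~ at_ (tied g) i) ->
  ~ (exists i j, [/\ i <> j, at_ (shell a b') i & at_ (shell a b') j]) ->
  (forall i, ~ at_ (hits_ball g a) i) /\
  exists i, at_ (strict_min g (target a b C)) i.
Proof.
move=> a0 bb' ad db Cu nt ntwo.
have na i : ~ at_ (hits_ball g a) i.
  move=> [_ [y Ly ya]]; have := dB_le cB vB nB (in_process Ly).
  by move=> /(lt_le_trans ad); rewrite lte_fin ltNge ya.
split => //.
have [z1 /cluster_processP[i [y1 Ly1 ->]]] : exists2 z, Z w z & ((g z)%:E < b'%:E)%E.
  by apply: (dB_lt cB vB nB); apply: le_lt_trans db _; rewrite lte_fin.
rewrite lte_fin => y1b.
have [y Ly ymin] := finite_argmin (fun y => g (X i w + y)) (fL i w) Ly1.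
have yb' : g (X i w + y) < b' by apply: le_lt_trans y1b; exact: ymin.
have ay : a < g (X i w + y).
  rewrite ltNge; apply/negP => ya; apply: (na i); split; first exact: fL.
  by exists y.
have strict y' : L i w y' -> y' <> y -> g (X i w + y) < g (X i w + y').
  move=> Ly' yy'; rewrite lt_neqAle ymin // andbT; apply/eqP => e.
  apply: (nt i); split; first exact: fL.
  exists y => //; exists y' => //; split => // ?; exact: yy'.
have [dE uE] : dB B 0 (Z w) = (g (X i w + y))%:E /\
    uB B u0 (Z w) 0 = (g (X i w + y))^-1 *: (0 - (X i w + y)).
  apply: minimum_contact; [exact: in_process|exact: le_lt_trans ay|].
  move=> _ /cluster_processP[j [y' Ly' ->]] zz0.
  have [ji|/eqP ji] := eqVneq j i.
    move: Ly' zz0; rewrite ji => Ly' zz0; apply: strict => // e.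
    by apply: zz0; rewrite e.
  apply: (lt_le_trans yb'); rewrite leNgt; apply/negP => lt; apply: ntwo.
  exists j, i; split => //; split; try exact: na.
    by split; [exact: fL|exists y' => //; exact: ltW].
  by split; [exact: fL|exists y => //; exact: ltW].
exists i; split; first exact: fL.
exists y => //; split; last exact: strict.
split; last by rewrite -uE.
by rewrite ay -lee_fin -dE.
Qed.

End sandwich.

(** * Poisson clusters *)

Section scaled_measure.
Context d (T : measurableType d) (R : realType) (k : {nonneg R}).
Variable m : {sigma_finite_measure set T -> \bar R}.

(* The library's finite-measure instance on [mscale] blocks a sigma-finite one,
   hence this alias. *)
Definition scaled_measure : set T -> \bar R := mscale k m.

HB.instance Definition _ := Measure.on scaled_measure.

Let scaled_measure_sigma_finite : sigma_finite setT scaled_measure.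
Proof.
have [F TF mF] := sigma_finiteT m; exists F => // i; have [mFi Fi] := mF i.
by split => //=; apply: lte_mul_pinfty.
Qed.

HB.instance Definition _ :=
  Measure_isSigmaFinite.Build _ _ _ scaled_measure scaled_measure_sigma_finite.

End scaled_measure.

Section poisson_clusters.
Context {R : realType} {d : nat}.
Local Notation E := 'rV[R]_d.
Local Notation BE := (borelRd R d).
Local Notation Conf := (confRd R d).
Local Notation nu := (@lebesgueRd R d).
Context dT (T : measurableType dT) (P : probability T R).
Context dT0 (T0 : measurableType dT0) (P0 : probability T0 R).
Variables (lam : R) (X : nat -> T -> E) (L0 : T0 -> set E) (L : nat -> T -> set E).
Hypotheses (lam0 : 0 < lam) (poissonX : stationary_poisson P lam X)
  (mL0 : measurable_fun setT (L0 : T0 -> Conf)) (iidL : iid_clusters P P0 X L0 L).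

(** The intensity measure of the marked process, written over the sample space of the typical
    cluster so that no measurability proof appears in it. *)
Definition cluster_intensity (S : set (BE * Conf)) : \bar R :=
  (lam%:E * \int[P0]_w nu [set x | S (x, L0 w)])%E.

Let rate : {sigma_finite_measure set BE -> \bar R} :=
  scaled_measure (NngNum (ltW lam0)) (lebesgueRd d).
Let Q : probability Conf R := image_measure P0 mL0.

Let rateE (S : set (BE * Conf)) : measurable S ->
  ((rate \x Q) S = cluster_intensity S)%E.
Proof.
move=> mS; rewrite /cluster_intensity -(cluster_intensityE P0 mL0) //.
rewrite /product_measure1 /rate /scaled_measure ge0_integral_mscale //=.
exact: measurable_fun_xsection.
Qed.

Let mX i : measurable_fun setT (X i : T -> BE).
Proof. by have [] := poissonX. Qed.

Let mL i : measurable_fun setT (L i : T -> Conf).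
Proof. by have [/(_ i)[]] := iidL. Qed.

Let injX : {ae P, forall w, injective (X ^~ w)}.
Proof. by have [] := poissonX. Qed.

Let rate_apply (A : set BE) : rate A = (lam%:E * nu A)%E.
Proof. by []. Qed.

Let rate_poisson (n : nat) (A : 'I_n -> set BE) (k : 'I_n -> nat) :
  (forall i, measurable (A i) /\ (rate (A i) < +oo)%E) -> trivIset setT A ->
  P [set w | forall i, counting (range (X ^~ w) `&` A i) = (k i)%:R%:E :> \bar R] =
  (\prod_(i < n) poisson_prob (fine (rate (A i))) (k i) [set k i])%E.
Proof.
move=> fA tA; have [_ _ pX] := poissonX.
(* A finite rate entails a finite volume because lam is positive. *)
have nuA i : (nu (A i) < +oo)%E.
  rewrite ltNge leye_eq; apply/negP => /eqP e; have := (fA i).2.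
  by rewrite rate_apply e gt0_muley ?lte_fin.
rewrite pX => [|i|//]; last by rewrite vol_lebesgueRd ?nuA //; case: (fA i).
apply: eq_bigr => i _; congr (poisson_prob _ _ _).
rewrite vol_lebesgueRd; last by case: (fA i).
by rewrite rate_apply fineM // ge0_fin_numE ?nuA.
Qed.

Let indXL D (n : nat) (H : nat -> set Conf) : <<s points_events (X : nat -> T -> BE) >> D ->
  (forall i, measurable (H i)) ->
  (P (D `&` [set w | forall i, (i < n)%N -> H i (L i w)]) =
   P D * \prod_(i < n) Q (H i))%E.
Proof.
move=> mD mH; have [_ lawL indL] := iidL.
have := indL D n (fun i => H i) mD (fun i => mH i).
rewrite (_ : [set w | forall i : 'I_n, _] = [set w | forall i, (i < n)%N -> H i (L i w)]).
  by move=> ->; congr (_ * _)%E; apply: eq_bigr => i _; exact: lawL.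
apply/seteqP; split => w /= h i; last exact: h.
by move=> ni; exact: (h (Ordinal ni)).
Qed.

Let mdiag i j : measurable [set w | X i w <> X j w].
Proof. exact: measurable_neq_rV. Qed.

Lemma cluster_void (S : set (BE * Conf)) : measurable S ->
  (cluster_intensity S < +oo)%E ->
  P [set w | forall i, ~ S (X i w, L i w)] =
  (expR (- fine (cluster_intensity S)))%:E.
Proof.
move=> mS Soo; rewrite -rateE //.
apply: (void_probability (nu := rate) (Q := Q) mX mL mdiag injX rate_poisson indXL mS).
by rewrite rateE.
Qed.

Lemma cluster_two_points (S : set (BE * Conf)) : measurable S ->
  (cluster_intensity S < +oo)%E ->
  (P [set w | exists i j, [/\ i <> j, S (X i w, L i w) & S (X j w, L j w)]] <=
   (fine (cluster_intensity S) ^+ 2)%:E)%E.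
Proof.
move=> mS Soo; rewrite -rateE //.
apply: (two_points_le (nu := rate) (Q := Q) mX mL mdiag injX rate_poisson indXL mS).
by rewrite rateE.
Qed.

Lemma le_cluster_intensity (S S' : set (BE * Conf)) : measurable S -> measurable S' ->
  S `<=` S' -> (cluster_intensity S <= cluster_intensity S')%E.
Proof. by move=> mS mS' SS'; rewrite -!rateE //; apply: le_measure; rewrite ?inE. Qed.

Lemma cluster_intensity_ge0 (S : set (BE * Conf)) : measurable S ->
  (0 <= cluster_intensity S)%E.
Proof. by move=> mS; rewrite -rateE. Qed.

Lemma cluster_intensityU (S S' : set (BE * Conf)) : measurable S -> measurable S' ->
  S `&` S' = set0 ->
  cluster_intensity (S `|` S') = (cluster_intensity S + cluster_intensity S')%E.
Proof.
move=> mS mS' dS; rewrite -!rateE ?measureU //; exact: measurableU.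
Qed.

End poisson_clusters.

Section real_probability.
Context d (T : measurableType d) (R : realType) (P : probability T R).

Let fin A : measurable A -> P A \is a fin_num.
Proof. by move=> mA; exact: fin_num_measure. Qed.

Lemma fine_probability_le (A A' : set T) : measurable A -> measurable A' ->
  A `<=` A' -> fine (P A) <= fine (P A').
Proof.
by move=> mA mA' AA'; apply: fine_le; rewrite ?fin //; apply: le_measure; rewrite ?inE.
Qed.

Lemma fine_probability_setU_le (A A' : set T) : measurable A -> measurable A' ->
  fine (P (A `|` A')) <= fine (P A) + fine (P A').
Proof.
move=> mA mA'; rewrite -fineD ?fin //; apply: fine_le; rewrite ?fin //.
- exact: measurableU.
- by rewrite fin_numD !fin.
- exact: measureU2.
Qed.

Lemma fine_probability_setD (A A' : set T) : measurable A -> measurable A' ->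
  A' `<=` A -> fine (P (A `\` A')) = fine (P A) - fine (P A').
Proof.
move=> mA mA' AA'; have H : (P (A `\` A') + P A' = P A)%E.
  rewrite -measureU //; last 2 first.
  - exact: measurableD.
  - by rewrite setDE -setIA setICl setI0.
  by rewrite setDKU.
by rewrite -H fineD ?fin ?addrK //; exact: measurableD.
Qed.

End real_probability.

Lemma ler_small_error (R : realFieldType) (x y C : R) :
  (forall e, 0 < e -> e <= 1 -> x <= y + C * e) -> x <= y.
Proof.
move=> H; rewrite leNgt; apply/negP => yx.
have C1 : 0 < `|C| + 1 by rewrite ltr_wpDl.
have d0 : 0 < (x - y) / ((`|C| + 1) * 2) by rewrite divr_gt0 ?subr_gt0 ?mulr_gt0.
pose e := Num.min 1 ((x - y) / ((`|C| + 1) * 2)).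
have e0 : 0 < e by rewrite lt_min ltr01 d0.
have := H e e0; rewrite ge_min lexx => /(_ isT).
rewrite leNgt => /negP; apply; rewrite -ltrBrDl.
apply: (@le_lt_trans _ _ ((`|C| + 1) * ((x - y) / ((`|C| + 1) * 2)))).
  apply: (@le_trans _ _ ((`|C| + 1) * e)); last first.
    by rewrite ler_pM2l // ge_min lexx orbT.
  by rewrite ler_pM2r // (le_trans (ler_norm C)) // lerDl.
rewrite invfM mulrCA mulVKf ?gt_eqF //; lra.
Qed.

(** * Increments of the empty space function *)

Section empty_space.
Context {R : realType} {d : nat}.
Local Notation E := 'rV[R]_d.
Local Notation BE := (borelRd R d).
Local Notation Conf := (confRd R d).
Local Notation nu := (@lebesgueRd R d).
Variables (B : set E) (u0 : E).
Hypotheses (cB : compact B) (vB : convex_set B) (nB : nbhs (0 : E) B).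
Hypothesis d0 : (0 < d)%N.
Local Notation g := (gauge B).
Context dT (T : measurableType dT) (P : probability T R).
Context dT0 (T0 : measurableType dT0) (P0 : probability T0 R).
Variables (lam : R) (X : nat -> T -> E) (L0 : T0 -> set E) (L : nat -> T -> set E).
Hypotheses (lam0 : 0 < lam) (poissonX : stationary_poisson P lam X)
  (mL0 : measurable_fun setT (L0 : T0 -> Conf)) (iidL : iid_clusters P P0 X L0 L).
Hypotheses (fL0 : forall w, finite_set (L0 w)) (L0oo : (mean_card P0 L0 < +oo)%E).
Local Notation I := (cluster_intensity P0 lam L0).
Local Notation Z := (cluster_process X L).

Let mg : measurable_fun setT (g : BE -> R).
Proof. exact: measurable_gauge. Qed.

Let mX i : measurable_fun setT (X i : T -> BE).
Proof. by have [] := poissonX. Qed.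

Let mL i : measurable_fun setT (L i : T -> Conf).
Proof. by have [/(_ i)[]] := iidL. Qed.

Let fL i w : finite_set (L i w).
Proof. by have [/(_ i)[]] := iidL. Qed.

Lemma measurable_shell a b : measurable (shell B a b).
Proof. by apply: measurableD; exact: measurable_hits_ball. Qed.

Lemma measurable_target a b (C : set E) : borel C ->
  measurable (target B a b C : set BE).
Proof.
move=> mC; apply: measurableI; last first.
  apply: (@measurable_preimageT _ BE _ BE (fun z : BE => (g z)^-1 *: (0 - (z : E)))) => //.
  apply: measurable_funZ_rV.
    rewrite (_ : (fun _ => _) = (fun z : BE => g z `^ (-1))).
      exact: (measurableT_comp (@measurable_powR R (-1)) mg).
    by apply/funext => q; rewrite powR_inv1 // gauge_ge0.
  by apply: measurable_funB_rV; [exact: measurable_cst|exact: measurable_id].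
apply: (measurable_eq_set (A := [set z : BE | a < g z] `&` [set z : BE | g z <= b])).
  by apply: measurableI; [exact: measurable_ltr|exact: measurable_ler].
by apply/seteqP; split => z /=; [move=> [-> ->]|move=> /andP[]].
Qed.

Let mtarget a b C : borel C -> measurable (strict_min g (target B a b C)).
Proof. by move=> mC; apply: measurable_strict_min => //; exact: measurable_target. Qed.

Lemma strict_min_target_sub a b (C : set E) :
  strict_min g (target B a b C) `<=` shell B a b.
Proof.
move=> [x M] [/= fM [y My [[/andP[ay yb] _] ymin]]]; split.
  by split => //; exists y.
move=> [_ [y' /= My' y'a]]; have [e|/eqP yy'] := eqVneq y' y.
  by move: ay; rewrite ltNge -e y'a.
by have := lt_trans (le_lt_trans y'a ay) (ymin _ My' yy'); rewrite ltxx.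
Qed.

(** A Lipschitz constant, for radii up to M, of the intensity of clusters reaching a ball: the point
    intensity of the process times the Lipschitz constant of the volume. *)
Definition intensity_lip (M : R) : R :=
  lam * (fine (mean_card P0 L0) * shell_lip B M).

Lemma intensity_lip_ge0 M : 0 <= M -> 0 <= intensity_lip M.
Proof.
move=> M0; rewrite mulr_ge0 ?(ltW lam0) // mulr_ge0 ?shell_lip_ge0 // fine_ge0 //.
by apply: integral_ge0 => w _; rewrite countingE.
Qed.

Let intensity_le (S : set (BE * Conf)) (c : R) : measurable S -> 0 <= c ->
  (forall w, (nu [set x | S (x, L0 w)] <= counting (L0 w) * c%:E)%E) ->
  (I S <= (lam * (fine (mean_card P0 L0) * c))%:E)%E.
Proof.
move=> mS c0 Sc; rewrite /cluster_intensity EFinM lee_pmul2l ?lte_fin //.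
have N0 w : (0 <= counting (L0 w) :> \bar R)%E by rewrite countingE.
have mN := measurable_counting mL0 fL0.
rewrite EFinM fineK; last first.
  by rewrite ge0_fin_numE // integral_ge0.
rewrite /mean_card -ge0_integralZr ?lee_fin //.
apply: ge0_le_integral => //.
- exact: measurable_fun_section.
- by apply: emeasurable_funM => //; exact: measurable_cst.
Qed.

Lemma intensity_shell (M a b : R) : 0 <= a -> a <= b -> b <= M ->
  (I (shell B a b) <= (intensity_lip M * (b - a))%:E)%E.
Proof.
move=> a0 ab bM; rewrite /intensity_lip -(mulrA lam) -(mulrA (fine _)); apply: intensity_le.
- exact: measurable_shell.
- apply: mulr_ge0; last by rewrite subr_ge0.
  by apply: shell_lip_ge0; exact: le_trans (le_trans a0 ab) bM.
- by move=> w; apply: lebesgueRd_shell_le => //; exact: lebesgueRd_gauge_shell_le.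
Qed.

Lemma intensity_hits_ball_lty (t : R) : (I (hits_ball g t) < +oo)%E.
Proof.
have t0 : 0 <= Num.max t 0 by rewrite le_max lexx orbT.
have tt : nu [set z | g z <= Num.max t 0] \is a fin_num by rewrite lebesgueRd_gauge.
pose c := fine (nu [set z | g z <= Num.max t 0]).
apply: (@le_lt_trans _ _ (lam * (fine (mean_card P0 L0) * c))%:E); last exact: ltry.
apply: intensity_le; [exact: measurable_hits_ball|exact: fine_ge0|move=> w].
(* The gauge is nonnegative, so no cluster reaches radius -1, and the ball is a shell to which the
   union bound applies. *)
rewrite (_ : [set x | hits_ball g t (x, L0 w)] =
    [set x | hits_ball g t (x, L0 w) /\ ~ hits_ball g (-1) (x, L0 w)]).
  apply: lebesgueRd_shell_le => //; rewrite /c fineK //.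
  apply: le_measure; rewrite ?inE.
  - apply: (measurable_eq_set (A := [set z : BE | -1 < g z] `&` [set z : BE | g z <= t])).
      by apply: measurableI; [exact: measurable_ltr|exact: measurable_ler].
    by apply/seteqP; split => z /=; [move=> [-> ->]|move=> /andP[]].
  - exact: measurable_gauge_le.
  - by move=> z /= /andP[_ zt]; rewrite le_max zt.
apply/seteqP; split => x /=; last by case.
move=> h; split => // -[_ [y _ /=]]; rewrite leNgt => /negP; apply.
by apply: (lt_le_trans (ltrN10 R)); exact: gauge_ge0.
Qed.

Local Notation pr A := (fine (P A)).

Definition some_hit (S : set (BE * Conf)) : set T := [set w | exists i, S (X i w, L i w)].

Definition two_hits (S : set (BE * Conf)) : set T :=
  [set w | exists i j, [/\ i <> j, S (X i w, L i w) & S (X j w, L j w)]].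

Let mhit (S : set (BE * Conf)) i : measurable S -> measurable [set w | S (X i w, L i w)].
Proof.
move=> mS; apply: (measurable_preimageT (f := fun w => (X i w : BE, L i w : Conf))) mS.
by apply: measurable_fun_pair; [exact: mX|exact: mL].
Qed.

Lemma measurable_some_hit (S : set (BE * Conf)) : measurable S -> measurable (some_hit S).
Proof.
move=> mS; apply: (measurable_eq_set (A := \bigcup_i [set w | S (X i w, L i w)])).
  by apply: bigcupT_measurable => i; exact: mhit.
by apply/seteqP; split => w /=; [move=> [i _ ?]|move=> [i ?]]; exists i.
Qed.

Lemma measurable_two_hits (S : set (BE * Conf)) : measurable S -> measurable (two_hits S).
Proof.
move=> mS; apply: (measurable_eq_set (A := \bigcup_i \bigcup_j ([set _ | i <> j] `&`
    ([set w | S (X i w, L i w)] `&` [set w | S (X j w, L j w)])))).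
  apply: bigcupT_measurable => i; apply: bigcupT_measurable => j.
  apply: measurableI; first exact: measurable_setU_Prop.
  by apply: measurableI; exact: mhit.
apply/seteqP; split => w /=; first by move=> [i _ [j _ [ij [Si Sj]]]]; exists i, j.
by move=> [i [j [ij Si Sj]]]; exists i => //; exists j.
Qed.

Lemma pr_some_hit (S : set (BE * Conf)) : measurable S -> (I S < +oo)%E ->
  pr (some_hit S) = 1 - expR (- fine (I S)).
Proof.
move=> mS Soo; have := cluster_void lam0 poissonX mL0 iidL mS Soo.
rewrite (_ : [set w | _] = ~` some_hit S); last first.
  by apply/seteqP; split => w /=; [move=> h [i] /h|move=> h i Si; apply: h; exists i].
rewrite probability_setC; last exact: measurable_some_hit.
have fS : P (some_hit S) \is a fin_num.
  by rewrite fin_num_measure //; exact: measurable_some_hit.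
rewrite -(fineK fS) => -[<-] /=; by rewrite opprB addrC subrK.
Qed.

(** This is 1 - exp(-x) <= x. *)
Lemma pr_some_hit_le (S : set (BE * Conf)) (c : R) : measurable S -> (I S <= c%:E)%E -> pr (some_hit S) <= c.
Proof.
move=> mS Sc; have Soo := le_lt_trans Sc (ltry c).
rewrite pr_some_hit // lerBlDr addrC -lerBlDr.
apply: le_trans (expR_ge1Dx _); rewrite lerD2l lerN2 -lee_fin fineK //.
by rewrite ge0_fin_numE // (cluster_intensity_ge0 P0 lam0 mL0).
Qed.

Lemma pr_two_hits_le (S : set (BE * Conf)) (c : R) : measurable S -> (I S <= c%:E)%E -> pr (two_hits S) <= c ^+ 2.
Proof.
move=> mS Sc; have Soo := le_lt_trans Sc (ltry c).
have I0 := cluster_intensity_ge0 P0 lam0 mL0 mS.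
have fI : I S \is a fin_num by rewrite ge0_fin_numE.
have := cluster_two_points lam0 poissonX mL0 iidL mS Soo.
rewrite -lee_fin fineK; last first.
  by rewrite fin_num_measure //; exact: measurable_two_hits.
move=> /le_trans; apply; rewrite lee_fin lerXn2r // ?nnegrE ?fine_ge0 //.
  by rewrite -lee_fin; exact: le_trans Sc.
by rewrite -lee_fin fineK.
Qed.

Definition contact_in (a b : R) (C : set E) : set T := [set w |
  [/\ (a%:E < dB B 0%R (Z w))%E, (dB B 0%R (Z w) <= b%:E)%E & C (uB B u0 (Z w) 0)]].

Let mevent t C : borel C ->
  measurable [set w | (dB B 0%R (Z w) <= t%:E)%E /\ C (uB B u0 (Z w) 0)].
Proof. exact: measurable_contact_event. Qed.

Let contact_inE a b C : contact_in a b C =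
  [set w | (dB B 0%R (Z w) <= b%:E)%E /\ C (uB B u0 (Z w) 0)] `\`
  [set w | (dB B 0%R (Z w) <= a%:E)%E /\ C (uB B u0 (Z w) 0)].
Proof.
apply/seteqP; split => w /=.
  by move=> [ad db Cu]; split => // -[]; rewrite leNgt ad.
by move=> [[db Cu] h]; split => //; rewrite ltNge; apply/negP => da; exact: h.
Qed.

Lemma measurable_contact_in a b C : borel C -> measurable (contact_in a b C).
Proof. by move=> mC; rewrite contact_inE; apply: measurableD; exact: mevent. Qed.

Lemma FB_sub a b C : borel C -> a <= b ->
  FB P B u0 Z b C - FB P B u0 Z a C = pr (contact_in a b C).
Proof.
move=> mC ab; rewrite contact_inE fine_probability_setD //; try exact: mevent.
by move=> w /= [da Cu]; split => //; apply: le_trans da _; rewrite lee_fin.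
Qed.

Let near_some_hit w z b : Z w z -> g z <= b -> exists i, hits_ball g b (X i w, L i w).
Proof.
move=> /cluster_processP[i [y Ly ->]] zb; exists i; split; first exact: fL.
by exists y.
Qed.

Let some_hit_near w i a : hits_ball g a (X i w, L i w) -> (dB B 0%R (Z w) <= a%:E)%E.
Proof.
move=> [_ [y Ly ya]]; apply: (@le_trans _ _ (g (X i w + y))%:E); last by rewrite lee_fin.
by apply: dB_le => //; apply/cluster_processP; exists i, y.
Qed.

Let lip_shell M a b : 0 <= a -> a <= b -> b <= M ->
  pr (some_hit (shell B a b)) <= intensity_lip M * (b - a).
Proof.
by move=> a0 ab bM; apply: pr_some_hit_le; [exact: measurable_shell|exact: intensity_shell].
Qed.

(** A distance at most a need not come from a point within radius a, as the infimum may not be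
    attained. But then some cluster reaches the shell ]a, a + e] for every e > 0, an event of
    probability of order e. *)
Lemma survivalE (a : R) : 0 <= a ->
  1 - FB P B u0 Z a setT = expR (- fine (I (hits_ball g a))).
Proof.
move=> a0.
suff -> : FB P B u0 Z a setT = pr (some_hit (hits_ball g a)).
  rewrite pr_some_hit ?intensity_hits_ball_lty //; last exact: measurable_hits_ball.
  by rewrite opprB addrC subrK.
have mH t : measurable (some_hit (hits_ball g t)).
  by apply: measurable_some_hit; exact: measurable_hits_ball.
apply/eqP; rewrite eq_le; apply/andP; split; last first.
  apply: fine_probability_le => //; first exact: (mevent a (@measurableT _ BE)).
  by move=> w [i /some_hit_near da]; split.
apply: (@ler_small_error _ _ _ (intensity_lip (a + 1))) => e e0 e1.
have mS : measurable (some_hit (shell B a (a + e))).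
  by apply: measurable_some_hit; exact: measurable_shell.
apply: (@le_trans _ _ (pr (some_hit (hits_ball g a) `|` some_hit (shell B a (a + e))))).
  apply: fine_probability_le; [exact: (mevent a (@measurableT _ BE))|exact: measurableU|].
  move=> w /= [da _].
  have [z Zz] : exists2 z, Z w z & ((g z)%:E < (a + e)%:E)%E.
    by apply: dB_lt => //; apply: le_lt_trans da _; rewrite lte_fin ltrDl.
  rewrite lte_fin => /ltW/(near_some_hit Zz)[i hi].
  have [ha|ha] := pselect (hits_ball g a (X i w, L i w)); first by left; exists i.
  by right; exists i; split.
apply: le_trans (fine_probability_setU_le _ _ _) _ => //.
rewrite lerD2l; apply: le_trans (lip_shell (M := a + 1) a0 _ _) _.
- by rewrite lerDl ltW.
- by rewrite lerD2l.
- by rewrite [a + e]addrC addrK.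
Qed.

Let contact_in_shell a b b' C w : b < b' -> contact_in a b C w ->
  some_hit (shell B a b') w /\ ~ some_hit (hits_ball g a) w.
Proof.
move=> bb' [ad db _]; have na i : ~ hits_ball g a (X i w, L i w).
  by move=> /some_hit_near /(lt_le_trans ad); rewrite ltxx.
split; last by move=> [i /na].
have [z Zz] : exists2 z, Z w z & ((g z)%:E < b'%:E)%E.
  by apply: dB_lt => //; apply: le_lt_trans db _; rewrite lte_fin.
by rewrite lte_fin => /ltW/(near_some_hit Zz)[i hi]; exists i.
Qed.

(** The source of absolute continuity, and thus of the densities. Near minimisers are sought up to
    radius b + e with e <= 1, which explains the constant at M + 1. *)
Lemma FB_increment_lip (M a b : R) C : borel C -> 0 <= a -> a <= b -> b <= M ->
  FB P B u0 Z b C - FB P B u0 Z a C <= intensity_lip (M + 1) * (b - a).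
Proof.
move=> mC a0 ab bM; rewrite FB_sub //.
apply: (@ler_small_error _ _ _ (intensity_lip (M + 1))) => e e0 e1.
apply: (@le_trans _ _ (pr (some_hit (shell B a (b + e))))).
  apply: fine_probability_le; first exact: measurable_contact_in.
    by apply: measurable_some_hit; exact: measurable_shell.
  have be : b < b + e by rewrite ltrDl.
  by move=> w cw; have [] := contact_in_shell be cw.
apply: le_trans (lip_shell (M := M + 1) a0 _ _) _.
- by rewrite (le_trans ab) // lerDl ltW.
- exact: lerD.
- by rewrite -mulrDr addrAC.
Qed.

Definition contact_intensity (a b : R) (C : set E) : R :=
  fine (I (strict_min g (target B a b C))).

(** The two sets of pairs are disjoint, so their intensities add. The probability is the difference
    of the two void probabilities exp(-I(H)) and exp(-I(S) - I(H)), where H is the set of pairs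
    hitting the ball; it factors as claimed. *)
Let pr_first_contact (a b M : R) C : borel C -> 0 <= a -> a <= b -> b <= M ->
  pr (some_hit (strict_min g (target B a b C)) `\` some_hit (hits_ball g a)) =
  (1 - FB P B u0 Z a setT) * (1 - expR (- contact_intensity a b C)).
Proof.
move=> mC a0 ab bM; rewrite survivalE //.
set S := strict_min g _; have mS : measurable S by exact: mtarget.
have mH : measurable (hits_ball g a) by exact: measurable_hits_ball.
have Soo : (I S < +oo)%E.
  apply: (@le_lt_trans _ _ (I (shell B a b))).
    apply: (le_cluster_intensity P0 lam0 mL0) => //; first exact: measurable_shell.
    exact: strict_min_target_sub.
  by apply: le_lt_trans (intensity_shell a0 ab bM) _; exact: ltry.
have Hoo := intensity_hits_ball_lty a.
have UE : some_hit S `\` some_hit (hits_ball g a) =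
    some_hit (S `|` hits_ball g a) `\` some_hit (hits_ball g a).
  apply/seteqP; split => w /= [[i Si] nH]; split => //.
    by exists i; left.
  by case: Si => [Si|Hi]; [exists i|exfalso; apply: nH; exists i].
have IU : I (S `|` hits_ball g a) = (I S + I (hits_ball g a))%E.
  apply: (cluster_intensityU P0 lam0 mL0) => //.
  by apply/seteqP; split => // x [/strict_min_target_sub[_ nH] /nH].
rewrite UE fine_probability_setD.
- rewrite !pr_some_hit //; last 2 first.
  + exact: measurableU.
  + by rewrite IU lte_add_pinfty.
  rewrite IU fineD; last 2 first.
  + by rewrite ge0_fin_numE // (cluster_intensity_ge0 P0 lam0 mL0).
  + by rewrite ge0_fin_numE // (cluster_intensity_ge0 P0 lam0 mL0).
  rewrite opprD expRD /contact_intensity -/S; ring.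
- by apply: measurable_some_hit; exact: measurableU.
- exact: measurable_some_hit.
- by move=> w [i Hi]; exists i; right.
Qed.

Lemma FB_increment_ge (M a b : R) C : borel C -> 0 <= a -> a <= b -> b <= M ->
  (1 - FB P B u0 Z a setT) * (1 - expR (- contact_intensity a b C)) <=
  FB P B u0 Z b C - FB P B u0 Z a C + (intensity_lip M * (b - a)) ^+ 2.
Proof.
move=> mC a0 ab bM; rewrite -(pr_first_contact mC a0 ab bM) FB_sub //.
have mS := measurable_shell a b.
have m2 := measurable_two_hits mS.
have mc := measurable_contact_in a b mC.
apply: (@le_trans _ _ (pr (contact_in a b C `|` two_hits (shell B a b)))).
  apply: fine_probability_le; last 1 first.
  - move=> w [[i Si] nH].
    have [t2|t2] := pselect (two_hits (shell B a b) w); first by right.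
    left; apply: (sandwich_lower (X := X) (L := L) u0 cB vB nB fL a0 _ Si t2).
    by move=> j Hj; apply: nH; exists j.
  - apply: measurableD; apply: measurable_some_hit; first exact: mtarget.
    exact: measurable_hits_ball.
  - exact: measurableU.
apply: le_trans (fine_probability_setU_le _ _ _) _ => //.
by rewrite lerD2l; apply: pr_two_hits_le => //; exact: intensity_shell.
Qed.

Hypothesis tie0 : difference_measure P0 L0 (tie_shifts g) = 0%E.

Let pr_tied : pr (some_hit (tied g)) = 0.
Proof.
apply/eqP; rewrite eq_le fine_ge0 // andbT; apply: pr_some_hit_le.
  exact: measurable_tied.
by rewrite /cluster_intensity -(cluster_intensityE P0 mL0) ?cluster_intensity_tied ?mule0 //;
  exact: measurable_tied.
Qed.

(** Only the two-cluster error carries the enlarged radius b'; the main term keeps the target at b,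
    so it matches the one of the lower bound. *)
Lemma FB_increment_le (M a b b' : R) C : borel C -> 0 <= a -> a <= b -> b < b' -> b' <= M ->
  FB P B u0 Z b C - FB P B u0 Z a C <=
  (1 - FB P B u0 Z a setT) * (1 - expR (- contact_intensity a b C)) +
  (intensity_lip M * (b' - a)) ^+ 2.
Proof.
move=> mC a0 ab bb' bM; have bM' := le_trans (ltW bb') bM.
rewrite -(pr_first_contact mC a0 ab bM') FB_sub //.
have mS := measurable_shell a b'.
have m2 := measurable_two_hits mS.
have mD : measurable (some_hit (strict_min g (target B a b C)) `\` some_hit (hits_ball g a)).
  by apply: measurableD; apply: measurable_some_hit; [exact: mtarget|exact: measurable_hits_ball].
have mT : measurable (some_hit (tied g)).
  by apply: measurable_some_hit; exact: measurable_tied.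
apply: (@le_trans _ _ (pr (((some_hit (strict_min g (target B a b C)) `\` some_hit (hits_ball g a))
    `|` two_hits (shell B a b')) `|` some_hit (tied g)))).
  apply: fine_probability_le; first exact: measurable_contact_in.
    by apply: measurableU => //; exact: measurableU.
  move=> w [ad db Cu].
  have [tw|tw] := pselect (some_hit (tied g) w); first by right.
  have [t2|t2] := pselect (two_hits (shell B a b') w); first by left; right.
  left; left.
  have nt i : ~ tied g (X i w, L i w) by move=> ti; apply: tw; exists i.
  have [nH [i Si]] := sandwich_upper (X := X) (L := L) cB vB nB fL a0 bb' ad db Cu nt t2.
  by split; [exists i|move=> [j /nH]].
apply: le_trans (fine_probability_setU_le _ _ _) _ => //; first exact: measurableU.
rewrite pr_tied addr0; apply: le_trans (fine_probability_setU_le _ _ _) _ => //.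
rewrite lerD2l; apply: pr_two_hits_le => //.
by apply: intensity_shell => //; exact: le_trans ab (ltW bb').
Qed.

End empty_space.

(** * Transfer between laws and comparison of the intensities *)

Section same_law.
Context {R : realType} {d : nat}.
Local Notation E := 'rV[R]_d.
Local Notation BE := (borelRd R d).
Local Notation Conf := (confRd R d).
Local Notation nu := (@lebesgueRd R d).
Context dT0 (T0 : measurableType dT0) (P0 : probability T0 R).
Context dT1 (T1 : measurableType dT1) (P1 : probability T1 R).
Variables (L0 : T0 -> set E) (L1 : T1 -> set E).
Hypotheses (mL0 : measurable_fun setT (L0 : T0 -> Conf))
  (mL1 : measurable_fun setT (L1 : T1 -> Conf)) (lawL : same_law P1 P0 L1 L0).

Lemma same_law_integral (h : Conf -> \bar R) : measurable_fun setT h ->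
  (forall M, 0 <= h M)%E -> (\int[P1]_w h (L1 w) = \int[P0]_w h (L0 w))%E.
Proof.
move=> mh h0; rewrite -(ge0_integral_image_measure P1 mL1) //.
rewrite -(ge0_integral_image_measure P0 mL0) //.
by apply: eq_measure_integral => A mA _; exact: lawL.
Qed.

Lemma same_law_cluster_intensity (lam : R) (S : set (BE * Conf)) : measurable S ->
  cluster_intensity P1 lam L1 S = cluster_intensity P0 lam L0 S.
Proof.
move=> mS; rewrite /cluster_intensity; congr (_ * _)%E.
apply: (same_law_integral (h := fun M => nu [set x | S (x, M)])) => //.
exact: (measurable_fun_section (@measurable_id _ Conf setT) mS).
Qed.

Lemma same_law_mean_card : (forall w, finite_set (L0 w)) -> (forall w, finite_set (L1 w)) ->
  mean_card P1 L1 = mean_card P0 L0.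
Proof.
move=> fL0 fL1; rewrite /mean_card.
under eq_integral do rewrite countingE //.
under [in RHS]eq_integral do rewrite countingE //.
apply: (same_law_integral (h := fun M => fin_counting M setT)) => //.
exact: (measurable_fin_counting (@measurableT _ BE)).
Qed.

End same_law.

Section contracted_clusters.
Context {R : realType} {d : nat}.
Local Notation E := 'rV[R]_d.
Local Notation BE := (borelRd R d).
Local Notation Conf := (confRd R d).
Variable B : set E.
Hypotheses (cB : compact B) (vB : convex_set B) (nB : nbhs (0 : E) B).
Hypothesis d0 : (0 < d)%N.
Context dT0 (T0 : measurableType dT0) (P0 : probability T0 R).
Context dT1 (T1 : measurableType dT1) (P1 : probability T1 R).
Variables (lam : R) (L0 : T0 -> set E) (L1 : T1 -> set E) (W : T0 -> R).
Hypotheses (lam0 : 0 < lam) (mL0 : measurable_fun setT (L0 : T0 -> Conf))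
  (fL0 : forall w, finite_set (L0 w)) (fL1 : forall w, finite_set (L1 w))
  (L0oo : (mean_card P0 L0 < +oo)%E).
Hypotheses (mW : measurable_fun setT W) (W01 : {ae P0, forall w, 0 <= W w <= 1}).
Hypotheses (mL1 : measurable_fun setT (L1 : T1 -> Conf))
  (lawL : same_law P1 P0 L1 (fun w => [set W w *: x | x in L0 w])).
Hypothesis same_intensity :
  (lam%:E * mean_card P0 L0 = lam%:E * mean_card P1 L1)%E.

Lemma contact_intensity_contract (a b : R) (C : set E) : borel C -> 0 <= a -> a <= b ->
  contact_intensity B P1 lam L1 a b C <= contact_intensity B P0 lam L0 a b C.
Proof.
move=> mC a0 ab.
have mG := measurable_target cB vB nB a b mC.
have mg := measurable_gauge cB vB nB.
have mS : measurable (strict_min (gauge B) (target B a b C)) by exact: measurable_strict_min.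
have mSL := measurable_scaled_cluster mL0 fL0 mW.
have fSL w : finite_set (scaled_cluster L0 W w) by exact: finite_scaled_cluster.
have injW : {ae P0, forall w, set_inj (L0 w) (fun y => W w *: y)}.
  apply: (ae_scaled_cluster_inj mL0 fL0 mW) => //.
  (* The mean size of the scaled cluster is that of [L1] by equality of laws, and lam > 0 cancels in
     the equality of intensities. *)
  rewrite -[LHS]/(mean_card P0 (scaled_cluster L0 W)) -(same_law_mean_card mSL mL1 lawL) //.
  by apply/eqP; rewrite eq_le; apply/andP; split;
    rewrite -(@lee_pmul2l _ lam%:E) ?lte_fin // same_intensity.
rewrite /contact_intensity (same_law_cluster_intensity mSL mL1 lawL) //.
have le : (cluster_intensity P0 lam (scaled_cluster L0 W) (strict_min (gauge B) (target B a b C))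
   <= cluster_intensity P0 lam L0 (strict_min (gauge B) (target B a b C)))%E.
  rewrite /cluster_intensity lee_pmul2l ?lte_fin //.
  rewrite -(cluster_intensityE P0 mSL) // -(cluster_intensityE P0 mL0) //.
  by apply: cluster_intensity_contract => //; exact: gauge_segment.
have oo : (cluster_intensity P0 lam L0 (strict_min (gauge B) (target B a b C)) < +oo)%E.
  apply: (@le_lt_trans _ _ (cluster_intensity P0 lam L0 (shell B a b))).
    apply: (le_cluster_intensity P0 lam0 mL0) => //; first exact: measurable_shell.
    exact: strict_min_target_sub.
  by apply: le_lt_trans (intensity_shell cB vB nB d0 lam0 mL0 fL0 L0oo a0 ab (lexx b)) _; exact: ltry.
apply: fine_le => //; rewrite ge0_fin_numE.
- exact: le_lt_trans le oo.
- exact: (cluster_intensity_ge0 P0 lam0 mSL).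
- exact: oo.
- exact: (cluster_intensity_ge0 P0 lam0 mL0).
Qed.

End contracted_clusters.

(** * Densities and Lebesgue differentiation *)

Section lipschitz_measure.
Context {R : realType}.
Local Notation leb := (@lebesgue_measure R).
Implicit Type m : {measure set (measurableTypeR R) -> \bar R}.

(** A Lebesgue null set has covers by half-open intervals of total length below any e. Clipped to
    ]a, b], these have total m-measure at most K e. *)
Lemma lipschitz_measure_null m (K a b : R) (N : set (measurableTypeR R)) :
  0 <= K ->
  (forall s t, a <= s -> s <= t -> t <= b -> (m `]s, t]%classic <= (K * (t - s))%:E)%E) ->
  measurable N -> leb N = 0%E -> m (N `&` `]a, b]%classic) = 0%E.
Proof.
move=> K0 mK mN N0; apply: (@ge0_small_eq0 _ _ K 1) => // e e0 _.
have : (leb N < e%:E)%E by rewrite N0 lte_fin.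
rewrite [X in (X < _)%E](_ : _ = ereal_inf [set (\sum_(k <oo) wlength idfun (F k))%E |
  F in measurable_cover (N : set (ocitv_type R))]) //.
move=> /ereal_inf_lt[_ [F [mF NF] <-]] Fe.
have mFI k : measurable (F k `&` `]a, b]%classic : set (measurableTypeR R)).
  by apply: measurableI => //; apply: sub_sigma_algebra; exact: mF.
have wF0 k : (0 <= wlength idfun (F k))%E by apply: wlength_ge0.
apply: (@le_trans _ _ (\sum_(k <oo) m (F k `&` `]a, b]%classic))%E).
  apply: measure_sigma_subadditive => //; first exact: measurableI.
  by move=> x [/NF[k _ Fx] xI]; exists k.
apply: (@le_trans _ _ (\sum_(k <oo) K%:E * wlength idfun (F k)))%E.
  apply: lee_nneseries => // k _.
  have [[s t] _ <-] := mF k; rewrite /= wlength_itv /= lte_fin.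
  have [st|ts] := ltP s t; last first.
    by rewrite set_itv_ge ?set0I ?measure0 ?mule0 // -leNgt.
  pose s' := Num.max a s; pose t' := Num.min b t.
  rewrite (_ : _ `&` _ = `]s', t']%classic); last first.
    apply/seteqP; split => x /=; rewrite !in_itv /= gt_max le_min.
      by move=> [/andP[-> ->] /andP[-> ->]].
    by move=> /andP[/andP[-> ->] /andP[-> ->]].
  have [st'|ts'] := leP s' t'; last first.
    rewrite set_itv_ge ?measure0 -?leNgt ?bnd_simp ?(ltW ts') //.
    by rewrite mule_ge0 ?lee_fin ?subr_ge0 // ltW.
  apply: le_trans (mK s' t' _ st' _) _; rewrite ?le_max ?ge_min ?lexx //.
  by rewrite -EFinB -EFinM lee_fin ler_wpM2l // lerB // ?ge_min ?le_max ?lexx ?orbT.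
by rewrite nneseriesZl // EFinM; apply: lee_wpmul2l; rewrite ?lee_fin // ltW.
Qed.

(** The Lipschitz bound gives absolute continuity, and Radon-Nikodym the density. *)
Lemma lipschitz_measure_density (m : {finite_measure set (measurableTypeR R) -> \bar R})
    (K : R -> R) :
  (forall M, 0 <= M -> 0 <= K M) ->
  (forall M s t, 0 <= s -> s <= t -> t <= M ->
    (m `]s, t]%classic <= (K M * (t - s))%:E)%E) ->
  m `]-oo, 0]%classic = 0%E ->
  exists f : R -> R, [/\ measurable_fun setT f, forall t, 0 <= f t &
    forall a b, m `]a, b]%classic = (\int[leb]_(t in `]a, b]) (f t)%:E)%E].
Proof.
move=> K0 mK m0.
have mleb : m `<< leb.
  apply/null_content_dominatesP => N mN N0; apply/eqP; rewrite eq_le measure_ge0 andbT.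
  (* The Lipschitz constant depends on the range, so the null set is cut into bounded pieces; piece
     0 absorbs the half-line that [m] does not charge. *)
  pose F k : set (measurableTypeR R) :=
    if k is k'.+1 then N `&` `]0, k'.+1%:R]%classic else `]-oo, 0]%classic.
  have mF k : measurable (F k) by case: k => [|k] //=; exact: measurableI.
  apply: (@le_trans _ _ (\sum_(k <oo) m (F k))%E).
    apply: measure_sigma_subadditive => // x Nx.
    have [x0|x0] := leP x 0; first by exists 0%N => //=; rewrite in_itv.
    exists (Num.truncn x).+1 => //; split => //=.
    by rewrite in_itv /= x0 ltW // truncnS_gt.
  rewrite eseries0 // => -[|k] _ _ //=.
  by apply: (lipschitz_measure_null (K := K k.+1%:R)) => //;
    [exact: K0|move=> s t s0 st tk; exact: mK].
have [f [f0 ff /integrableP[mf _] fm]] := radon_nikodym_sigma_finite mleb.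
exists (fine \o f); split.
- exact: measurableT_comp.
- by move=> t; apply: fine_ge0.
- move=> a b; rewrite fm //; apply: eq_integral => x _ /=; by rewrite fineK.
Qed.

End lipschitz_measure.

(** * Recovering densities from increments *)

Section density_derivative.
Context {R : realType}.
Local Notation leb := (@lebesgue_measure R).

Definition forward_quotient (F : R -> R) (t : R) (n : nat) : R :=
  (F (t + n.+1%:R^-1) - F t) * n.+1%:R.

(** Lebesgue differentiation. Integrability of f is known only on bounded intervals away from 0, so
    f is truncated to countably many such intervals, and almost every t is a Lebesgue point of all
    truncations at once. *)
Lemma density_quotient_cvg (F f : R -> R) : is_density F f ->
  {ae leb, forall t, 0 < t -> forward_quotient F t n @[n --> \oo] --> f t}.
Proof.
move=> [mf f0 fF].
(* The intervals ]1/(k+1), k+2[ exhaust the positive half-line; k + 2 rather than k + 1 keeps them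
   nonempty at k = 0. *)
pose c k : R := k.+1%:R^-1; pose u k : R := k.+2%:R.
have cu k : c k < u k.
  by apply: (@le_lt_trans _ _ 1); rewrite ?invf_le1 ?ler1n // ltr1n.
have c0 k : 0 < c k by rewrite invr_gt0.
pose fk k := f \_ `]c k, u k]%classic.
have sub k : `]c k, u k]%classic `<=` `]0, +oo[%classic.
  by move=> t /=; rewrite !in_itv /= andbT => /andP[+ _]; exact: lt_trans.
have ik k : leb.-integrable setT (EFin \o fk k).
  rewrite (_ : EFin \o fk k = (EFin \o f) \_ `]c k, u k]%classic); last first.
    by apply/funext => t; rewrite /fk /= restrict_EFin.
  apply/integrable_restrict => //; rewrite setTI; apply/integrableP; split.
    by apply/measurable_EFinP; apply: measurable_funS mf.
  rewrite [X in (X < _)%E](_ : _ = \int[leb]_(t in `]c k, u k]) (f t)%:E)%E; last first.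
    by apply: eq_integral => t _ /=; rewrite ger0_norm.
  by rewrite -fF ?ltry // ltW.
have : forall k, {ae leb, forall t, lebesgue_pt (fk k) t}.
  by move=> k; apply: lebesgue_differentiation; exact: open_integrable_locally openT (ik k).
move=> /ae_foralln; apply: filterS => t Ht t0.
have [k [ckt tuk]] : exists k, c k < t /\ t < u k.
  exists (maxn (Num.truncn t) (Num.truncn t^-1)); split.
    rewrite invf_plt ?posrE //; apply: lt_le_trans (truncnS_gt _) _.
    by rewrite ler_nat ltnS leq_maxr.
  apply: lt_le_trans (truncnS_gt _) _.
  by rewrite ler_nat ltnS (leq_trans (leq_maxl _ _) (leqnSn _)).
have iku : leb.-integrable [set` Interval (BRight (c k)) (BRight (u k))] (EFin \o fk k).
  exact: integrableS (ik k).
(* The fundamental theorem applies to the primitive G of the truncation, which equals F up to a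
   constant on the interval around t. *)
have [G [dG GE GF]] : exists G : R -> R, [/\ derivable G t 1, derive1 G t = fk k t &
    forall y, c k <= y -> y <= u k -> G y = F y - F (c k)].
  have [dG GE] := FTC1_lebesgue_pt tuk iku ckt (Ht k).
  exists (fun y => \int[leb]_(t in [set` Interval (BRight (c k)) (BRight y)]) (fk k t))%R.
  split => // y cy yu; rewrite /Rintegral.
  transitivity (fine (\int[leb]_(s in `]c k, y]) (f s)%:E)%E); last by rewrite -fF.
  congr fine; apply: eq_integral => s; rewrite inE /= in_itv /= => /andP[cs sy].
  by rewrite /fk patchE mem_set //= in_itv /= cs (le_trans sy).
have ftE : fk k t = f t by rewrite /fk patchE mem_set //= in_itv /= ckt ltW.
have dG' : h^-1 *: (G (h + t) - G t) @[h --> 0^'] --> f t.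
  have qE : (fun h => h^-1 *: ((G \o shift t) (h *: (1 : R)) - G t)) =
      (fun h => h^-1 *: (G (h + t) - G t)).
    by apply/funext => h; rewrite /= (_ : h *: (1 : R) = h) //; exact: mulr1.
  by move: dG; rewrite /derivable qE -ftE -GE.
have dq : forward_quotient G t n @[n --> \oo] --> f t.
  rewrite (_ : forward_quotient G t =
      fun n => (n.+1%:R^-1)^-1 *: (G (n.+1%:R^-1 + t) - G t)); last first.
    by apply/funext => n; rewrite /forward_quotient invrK mulrC [t + _]addrC.
  apply: (cvgr_dnbhsP _ _ _).1 dG' _ _.
  by split; [move=> n; rewrite invr_eq0 pnatr_eq0|exact: cvg_harmonic].
have [n0 n0P] : exists n0 : nat, n0.+1%:R^-1 <= u k - t.
  exists (Num.truncn (u k - t)^-1); rewrite invf_ple ?posrE ?subr_gt0 //.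
  exact/ltW/truncnS_gt.
apply: cvg_trans dq; apply: near_eq_cvg; exists n0 => // n /= n0n.
have n1 : 0 < n.+1%:R^-1 :> R by rewrite invr_gt0.
rewrite /forward_quotient !GF ?(ltW ckt) ?(ltW tuk) //.
- congr (_ * _); ring.
- by rewrite (le_trans (ltW ckt)) // lerDl ltW.
- rewrite -lerBrDl (le_trans _ n0P) // lef_pV2 ?posrE // ler_nat //.
Qed.

(** Dividing by h = 1/(n+1) leaves an error K/(n+1), which vanishes in the limit; K may therefore
    depend on t. *)
Lemma density_ratio_le (F F' f f' S S' : R -> R) :
  is_density F f -> is_density F' f' ->
  (forall t, 0 < t -> exists K : R, forall h, 0 < h -> h <= 1 ->
    (F' (t + h) - F' t) / S' t <= (F (t + h) - F t) / S t + K * h ^+ 2) ->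
  {ae leb, forall t, 0 < t -> f' t / S' t <= f t / S t}.
Proof.
move=> df df' H.
have aeF : Filter (nbhs (almost_everywhere leb)) := ae_filter_ringOfSetsType leb.
have := density_quotient_cvg df'; have := density_quotient_cvg df.
apply: filterS2 => t cq cq' t0.
have [K HK] := H t t0.
have c1 : forward_quotient F' t n / S' t @[n --> \oo] --> f' t / S' t.
  by apply: cvgMr_tmp; exact: cq'.
have c2 : (forward_quotient F t n / S t + K * n.+1%:R^-1) @[n --> \oo] --> f t / S t.
  rewrite -[f t / S t]addr0 -[X in _ + X](mulr0 K); apply: cvgD.
    by apply: cvgMr_tmp; exact: cq.
  by apply: cvgMl_tmp; exact: cvg_harmonic.
apply: (ler_cvg_to c1 c2); apply: nearW => n.
have n0 : 0 < n.+1%:R :> R by [].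
have n1 : n.+1%:R^-1 <= 1 :> R by rewrite invf_le1 ?ler1n.
have := HK n.+1%:R^-1; rewrite invr_gt0 => /(_ n0 n1).
rewrite -(ler_pM2r n0) [X in (_ <= X) -> _]mulrDl /forward_quotient
  (mulrAC (F' _ - _)) (mulrAC (F _ - _)).
move=> /le_trans; apply.
by rewrite lerD2l -mulrA expr2 -mulrA mulVf ?mulr1 // gt_eqF.
Qed.

(** Setting a density to 0 on a null set and off the positive half-line keeps it a density. This
    upgrades an almost sure inequality to one that holds everywhere. *)
Lemma is_density_restrict (F f : R -> R) (N : set R) : measurable N -> leb N = 0%E ->
  is_density F f -> is_density F (fun t => f t * \1_(~` N `&` `]0, +oo[%classic) t).
Proof.
move=> mN N0 [mf f0 fF]; have mD : measurable (~` N `&` `]0, +oo[%classic).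
  by apply: measurableI => //; exact: measurableC.
split.
- by apply: measurable_funM => //; exact: measurable_indic.
- by move=> t; rewrite mulr_ge0.
- move=> a b a0 ab; rewrite fF //.
  have sub : `]a, b]%classic `<=` `]0, +oo[%classic.
    by move=> t /=; rewrite !in_itv /= andbT => /andP[+ _]; exact: lt_trans.
  have mfab : measurable_fun `]a, b]%classic f by exact: measurable_funS mf.
  apply: ae_eq_integral => //.
  + exact/measurable_EFinP.
  + apply/measurable_EFinP; apply: measurable_funM => //; exact: measurable_indic.
  + exists N; split => // t /=; apply: contra_notP => nN tab.
    by rewrite indicE mem_set ?mulr1 //; split => //; exact: sub.
Qed.

End density_derivative.

(** * The hazard order *)

Section contact_density.
Context {R : realType} {d : nat}.
Local Notation E := 'rV[R]_d.
Local Notation BE := (borelRd R d).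
Local Notation Conf := (confRd R d).
Variables (B : set E) (u0 : E).
Hypotheses (cB : compact B) (vB : convex_set B) (nB : nbhs (0 : E) B).
Hypothesis d0 : (0 < d)%N.
Context dT (T : measurableType dT) (P : probability T R).
Context dT0 (T0 : measurableType dT0) (P0 : probability T0 R).
Variables (lam : R) (X : nat -> T -> E) (L0 : T0 -> set E) (L : nat -> T -> set E).
Hypotheses (lam0 : 0 < lam) (poissonX : stationary_poisson P lam X)
  (mL0 : measurable_fun setT (L0 : T0 -> Conf)) (iidL : iid_clusters P P0 X L0 L).
Hypotheses (fL0 : forall w, finite_set (L0 w)) (L0oo : (mean_card P0 L0 < +oo)%E).
Local Notation Z := (cluster_process X L).

Let mX i : measurable_fun setT (X i : T -> BE).
Proof. by have [] := poissonX. Qed.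

Let mL i : measurable_fun setT (L i : T -> Conf).
Proof. by have [/(_ i)[]] := iidL. Qed.

Let fL i w : finite_set (L i w).
Proof. by have [/(_ i)[]] := iidL. Qed.

Let mcontact a b C : borel C -> measurable (contact_in B u0 X L a b C).
Proof. exact: (measurable_contact_in u0 cB vB nB poissonX iidL). Qed.

(** The measure to differentiate is the law of the distance on the event [D] that it is positive and
    finite with direction in C. On [D] the distance is its own [fine] part, and the half-line up to
    0 has no mass. *)
Lemma FB_density (C : set E) : borel C -> exists f, is_density (FB P B u0 Z ^~ C) f.
Proof.
move=> mC; pose D := \bigcup_n contact_in B u0 X L 0 n%:R C.
have mD : measurable D by apply: bigcupT_measurable => n; exact: mcontact.
pose dist w := dB B 0 (Z w).
have mdist : measurable_fun setT (fine \o dist : T -> measurableTypeR R).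
  by apply: measurableT_comp => //; exact: (measurable_dist cB vB nB mX mL fL).
have mI (A : set (measurableTypeR R)) : measurable A -> measurable ((fine \o dist) @^-1` A `&` D).
  by move=> mA; apply: measurableI => //; exact: measurable_preimageT mA.
have fin : fin_num_fun (image_measure (mrestr P mD) mdist).
  by move=> A mA; apply: (fin_num_measure P); exact: mI.
have [m mE] : exists m : {finite_measure set (measurableTypeR R) -> \bar R},
    forall A, m A = P ((fine \o dist) @^-1` A `&` D).
  pose m : {finite_measure set (measurableTypeR R) -> \bar R} :=
    HB.pack (image_measure (mrestr P mD) mdist)
      (Measure_isFinite.Build _ _ _ (image_measure (mrestr P mD) mdist) fin).
  by exists m.
have mitv s t : 0 <= s -> s <= t ->
    m `]s, t]%classic = (FB P B u0 Z t C - FB P B u0 Z s C)%:E.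
  move=> s0 st; rewrite (FB_sub u0 cB vB nB poissonX iidL) // fineK; last first.
    by rewrite fin_num_measure //; exact: mcontact.
  rewrite mE; congr (P _); apply/seteqP; split => w /=.
    move=> [+ [n _ [dw dn Cw]]]; rewrite in_itv /= /dist.
    have dE : dB B 0 (Z w) = (fine (dB B 0 (Z w)))%:E.
      by rewrite fineK // ge0_fin_numE ?(ltW dw) // (le_lt_trans dn) ?ltry.
    by move=> /andP[sd dt]; split => //; rewrite dE ?lte_fin ?lee_fin.
  move=> [sd dt Cw].
  have dE : dB B 0 (Z w) = (fine (dB B 0 (Z w)))%:E.
    rewrite fineK // ge0_fin_numE ?dB_ge0 // (le_lt_trans dt) ?ltry //.
  split; first by rewrite in_itv /= -lte_fin -lee_fin -dE sd dt.
  exists (Num.truncn t).+1 => //; split => //.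
    by apply: le_lt_trans sd; rewrite lee_fin.
  by apply: le_trans dt _; rewrite lee_fin ltW // truncnS_gt.
have lip M s t : 0 <= s -> s <= t -> t <= M ->
    (m `]s, t]%classic <= (intensity_lip B P0 lam L0 (M + 1) * (t - s))%:E)%E.
  move=> s0 st tM; rewrite mitv // lee_fin.
  exact: (FB_increment_lip u0 cB vB nB d0 lam0 poissonX mL0 iidL fL0 L0oo).
have m0 : m `]-oo, 0]%classic = 0%E.
  rewrite mE [X in P X](_ : _ = set0) ?measure0 //; apply/seteqP; split => // w /=.
  move=> [+ [n _ [dw dn Cw]]]; rewrite in_itv /= /dist.
  have : (0 < (fine (dB B 0 (Z w)))%:E)%E.
    by rewrite fineK // ge0_fin_numE ?(ltW dw) // (le_lt_trans dn) ?ltry.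
  by rewrite lte_fin ltNge => /negP.
have [|f [mf f0 fm]] := lipschitz_measure_density _ lip m0.
  by move=> M M0; apply: intensity_lip_ge0 => //; rewrite addr_ge0.
exists f; split => //; first exact: measurable_funTS.
by move=> a b a0 ab; rewrite -fm mitv // ltW.
Qed.

End contact_density.

Lemma tie_shifts_null (R : realType) (d : nat) (B : set 'rV[R]_d)
    (dT0 : measure_display) (T0 : measurableType dT0) (P0 : probability T0 R)
    (L0 : T0 -> set 'rV[R]_d) :
  (0 < d)%N -> compact B -> convex_set B -> nbhs (0 : 'rV[R]_d) B ->
  typical_cluster P0 L0 -> difference_measure P0 L0 (tie_shifts (gauge B)) = 0%E.
Proof.
move=> d0 cB vB nB [_ _ ac]; have mg := measurable_gauge cB vB nB.
have mtie := measurable_tie_shifts mg.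
apply: ac => //; rewrite vol_lebesgueRd //; apply: lebesgueRd_tie_shifts => //.
by move=> c; exact: lebesgueRd_gauge_sphere.
Qed.

Theorem proposition3p13 (R : realType) (d : nat) (B : set 'rV[R]_d)
    (u0 : 'rV[R]_d)
    (dT : measure_display) (T : measurableType dT) (P : probability T R)
    (dT0 : measure_display) (T0 : measurableType dT0) (P0 : probability T0 R)
    (dT1 : measure_display) (T1 : measurableType dT1) (P1 : probability T1 R)
    (lam : R) (X : nat -> T -> 'rV[R]_d)
    (L0 : T0 -> set 'rV[R]_d) (L : nat -> T -> set 'rV[R]_d)
    (L0' : T1 -> set 'rV[R]_d) (L' : nat -> T -> set 'rV[R]_d)
    (W : T0 -> R) :
  (0 < d)%N ->
  compact B -> convex_set B -> nbhs (0 : 'rV[R]_d) B ->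
  boundary (reflection B) u0 ->
  0 < lam -> stationary_poisson P lam X ->
  typical_cluster P0 L0 -> iid_clusters P P0 X L0 L ->
  typical_cluster P1 L0' -> iid_clusters P P1 X L0' L' ->
  (lam%:E * mean_card P0 L0 = lam%:E * mean_card P1 L0')%E ->
  measurable_fun setT W -> {ae P0, forall w, 0 <= W w <= 1} ->
  same_law P1 P0 L0' (fun w => [set W w *: x | x in L0 w]) ->
  hazard_order P B u0 (cluster_process X L) (cluster_process X L').
Proof.
move=> d0 cB vB nB _ lam0 pX tL iL tL' iL' same mW W01 law.
have [[fL0 mL0] /andP[_ L0oo] _] := tL.
have [[fL1 mL1] /andP[_ L1oo] _] := tL'.
have tie1 := tie_shifts_null d0 cB vB nB tL'.
pose S t := 1 - FB P B u0 (cluster_process X L) t setT.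
pose S' t := 1 - FB P B u0 (cluster_process X L') t setT.
have S0 t : 0 < t -> 0 < S t.
  move=> t0; rewrite /S (survivalE u0 cB vB nB d0 lam0 pX mL0 iL fL0 L0oo) ?expR_gt0 //.
  exact: ltW.
have S0' t : 0 < t -> 0 < S' t.
  move=> t0; rewrite /S' (survivalE u0 cB vB nB d0 lam0 pX mL1 iL' fL1 L1oo) ?expR_gt0 //.
  exact: ltW.
have increments C t : borel C -> 0 < t -> exists K : R, forall h, 0 < h -> h <= 1 ->
    (FB P B u0 (cluster_process X L') (t + h) C -
     FB P B u0 (cluster_process X L') t C) / S' t <=
    (FB P B u0 (cluster_process X L) (t + h) C -
     FB P B u0 (cluster_process X L) t C) / S t + K * h ^+ 2.
  move=> mC t0; pose i := intensity_lip B P0 lam L0 (t + 2).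
  pose i' := intensity_lip B P1 lam L0' (t + 2).
  (* The upper bound is used with b' = t + 2h, whence the factor 2, and the lower bound with b = t +
     h. As h <= 1, all radii stay below t + 2. *)
  exists ((i' * 2) ^+ 2 / S' t + i ^+ 2 / S t) => h h0 h1.
  have tth : t <= t + h by rewrite lerDl ltW.
  have thh : t + h < t + 2 * h by rewrite ltrD2l; lra.
  have th2 : t + 2 * h <= t + 2 by rewrite lerD2l; lra.
  have up := FB_increment_le u0 cB vB nB d0 lam0 pX mL1 iL' fL1 L1oo tie1 mC (ltW t0) tth thh th2.
  have lo := FB_increment_ge u0 cB vB nB d0 lam0 pX mL0 iL fL0 L0oo mC (ltW t0) tth
    (ltW (lt_le_trans thh th2)).
  have mm := contact_intensity_contract cB vB nB d0 lam0 mL0 fL0 fL1 L0oo mW W01 mL1 law same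
    mC (ltW t0) tth.
  move: up lo; rewrite -/(S t) -/(S' t) -/i -/i'.
  set m' := contact_intensity B P1 _ _ _ _ _ in mm *.
  set m := contact_intensity B P0 _ _ _ _ _ in mm *.
  move=> up lo.
  (* After division by its own survival probability, the main term of each increment is 1 - exp(-m),
     which increases with the contact intensity m. *)
  apply: (@le_trans _ _ ((1 - expR (- m')) + (i' * 2) ^+ 2 / S' t * h ^+ 2)).
    rewrite ler_pdivrMr ?S0' //; apply: le_trans up _.
    rewrite le_eqVlt; apply/orP; left; apply/eqP; field.
    by rewrite gt_eqF // S0'.
  apply: (@le_trans _ _ ((1 - expR (- m)) + (i' * 2) ^+ 2 / S' t * h ^+ 2)).
    by rewrite lerD2r lerD2l lerN2 ler_expR lerN2.
  rewrite [X in _ <= _ + X]mulrDl addrCA [X in X <= _]addrC lerD2l.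
  rewrite -(ler_pM2l (S0 t t0)); apply: le_trans lo _.
  rewrite le_eqVlt; apply/orP; left; apply/eqP; field.
  by rewrite gt_eqF // S0.
have ratio C f f' : borel C ->
    is_density (FB P B u0 (cluster_process X L) ^~ C) f ->
    is_density (FB P B u0 (cluster_process X L') ^~ C) f' ->
    {ae lebesgue_measure, forall t, 0 < t -> f' t / S' t <= f t / S t}.
  by move=> mC df df'; apply: density_ratio_le df df' _ => t; exact: increments.
split; last first.
  move=> f f' df df' C mC.
  (* The ratios are compared at t > 0 only; the origin is a null set. *)
  have t0 : {ae (@lebesgue_measure R), forall t : R, t != 0}.
    exists [set 0]; split; [exact: measurable_set1|exact: lebesgue_measure_set1|].
    by move=> t /= /negP; rewrite negbK => /eqP.
  have aeF : Filter (nbhs (almost_everywhere (@lebesgue_measure R))) :=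
    ae_filter_ringOfSetsType _.
  apply: filterS2 (ratio C _ _ mC (df C mC) (df' C mC)) t0 => t H tn t0.
  by apply: H; rewrite lt_neqAle eq_sym tn.
(* A version of the densities is chosen separately for each C, with dummy values when C is not
   Borel. *)
have /choice[ff ffP] : forall C, exists ff : (R -> R) * (R -> R), borel C ->
    [/\ is_density (FB P B u0 (cluster_process X L) ^~ C) ff.1,
        is_density (FB P B u0 (cluster_process X L') ^~ C) ff.2 &
        forall t, 0 <= t -> ff.2 t / S' t <= ff.1 t / S t].
  move=> C; have [mC|nC] := pselect (borel C); last by exists (cst 0, cst 0).
  have [f df] := FB_density u0 cB vB nB d0 lam0 pX mL0 iL fL0 L0oo mC.
  have [f' df'] := FB_density u0 cB vB nB d0 lam0 pX mL1 iL' fL1 L1oo mC.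
  have [N [mN N0 HN]] := ratio C f f' mC df df'.
  pose D := ~` N `&` `]0, +oo[%classic.
  (* Both densities vanish on the exceptional null set and at t = 0, where the inequality becomes 0
     <= 0. *)
  exists (fun t => f t * \1_D t, fun t => f' t * \1_D t) => _.
  split; [exact: is_density_restrict|exact: is_density_restrict|move=> t t0 /=].
  rewrite indicE; have [tD|tD] := pselect (D t); last first.
    by rewrite memNset //= !mulr0 !mul0r.
  rewrite mem_set //= !mulr1; case: tD => nN; rewrite /= in_itv /= andbT => tp.
  by apply: contrapT => nt; apply: nN; apply: HN => /= /(_ tp).
exists (fun t C => (ff C).1 t), (fun t C => (ff C).2 t); split.
- by move=> C /ffP[].
- by move=> C /ffP[].
- by move=> t C t0 /ffP[_ _]; exact.
Qed.
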